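(* Let $M_p$, $A_p$ be weight sequences satisfying the standing assumptions and let $\mathcal{W}=(w_N)_{N}$ be an increasing weight system on $\mathbb{R}^d$ satisfying the standing assumptions (see context). Let $(\ast,\dagger)$ be either $((M_p),(A_p))$ (Beurling case) or $(\{M_p\},\{A_p\})$ (Roumieu case). Let $f \in \mathcal{S}'^\ast_\dagger(\mathbb{R}^d)$. The following statements are equivalent: (i) $f \in \mathcal{B}'^{\ast}_{\mathcal{W}}(\mathbb{R}^d)$. (ii) $f \ast \varphi \in \mathcal{W}^\circ C(\mathbb{R}^d)$ for all $\varphi \in \mathcal{S}^\ast_\dagger(\mathbb{R}^d)$. (iii) $f \ast \varphi \in \mathcal{W}^\circ C(\mathbb{R}^d)$ for all $\varphi \in \mathcal{S}^\ast_\dagger(\mathbb{R}^d)$ and the mapping $\ast_f : \mathcal{S}^\ast_\dagger(\mathbb{R}^d) \rightarrow \mathcal{W}^\circ C(\mathbb{R}^d)$, $\varphi \mapsto f \ast \varphi$, is continuous. (iv) $f \ast \varphi \in \mathcal{B}^\ast_{\mathcal{W}^\circ}(\mathbb{R}^d)$ for all $\varphi \in \mathcal{S}^\ast_\dagger(\mathbb{R}^d)$. (v) $f \ast \varphi \in \mathcal{B}^\ast_{\mathcal{W}^\circ}(\mathbb{R}^d)$ for all $\varphi \in \mathcal{S}^\ast_\dagger(\mathbb{R}^d)$ and the mapping $\ast_f : \mathcal{S}^\ast_\dagger(\mathbb{R}^d) \rightarrow \mathcal{B}^\ast_{\mathcal{W}^\circ}(\mathbb{R}^d)$, $\varphi \mapsto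 f \ast \varphi$, is continuous.
   Context: Weight sequences. For a sequence $(M_p)_{p\in\mathbb{N}}$ of positive reals ($\mathbb N=\{0,1,2,\dots\}$) put $m_p := M_p/M_{p-1}$, $p\ge 1$. It is a weight sequence if $m_p\to\infty$. Write $M_\alpha=M_{|\alpha|}$ for $\alpha\in\mathbb{N}^d$. $(M.1)$: $M_p^2\le M_{p-1}M_{p+1}$, $p\ge1$. $(M.2)$: $M_{p+q}\le C_0H^{p+q}M_pM_q$ for all $p,q$, for some $C_0,H\ge1$. $M_p\prec N_p$ means: for every $h>0$ there is $C>0$ with $M_p\le Ch^pN_p$ for all $p$. The associated function of $A_p$ is $A(t)=\sup_{p}\log(t^pA_0/A_p)$ for $t>0$, $A(0)=0$, and $A(x)=A(|x|)$ for $x\in\mathbb{R}^d$. Gelfand-Shilov spaces. $\mathcal{S}^{M_p,h}_{A_p,\lambda}(\mathbb{R}^d)$ ($h,\lambda>0$) is the Banach space of $\varphi\in C^\infty(\mathbb{R}^d)$ with $\sup_{\alpha}\sup_{x}h^{|\alpha|}|\varphi^{(\alpha)}(x)|e^{A(\lambda x)}/M_\alpha<\infty$; $\mathcal{S}^{(M_p)}_{(A_p)}(\mathbb{R}^d)=\varprojlim_{h\to\infty}\mathcal{S}^{M_p,h}_{A_p,h}(\mathbb{R}^d)$, $\mathcal{S}^{\{M_p\}}_{\{A_p\}}(\mathbb{R}^d)=\varinjlim_{h\to0^+}\mathcal{S}^{M_p,h}_{A_p,h}(\mathbb{R}^d)$; $\mathcal{S}'^\ast_\dagger$ denotes the dual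 of $\mathcal{S}^\ast_\dagger$. Weight systems. An increasing (decreasing) weight system on $\mathbb{R}^d$ is a pointwise increasing (decreasing) sequence of positive continuous functions on $\mathbb R^d$. For an increasing weight system $\mathcal{W}=(w_N)_N$ the dual weight system is the decreasing weight system $\mathcal{W}^\circ=(w_N^{-1})_N$. For a positive continuous $w$ and $h>0$, $\mathcal{B}^{M_p,h}_w(\mathbb{R}^d)$ is the Banach space of $\varphi\in C^\infty(\mathbb{R}^d)$ with $\sup_{\alpha}\sup_{x}h^{|\alpha|}|\varphi^{(\alpha)}(x)|w(x)/M_\alpha<\infty$; $\mathcal{B}^{(M_p)}_w=\varprojlim_{h\to\infty}\mathcal{B}^{M_p,h}_w$, $\mathcal{B}^{\{M_p\}}_w=\varinjlim_{h\to0^+}\mathcal{B}^{M_p,h}_w$. For increasing $\mathcal{W}$: $\mathcal{B}^{M_p,h}_\mathcal{W}=\varprojlim_N\mathcal{B}^{M_p,h}_{w_N}$, $\mathcal{B}^{(M_p)}_\mathcal{W}=\varprojlim_{h\to\infty}\mathcal{B}^{M_p,h}_\mathcal{W}$, $\mathcal{B}^{\{M_p\}}_\mathcal{W}=\varinjlim_{h\to0^+}\mathcal{B}^{M_p,h}_\mathcal{W}$. For decreasing $\mathcal{V}=(v_n)_n$: $\mathcal{B}^{\ast}_\mathcal{V}=\varinjlim_n\mathcal{B}^{\ast}_{v_n}$ for $\ast=(M_p)$ or $\{M_p\}$, and $\mathcal{V}C(\mathbb{R}^d)=\varinjlim_n Cv_n(\mathbb{R}^d)$, where $Cv(\mathbb{R}^d)$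 is the Banach space of $f\in C(\mathbb{R}^d)$ with $\|f\|_v=\sup_x|f(x)|v(x)<\infty$. Standing assumptions. $M_p$ and $A_p$ satisfy $(M.1)$ and $(M.2)$, $p!\prec M_pA_p$, and $\mathcal{S}^{(M_p)}_{(A_p)}(\mathbb{R}^d)\neq\{0\}$. The increasing weight system $\mathcal{W}$ satisfies $\forall N\,\exists M>N:\ w_N(x)/w_M(x)=O(|x|^{-(d+1)})$, and is $(A_p)$-admissible in the Beurling case, i.e. $\forall N\,\exists\lambda>0\,\exists M\ge N\,\exists C>0\,\forall x,t\in\mathbb R^d:\ w_N(x+t)\le Cw_M(x)e^{A(\lambda t)}$, respectively $\{A_p\}$-admissible in the Roumieu case, i.e. $\forall N\,\forall\lambda>0\,\exists M\ge N\,\exists C>0\,\forall x,t:\ w_N(x+t)\le Cw_M(x)e^{A(\lambda t)}$. Under these assumptions $\mathcal{S}^\ast_\dagger(\mathbb{R}^d)$ is densely and continuously included in $\mathcal{B}^\ast_\mathcal{W}(\mathbb{R}^d)$, so the dual $\mathcal{B}'^\ast_\mathcal{W}(\mathbb{R}^d)$ is regarded as a subspace of $\mathcal{S}'^\ast_\dagger(\mathbb{R}^d)$. Convolution: $(f\ast\varphi)(x)=\langle f,T_x\check\varphi\rangle=\langle f,\varphi(x-\cdot)\rangle$. *)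

(* Defs.v *)
From HB Require Import structures.
From mathcomp Require Import all_boot all_order all_algebra.
From mathcomp Require Import all_classical all_reals all_analysis.
From mathcomp Require Import complex ring lra.

Set Implicit Arguments.
Unset Strict Implicit.
Unset Printing Implicit Defensive.

Import Order.TTheory GRing.Theory Num.Theory numFieldNormedType.Exports.
Import Normc.

Local Open Scope classical_set_scope.
Local Open Scope ring_scope.

Section LocallyConvex.
Context {R : realType} {F : lmodType R[i]}.

Definition seminorm_on (E : set F) (q : F -> R) :=
  (forall a x, E x -> q (a *: x) = normc a * q x) /\
  (forall x y, E x -> E y -> q (x + y) <= q x + q y).

(* A locally convex space sitting (as a vector space) inside F: a linear      *)
(* subspace together with a generating family of seminorms. The seminorms are *)
(* total functions on F, but only their values on the subspace matter.        *)
Record lcspace := LCSpace {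
  lcs_set : set F;
  lcs_sn : set (F -> R);
  lcs_set0 : lcs_set 0;
  lcs_setP : forall a x y, lcs_set x -> lcs_set y -> lcs_set (a *: x + y);
  lcs_snP : forall q, lcs_sn q -> seminorm_on lcs_set q }.

Definition lcs_pred (E : lcspace) : {pred F} := fun x => x \in lcs_set E.

Fact lcs_pred_submod (E : lcspace) : submod_closed (lcs_pred E).
Proof.
split; first by rewrite unfold_in; apply/mem_set/lcs_set0.
move=> a x y; rewrite !unfold_in => /set_mem xE /set_mem yE.
exact/mem_set/lcs_setP.
Qed.

HB.instance Definition _ (E : lcspace) :=
  GRing.isSubmodClosed.Build R[i] F (lcs_pred E) (lcs_pred_submod E).

Record lcs_elt (E : lcspace) := LCSElt {
  lcs_val : F;
  lcs_valP : lcs_val \in lcs_pred E }.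

Coercion lcs_elt : lcspace >-> Sortclass.

HB.instance Definition _ (E : lcspace) := [isSub for @lcs_val E].
HB.instance Definition _ (E : lcspace) := [Choice of lcs_elt E by <:].
HB.instance Definition _ (E : lcspace) :=
  [SubChoice_isSubLmodule of lcs_elt E by <:].

Lemma lcs_eltP (E : lcspace) (x : lcs_elt E) : lcs_set E (val x).
Proof. exact: set_mem (valP x). Qed.

Definition lcs_ball (E : lcspace) (x : lcs_elt E) (s : seq (F -> R)) (e : R) :
  set (lcs_elt E) := [set y | forall q, q \in s -> q (val (y - x)) < e].

Definition lcs_nbhs (E : lcspace) (x : lcs_elt E) : set_system (lcs_elt E) :=
  [set U | exists s e, [/\ forall q, q \in s -> lcs_sn E q, 0 < e &
                         lcs_ball x s e `<=` U]].

HB.instance Definition _ (E : lcspace) := hasNbhs.Build (lcs_elt E) (@lcs_nbhs E).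

Section Topology.
Variable E : lcspace.
Implicit Types (x y z : lcs_elt E) (q : F -> R).

Lemma lcs_sn0 q : lcs_sn E q -> q 0 = 0.
Proof.
move=> /lcs_snP[qZ _]; rewrite -(scale0r (0 : F)) qZ ?normc0 ?mul0r//.
exact: lcs_set0.
Qed.

Lemma lcs_snZ q a x : lcs_sn E q -> q (val (a *: x)) = normc a * q (val x).
Proof. by move=> /lcs_snP[qZ _]; rewrite linearZ qZ//; exact: lcs_eltP. Qed.

Lemma lcs_snD q x y : lcs_sn E q -> q (val (x + y)) <= q (val x) + q (val y).
Proof.
by move=> /lcs_snP[_ qD]; rewrite raddfD/=; apply: qD; exact: lcs_eltP.
Qed.

Lemma lcs_snN q x : lcs_sn E q -> q (val (- x)) = q (val x).
Proof.
move=> qE; rewrite -scaleN1r lcs_snZ// -[RHS]mul1r; congr (_ * _).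
by rewrite /normc/= oppr0 expr0n/= addr0 sqrrN expr1n sqrtr1.
Qed.

Lemma lcs_sn_ge0 q x : lcs_sn E q -> 0 <= q (val x).
Proof.
move=> qE; have := lcs_snD x (- x) qE.
by rewrite subrr lcs_sn0// lcs_snN// -mulr2n pmulrn_lge0.
Qed.

Lemma lcs_ballxx x s e : (forall q, q \in s -> lcs_sn E q) -> 0 < e ->
  lcs_ball x s e x.
Proof. by move=> sE e0 q qs; rewrite subrr lcs_sn0//; exact: sE. Qed.

Lemma lcs_ball_nbhs x s e : (forall q, q \in s -> lcs_sn E q) -> 0 < e ->
  lcs_nbhs x (lcs_ball x s e).
Proof. by move=> sE e0; exists s, e; split. Qed.

Lemma lcs_ball_open x y s e : (forall q, q \in s -> lcs_sn E q) ->
  lcs_ball x s e y -> lcs_nbhs y (lcs_ball x s e).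
Proof.
elim: s => [|q s IH] sE yx.
  by exists [::], 1; split => // z _ p; rewrite in_nil.
have [|p ps|t [r [tE r0 trs]]] := IH.
- by move=> p ps; apply: sE; rewrite inE ps orbT.
- by apply: yx; rewrite inE ps orbT.
have qE : lcs_sn E q by apply: sE; rewrite inE eqxx.
have qyx : q (val (y - x)) < e by apply: yx; rewrite inE eqxx.
exists (q :: t), (Num.min r (e - q (val (y - x)))); split.
- by move=> p; rewrite inE => /predU1P[->//|]; exact: tE.
- by rewrite lt_min r0 subr_gt0.
- move=> z zy p; rewrite inE => /predU1P[->|ps].
    have := zy q; rewrite inE eqxx => /(_ isT); rewrite lt_min => /andP[_].
    rewrite ltrBrDr; apply: le_lt_trans.
    by rewrite -[z - x](subrKA y); exact: lcs_snD.
  apply: trs => // p' p't.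
  by have := zy p'; rewrite inE p't orbT lt_min => /(_ isT)/andP[].
Qed.

Fact lcs_nbhs_filter x : ProperFilter (nbhs x).
Proof.
split.
  by move=> -[s [e [sE e0 /(_ x)]]]; apply; exact: lcs_ballxx.
split.
- by exists [::], 1; split.
- move=> A B [s [e [sE e0 sA]]] [t [r [tE r0 tB]]].
  exists (s ++ t), (Num.min e r); split.
  + by move=> q; rewrite mem_cat => /orP[/sE|/tE].
  + by rewrite lt_min e0.
  + move=> y yx; split; [apply: sA|apply: tB] => q qs;
    by have := yx q; rewrite mem_cat qs ?orbT lt_min => /(_ isT)/andP[].
- move=> A B AB [s [e [sE e0 sA]]]; exists s, e; split => //.
  exact: subset_trans AB.
Qed.

Fact lcs_nbhs_singleton x (A : set (lcs_elt E)) : nbhs x A -> A x.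
Proof. by move=> [s [e [sE e0]]]; apply; exact: lcs_ballxx. Qed.

Fact lcs_nbhs_nbhs x (A : set (lcs_elt E)) : nbhs x A -> nbhs x (nbhs^~ A).
Proof.
move=> [s [e [sE e0 sA]]]; exists s, e; split => // y yx.
have [t [r [tE r0 trs]]] := lcs_ball_open sE yx.
by exists t, r; split => //; exact: subset_trans sA.
Qed.

HB.instance Definition _ := Nbhs_isNbhsTopological.Build (lcs_elt E)
  lcs_nbhs_filter lcs_nbhs_singleton lcs_nbhs_nbhs.

Fact lcs_add_continuous : continuous (fun x : lcs_elt E * lcs_elt E => x.1 + x.2).
Proof.
move=> [x y] A [s [e [sE e0 sA]]].
have e20 : 0 < e / 2 by rewrite divr_gt0.
exists (lcs_ball x s (e / 2), lcs_ball y s (e / 2)).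
  by split; exact: lcs_ball_nbhs.
move=> [x' y'] [/= x'x y'y]; apply: sA => q qs.
change (q (val ((x' + y') - (x + y))) < e).
rewrite opprD addrACA (splitr e).
apply: le_lt_trans (lcs_snD _ _ (sE _ qs)) _.
by apply: ltrD; [exact: x'x|exact: y'y].
Qed.

Fact lcs_scale_continuous :
  continuous (fun z : R[i]^o * lcs_elt E => z.1 *: z.2).
Proof.
move=> [a x] A [s [e [sE e0 sA]]].
pose M := 1 + \sum_(q <- s) q (val x).
have M_ge1 : 1 <= M.
  rewrite lerDl big_seq; apply: sumr_ge0 => q qs; exact/lcs_sn_ge0/sE.
have M_gt0 : 0 < M by apply: lt_le_trans M_ge1.
have qM q : q \in s -> q (val x) < M.
  move=> qs; rewrite /M (big_rem q)//=; apply: ltr_pwDl => //; rewrite lerDl.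
  rewrite big_seq; apply: sumr_ge0 => p /mem_rem ps; exact/lcs_sn_ge0/sE.
pose N := 1 + normc a.
have N_gt0 : 0 < N.
  by rewrite ltr_pwDl//; case: (a) => u v; exact: sqrtr_ge0.
pose k := Num.min 1 (e / 2 / M).
have k0 : 0 < k by rewrite lt_min ltr01 !divr_gt0.
exists (ball a k%:C%C, lcs_ball x s (e / 2 / N)).
  split; last by apply: lcs_ball_nbhs => //; rewrite !divr_gt0.
  by apply: nbhsx_ballx; rewrite ltcR.
move=> [b y] [/= ba yx]; apply: sA => q qs.
have qE := sE _ qs.
have {}ba : normc (b - a) < k.
  by move: ba; rewrite -ball_normE/= distrC -ltcR.
change (q (val (b *: y - a *: x)) < e).
have -> : b *: y - a *: x = b *: (y - x) + (b - a) *: x.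
  by rewrite scalerBr scalerBl addrA subrK.
apply: le_lt_trans (lcs_snD _ _ qE) _; rewrite !lcs_snZ// (splitr e).
apply: ltr_leD.
  have bN : normc b <= N.
    rewrite -[b](subrK a) /N; apply: le_trans (le_normcD _ _) _.
    by rewrite lerD2r; apply: ltW; apply: lt_le_trans ba _; rewrite ge_min lexx.
  have := yx q qs; rewrite ltr_pdivlMr// mulrC; apply: le_lt_trans.
  by rewrite ler_wpM2r// lcs_sn_ge0.
have kM : k <= e / 2 / M by rewrite ge_min lexx orbT.
have := le_trans (ltW ba) kM; rewrite ler_pdivlMr//; apply: le_trans.
apply: ler_wpM2l; last exact/ltW/qM.
by case: (b - a) => u v; exact: sqrtr_ge0.
Qed.

Local Open Scope convex_scope.

Fact lcs_ball_convex x s e : (forall q, q \in s -> lcs_sn E q) ->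
  convex_set (lcs_ball x s e).
Proof.
move=> sE; apply/convex_setW => y z; rewrite !inE => yx zx l l0 l1.
rewrite inE => q qs.
have qE := sE _ qs.
pose t := complex.Re l%:num.
have tE : l%:num = t%:C%C by rewrite RRe_real// ger0_real.
have t0 : 0 < t by rewrite -ltcR -tE.
have t1 : t < 1 by rewrite -ltcR -tE.
rewrite [_ - x](_ : _ = t%:C%C *: (y - x) + (1 - t)%:C%C *: (z - x)); last first.
  have -> : (1 - t)%:C%C = 1 - t%:C%C :> R[i] by rewrite rmorphB rmorph1.
  rewrite -tE.
  change (l%:num *: (y : lcs_elt E) + (1 - l%:num) *: (z : lcs_elt E) - x =
    l%:num *: ((y : lcs_elt E) - x) + (1 - l%:num) *: ((z : lcs_elt E) - x)).
  rewrite !(scalerBr _ _ x) addrACA -opprD -scalerDl.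
  by rewrite (addrC l%:num) subrK scale1r.
apply: le_lt_trans (lcs_snD _ _ qE) _; rewrite !lcs_snZ//.
have nC (u : R) : 0 < u -> normc u%:C%C = u.
  by move=> u0; rewrite /normc/= expr0n/= addr0 sqrtr_sqr gtr0_norm.
rewrite !nC ?subr_gt0//.
have -> : e = t * e + (1 - t) * e by rewrite -mulrDl addrC subrK mul1r.
by rewrite ltrD// ltr_pM2l ?subr_gt0//; [exact: yx|exact: zx].
Qed.

Fact lcs_locally_convex : exists2 B : set_system (lcs_elt E),
  (forall b, b \in B -> convex_set b) & basis B.
Proof.
exists [set b | exists x s e,
    (forall q, q \in s -> lcs_sn E q) /\ b = lcs_ball x s e].
  by move=> b; rewrite inE => -[x [s [e [sE ->]]]]; exact: lcs_ball_convex.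
split.
  move=> b [x [s [e [sE ->]]]]; rewrite openE => y yx.
  exact: lcs_ball_open.
move=> x A [s [e [sE e0 sA]]]; exists (lcs_ball x s e) => //.
by split; [exists x, s, e|exact: lcs_ballxx].
Qed.

HB.instance Definition _ := PreTopologicalLmod_isTvs.Build R[i] (lcs_elt E)
  lcs_add_continuous lcs_scale_continuous lcs_locally_convex.

End Topology.

Lemma seminorm_onS (E E' : set F) q :
  E' `<=` E -> seminorm_on E q -> seminorm_on E' q.
Proof.
by move=> E'E [qZ qD]; split => [a x /E'E|x y /E'E xE /E'E]; [exact: qZ|exact: qD].
Qed.

Section ProjectiveLimit.
Context {I : Type} (E : I -> lcspace).

Fact projlim_set0 : (\bigcap_i lcs_set (E i)) 0.
Proof. by move=> i _; exact: lcs_set0. Qed.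

Fact projlim_setP a x y : (\bigcap_i lcs_set (E i)) x ->
  (\bigcap_i lcs_set (E i)) y -> (\bigcap_i lcs_set (E i)) (a *: x + y).
Proof. by move=> xE yE i _; apply: lcs_setP; [exact: xE|exact: yE]. Qed.

Fact projlim_snP q : (\bigcup_i lcs_sn (E i)) q ->
  seminorm_on (\bigcap_i lcs_set (E i)) q.
Proof.
move=> [i _ /lcs_snP]; apply: seminorm_onS; exact: bigcap_inf.
Qed.

(* Projective limit along the inclusions: the intersection with the initial   *)
(* topology.                                                                  *)
Definition projlim : lcspace :=
  LCSpace projlim_set0 projlim_setP projlim_snP.

End ProjectiveLimit.

Section InductiveLimit.
Context {I : Type} (E : I -> lcspace).

Definition indlim_set : set F := [set x | exists2 s : seq F,
  (forall y, y \in s -> exists i, lcs_set (E i) y) & x = \sum_(y <- s) y].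

(* the seminorms whose restriction to each step is continuous *)
Definition indlim_sn : set (F -> R) := [set q | seminorm_on indlim_set q /\
  forall i, continuous (fun x : E i => q (val x) : R^o)].

Fact indlim_set0 : indlim_set 0.
Proof. by exists [::]; rewrite ?big_nil. Qed.

Fact indlim_setP a x y :
  indlim_set x -> indlim_set y -> indlim_set (a *: x + y).
Proof.
move=> [s sE ->] [t tE ->]; exists ([seq a *: z | z <- s] ++ t).
  move=> z; rewrite mem_cat => /orP[/mapP[z' /sE[i z'E] ->]|/tE//].
  exists i; rewrite -[_ *: _]addr0; apply: lcs_setP => //; exact: lcs_set0.
by rewrite big_cat/= big_map scaler_sumr.
Qed.

Fact indlim_snP q : indlim_sn q -> seminorm_on indlim_set q.
Proof. by case. Qed.

(* Locally convex inductive limit along the inclusions: the linear hull of    *)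
(* the union (see indlim_setE) with the finest locally convex topology making *)
(* all the inclusions continuous.                                             *)
Definition indlim : lcspace :=
  LCSpace indlim_set0 indlim_setP indlim_snP.

Lemma indlim_setE : inhabited I ->
  (forall i j, exists k, lcs_set (E i) `|` lcs_set (E j) `<=` lcs_set (E k)) ->
  lcs_set indlim = \bigcup_i lcs_set (E i).
Proof.
move=> [i0] dirE; apply/seteqP; split => x.
  move=> [s sE ->]; elim: s sE => [_|y s IH sE].
    by rewrite big_nil; exists i0 => //; exact: lcs_set0.
  have [|i _ siE] := IH; first by move=> z zs; apply: sE; rewrite inE zs orbT.
  have [j yjE] := sE y (mem_head _ _).
  have [k ijk] := dirE i j; exists k => //.
  rewrite big_cons -[y]scale1r; apply: lcs_setP.
    by apply: ijk; right.
  by apply: ijk; left.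
move=> [i _ xE]; exists [:: x]; last by rewrite big_seq1.
by move=> y; rewrite inE => /eqP ->; exists i.
Qed.

End InductiveLimit.

Section SupNorm.
Context {J : Type} (j0 : J) (E : set F) (p : J -> F -> R).
Context (E0 : E 0) (EP : forall a x y, E x -> E y -> E (a *: x + y)).
Context (pP : forall j, seminorm_on E (p j)).

Definition sup_set : set F := [set x | E x /\ has_ubound (range (p^~ x))].
Definition sup_norm (x : F) : R := sup (range (p^~ x)).

Let p_ge0 j x : E x -> 0 <= p j x.
Proof.
move=> xE; have [pZ pD] := pP j.
have p0 : p j 0 = 0 by rewrite -(scale0r (0 : F)) pZ// Normc.normc0 mul0r.
have NxE : E (- x) by rewrite -scaleN1r -[_ *: _]addr0; exact: EP.
have := pD _ _ xE NxE; rewrite subrr p0 -scaleN1r pZ//.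
have -> : normc (-1 : R[i]) = 1.
  by rewrite /normc/= oppr0 expr0n/= addr0 sqrrN expr1n sqrtr1.
by rewrite mul1r -mulr2n pmulrn_lge0.
Qed.

Let normc_ge0 (a : R[i]) : 0 <= normc a.
Proof. by case: a => u v; exact: sqrtr_ge0. Qed.

Fact sup_set0 : sup_set 0.
Proof.
split => //; exists 0 => _ [j _ <-]/=; have [pZ _] := pP j.
by rewrite -(scale0r (0 : F)) pZ// Normc.normc0 mul0r.
Qed.

Fact sup_setP a x y : sup_set x -> sup_set y -> sup_set (a *: x + y).
Proof.
move=> [xE [b xb]] [yE [c yc]]; split; first exact: EP.
exists (normc a * b + c) => _ [j _ <-]/=; have [pZ pD] := pP j.
have axE : E (a *: x) by rewrite -[_ *: _]addr0; exact: EP.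
rewrite (le_trans (pD _ _ axE yE))// lerD//; last by apply: yc; exists j.
by rewrite pZ// ler_wpM2l//; apply: xb; exists j.
Qed.

Let sup_normZ_le a x : sup_set x -> sup_norm (a *: x) <= normc a * sup_norm x.
Proof.
move=> [xE xb]; apply: ge_sup; first by exists (p j0 (a *: x)), j0.
move=> _ [j _ <-]; have [pZ _] := pP j; rewrite pZ// ler_wpM2l//.
by apply: ub_le_sup => //; exists j.
Qed.

Fact sup_normP q : [set sup_norm] q -> seminorm_on sup_set q.
Proof.
move=> ->; split => [a x xE|x y [xE xb] [yE yb]].
  apply/eqP; rewrite eq_le sup_normZ_le//=.
  have [->|a0] := eqVneq a 0.
    rewrite Normc.normc0 mul0r.
    have [j ->] : exists j, 0 = p j (0 *: x).
      by exists j0; have [pZ _] := pP j0; rewrite pZ ?Normc.normc0 ?mul0r//; case: xE.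
    apply: ub_le_sup; last by exists j.
    have : sup_set (0 *: x + 0) by apply: sup_setP => //; exact: sup_set0.
    by rewrite addr0 => -[].
  have a_gt0 : 0 < normc a.
    rewrite lt_def normc_ge0 andbT; apply: contra a0 => /eqP.
    by move/Normc.eq0_normc => ->.
  rewrite -ler_pdivlMl// -Normc.normcV//.
  apply: le_trans (sup_normZ_le _ _).
    by rewrite scalerA mulVf// scale1r.
  rewrite -[_ *: _]addr0; apply: sup_setP => //; exact: sup_set0.
apply: ge_sup; first by exists (p j0 (x + y)), j0.
move=> _ [j _ <-]; have [_ pD] := pP j.
by rewrite (le_trans (pD _ _ xE yE))// lerD//; apply: ub_le_sup => //; exists j.
Qed.

Definition supspace : lcspace := LCSpace sup_set0 sup_setP sup_normP.

End SupNorm.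

End LocallyConvex.

Section WeightSequences.
Context {R : realType}.
Implicit Types M N A : nat -> {posnum R}.

Definition weight_seq M := ((M p.+1)%:num / (M p)%:num) @[p --> \oo] --> +oo.

Definition M1 M := forall p, (0 < p)%N ->
  (M p)%:num ^+ 2 <= (M p.-1)%:num * (M p.+1)%:num.

Definition M2 M := exists C H : R, [/\ 1 <= C, 1 <= H & forall p q,
  (M (p + q)%N)%:num <= C * H ^+ (p + q) * (M p)%:num * (M q)%:num].

Definition seq_prec (M N : nat -> R) := forall h : R, 0 < h ->
  exists2 C : R, 0 < C & forall p, M p <= C * h ^+ p * N p.

(* For a weight sequence the supremum is finite (assoc_fun_has_ubound), so the *)
(* real-valued sup is the intended one.                                       *)
Definition assoc_fun A (t : R) : R :=
  if t == 0 then 0 else sup (range (fun p => ln (t ^+ p * (A 0)%:num / (A p)%:num))).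

Lemma assoc_fun_has_ubound A t : weight_seq A -> 0 < t ->
  has_ubound (range (fun p => ln (t ^+ p * (A 0)%:num / (A p)%:num))).
Proof.
move=> wA t0; pose r p := t ^+ p * (A 0)%:num / (A p)%:num.
have r0 p : 0 < r p by rewrite !mulr_gt0// exprn_gt0.
have [N _ AN] : \forall p \near \oo, t <= (A p.+1)%:num / (A p)%:num.
  by move/cvgryPge : wA; exact.
have rS p : (N <= p)%N -> r p.+1 <= r p.
  move=> /AN; rewrite ler_pdivlMr// => tA.
  have -> : r p.+1 = r p * (t * (A p)%:num / (A p.+1)%:num).
    by rewrite /r exprSr; field; rewrite !gt_eqF.
  by rewrite ler_piMr ?(ltW (r0 p))// ler_pdivrMr// mul1r.
pose S := \sum_(p < N.+1) r p.
have rle p : r p <= S.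
  have rleN q : (q <= N)%N -> r q <= S.
    move=> qN; rewrite /S (bigD1 (Ordinal (qN : (q < N.+1)%N)))//= lerDl.
    by apply: sumr_ge0 => *; exact: ltW.
  have [/rleN//|/ltnW] := leqP p N.
  move=> /subnK <-; elim: (p - N)%N => [|k IH]; first exact: rleN.
  by rewrite addSn; apply: le_trans IH; apply: rS; rewrite leq_addl.
exists (ln S) => _ [p _ <-]; rewrite ler_ln ?posrE//; first exact: rle.
  exact: (r0 p).
exact: lt_le_trans (r0 0%N) (rle 0%N).
Qed.

Lemma assoc_fun_ge0 A t : weight_seq A -> 0 <= t -> 0 <= assoc_fun A t.
Proof.
rewrite /assoc_fun le_eqVlt eq_sym => wA; case: eqP => //= _ t0.
apply: ub_le_sup; first exact: assoc_fun_has_ubound.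
by exists 0%N => //; rewrite mul1r divff// ln1.
Qed.

Lemma assoc_fun_le A s t : weight_seq A -> 0 <= s -> s <= t ->
  assoc_fun A s <= assoc_fun A t.
Proof.
move=> wA s0 st; have [->|sn0] := eqVneq s 0.
  by rewrite {1}/assoc_fun eqxx assoc_fun_ge0// (le_trans s0).
have {}s0 : 0 < s by rewrite lt_def sn0.
have t0 : 0 < t by exact: lt_le_trans st.
rewrite /assoc_fun !gt_eqF//; apply: ge_sup; first by eexists; exists 0%N.
move=> _ [p _ <-]; apply: le_trans (ub_le_sup (assoc_fun_has_ubound wA t0) _).
  2: by exists p.
rewrite ler_ln ?posrE ?mulr_gt0 ?exprn_gt0// ler_wpM2r// ler_wpM2r//.
by rewrite lerXn2r// ?nnegrE ltW.
Qed.

End WeightSequences.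

Section Functions.
Context {R : realType} {d : nat}.
Local Notation V := 'rV[R]_d.
Local Notation F := (V -> R[i]^o).

Definition enorm (x : V) : R := Num.sqrt (\sum_(i < d) x ord0 i ^+ 2).

(* C is not a normed module over R here, so real partial derivatives are taken *)
(* on the real and imaginary parts.                                           *)
Definition reF (phi : F) (x : V) : R^o := complex.Re (phi x).
Definition imF (phi : F) (x : V) : R^o := complex.Im (phi x).

Definition pderivable (i : 'I_d) (phi : F) := forall x,
  derivable (reF phi) x (delta_mx ord0 i) /\
  derivable (imF phi) x (delta_mx ord0 i).

Definition pderiv (i : 'I_d) (phi : F) : F := fun x =>
  ('D_(delta_mx ord0 i) (reF phi) x +i* 'D_(delta_mx ord0 i) (imF phi) x)%C.

(* pderivs [:: i1; ...; ik] phi is the iterated partial derivative            *)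
(* d_i1 (... (d_ik phi))                                                      *)
Definition pderivs (s : seq 'I_d) (phi : F) : F := foldr pderiv phi s.

(* C^oo: all iterated partial derivatives exist everywhere and are continuous *)
Definition smooth (phi : F) := forall s,
  continuous (pderivs s phi) /\ forall i, pderivable i (pderivs s phi).

Definition multi_index := {ffun 'I_d -> nat}.
Definition mi_len (alpha : multi_index) : nat := (\sum_(i < d) alpha i)%N.

Definition mderiv (alpha : multi_index) : F -> F :=
  pderivs (flatten [seq nseq (alpha i) i | i <- enum 'I_d]).

Let derive_lin (u v w : V -> R^o) (k l : R) x e :
  derivable u x e -> derivable v x e -> derivable w x e ->
  derivable (k *: u + l *: v + w) x e /\
  'D_e (k *: u + l *: v + w) x = k * 'D_e u x + l * 'D_e v x + 'D_e w x.
Proof.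
move=> du dv dw.
have dku : derivable (k *: u) x e by exact: derivableZ.
have dlv : derivable (l *: v) x e by exact: derivableZ.
have dD : derivable (k *: u + l *: v) x e by exact: derivableD.
split; first exact: derivableD.
by rewrite deriveD// deriveD// !deriveZ.
Qed.

Let reF_lin a phi psi : reF (a *: phi + psi) =
  complex.Re a *: reF phi + (- complex.Im a) *: imF phi + reF psi.
Proof.
apply/funext => x; rewrite /reF /imF !fctE.
by case: a (phi x) (psi x) => ? ? [? ?] [? ?] /=; rewrite -mulNr.
Qed.

Let imF_lin a phi psi : imF (a *: phi + psi) =
  complex.Re a *: imF phi + complex.Im a *: reF phi + imF psi.
Proof.
apply/funext => x; rewrite /reF /imF !fctE.
by case: a (phi x) (psi x) => ? ? [? ?] [? ?].
Qed.

Lemma pderiv_lin i a phi psi : pderivable i phi -> pderivable i psi ->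
  pderivable i (a *: phi + psi) /\
  pderiv i (a *: phi + psi) = a *: pderiv i phi + pderiv i psi.
Proof.
move=> dphi dpsi; split => [x|].
  have [[d1 d2] [d3 d4]] := (dphi x, dpsi x).
  have [+ _] := derive_lin (complex.Re a) (- complex.Im a) d1 d2 d3.
  have [+ _] := derive_lin (complex.Re a) (complex.Im a) d2 d1 d4.
  by rewrite -reF_lin -imF_lin.
apply/funext => x; have [[d1 d2] [d3 d4]] := (dphi x, dpsi x).
have [_] := derive_lin (complex.Re a) (- complex.Im a) d1 d2 d3.
have [_] := derive_lin (complex.Re a) (complex.Im a) d2 d1 d4.
rewrite -reF_lin -imF_lin {1}/pderiv => -> ->.
by rewrite !fctE /pderiv; case: (a) => p q /=; rewrite mulNr.
Qed.

Lemma pderivs_lin s a phi psi : smooth phi -> smooth psi ->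
  pderivs s (a *: phi + psi) = a *: pderivs s phi + pderivs s psi.
Proof.
move=> sphi spsi; elim: s => //= i s ->.
by have [|| _ ->] := @pderiv_lin i a (pderivs s phi) (pderivs s psi);
  [exact: (sphi s).2|exact: (spsi s).2|].
Qed.

Lemma continuous_lin a (f g : F) :
  continuous f -> continuous g -> continuous (a *: f + g).
Proof.
by move=> cf cg x; apply: cvgD (cg x); apply: cvgZ (cf x); exact: cvg_cst.
Qed.

Lemma pderivs0 s : pderivs s 0 = 0.
Proof.
have re0 : reF 0 = cst 0 by [].
have im0 : imF 0 = cst 0 by [].
elim: s => //= i s ->; rewrite /pderiv re0 im0.
by apply/funext => x; rewrite !derive_cst.
Qed.

Fact smooth0 : smooth 0.
Proof.
move=> s; rewrite pderivs0; split; first exact: cst_continuous.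
by move=> i x; split; exact: derivable_cst.
Qed.

Lemma pderivsZ s a phi : smooth phi -> pderivs s (a *: phi) = a *: pderivs s phi.
Proof.
by move=> sphi; have := pderivs_lin s a sphi smooth0; rewrite pderivs0 !addr0.
Qed.

Lemma pderivsD s phi psi : smooth phi -> smooth psi ->
  pderivs s (phi + psi) = pderivs s phi + pderivs s psi.
Proof.
by move=> sphi spsi; have := pderivs_lin s 1 sphi spsi; rewrite !scale1r.
Qed.

Fact smoothP a phi psi : smooth phi -> smooth psi -> smooth (a *: phi + psi).
Proof.
move=> sphi spsi s; rewrite pderivs_lin//.
have [[cphi dphi] [cpsi dpsi]] := (sphi s, spsi s); split.
  exact: continuous_lin.
by move=> i; have [] := pderiv_lin a (dphi i) (dpsi i).
Qed.

Definition ultra_seminorm (M : nat -> {posnum R}) (h : {posnum R})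
    (w : V -> {posnum R}) (ax : multi_index * V) (phi : F) : R :=
  h%:num ^+ mi_len ax.1 * normc (mderiv ax.1 phi ax.2) * (w ax.2)%:num
    / (M (mi_len ax.1))%:num.

Fact ultra_seminormP M h w ax : seminorm_on smooth (ultra_seminorm M h w ax).
Proof.
case: ax => alpha x; rewrite /ultra_seminorm /mderiv/=.
set s := flatten _; split => [a phi sphi|phi psi sphi spsi].
  by rewrite pderivsZ// !fctE Normc.normcM mulrCA !mulrA.
rewrite pderivsD// !fctE -mulrDl ler_wpM2r// -mulrDl ler_wpM2r//.
rewrite -mulrDr ler_wpM2l//; exact: le_normcD.
Qed.

(* B^{M_p,h}_w *)
Definition Bstep (M : nat -> {posnum R}) (w : V -> {posnum R}) (h : {posnum R}) :
    lcspace :=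
  supspace ([ffun=> 0%N], 0) smooth0 smoothP (ultra_seminormP M h w).

Definition weighted_abs (w : V -> {posnum R}) (x : V) (f : F) : R :=
  normc (f x) * (w x)%:num.

Fact continuous_set0 : [set f : F | continuous f] 0.
Proof. exact: cst_continuous. Qed.

Fact continuous_setP a (f g : F) : [set f : F | continuous f] f ->
  [set f : F | continuous f] g -> [set f : F | continuous f] (a *: f + g).
Proof. exact: continuous_lin. Qed.

Fact weighted_absP w x : seminorm_on [set f : F | continuous f] (weighted_abs w x).
Proof.
split => [a f _|f g _ _]; first by rewrite /weighted_abs Normc.normcM mulrA.
rewrite /weighted_abs -mulrDl ler_wpM2r//; exact: le_normcD.
Qed.

(* Cw *)
Definition Cstep (w : V -> {posnum R}) : lcspace :=
  supspace 0 continuous_set0 continuous_setP (weighted_absP w).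


(* x |-> phi (c - x), i.e. the translate by c of the reflection of phi *)
Definition refl_trans (c : V) (phi : F) : F := fun x => phi (c - x).

Let dnbhs0N (R' : numFieldType) : - x @[x --> (0 : R')^'] = 0^'.
Proof.
rewrite -[in RHS]oppr0 dnbhsN; apply/seteqP; split => A.
  move=> A0; exists (-%R @^-1` A) => //.
  apply/seteqP; split => [_ [x Ax <-]//|x Ax].
  by exists (- x); rewrite /= ?opprK.
move=> [B B0 <-]; rewrite /nbhs/=; apply: filterS B0 => x Bx.
by exists x.
Qed.

Let derive_refl (u : V -> R^o) (c x e : V) : derivable u (c - x) e ->
  derivable (fun y => u (c - y)) x e /\
  'D_e (fun y => u (c - y)) x = - 'D_e u (c - x).
Proof.
move=> du; set v := fun y => _.
have vl : h^-1 *: ((v \o shift x) (h *: e) - v x) @[h --> 0^'] -->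
    - 'D_e u (c - x).
  rewrite (_ : (fun h : R => _) = (-%R \o
      (fun h => h^-1 *: ((u \o shift (c - x)) (h *: e) - u (c - x)))) \o -%R).
    have : (-%R \o (fun h => h^-1 *: ((u \o shift (c - x)) (h *: e)
        - u (c - x)))) h @[h --> 0^'] --> - 'D_e u (c - x) by exact: cvgN.
    by rewrite -[in X in X -> _](dnbhs0N R).
  apply/funext => h /=; rewrite /v /= scaleNr invrN scaleNr opprK.
  by congr (_ *: (u _ - _)); rewrite opprD addrCA.
split; first by apply/cvg_ex; eexists; exact: vl.
exact: cvg_lim vl.
Qed.

Lemma pderiv_refl i c phi : pderivable i phi ->
  pderivable i (refl_trans c phi) /\
  pderiv i (refl_trans c phi) = - refl_trans c (pderiv i phi).
Proof.
move=> dphi; split => [x|].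
  have [d1 d2] := dphi (c - x).
  by have [? _] := derive_refl d1; have [? _] := derive_refl d2.
apply/funext => x; have [d1 d2] := dphi (c - x).
have [_ +] := derive_refl d1; have [_ +] := derive_refl d2.
by rewrite {1}/pderiv /reF /imF => -> ->.
Qed.

Lemma pderivs_refl s c phi : smooth phi ->
  pderivs s (refl_trans c phi) = (-1) ^+ size s *: refl_trans c (pderivs s phi).
Proof.
move=> sphi; elim: s => [|i s IH]; first by rewrite scale1r.
have [dr er] := pderiv_refl c ((sphi s).2 i).
have d0 : pderivable i 0 by exact: (smooth0 [::]).2.
have p0 : pderiv i 0 = 0 by exact: (pderivs0 [:: i]).
have [_] := pderiv_lin ((-1) ^+ size s) dr d0.
by rewrite /= IH !addr0 p0 addr0 => ->; rewrite er scalerN exprS mulN1r scaleNr.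
Qed.

Lemma smooth_refl c phi : smooth phi -> smooth (refl_trans c phi).
Proof.
move=> sphi s; rewrite pderivs_refl//.
have d0 i : pderivable i 0 by exact: (smooth0 [::]).2.
split.
  rewrite -[_ *: _]addr0; apply: continuous_lin; last exact: cst_continuous.
  have cr : continuous (fun y : V => c - y).
    move=> x; apply: (@continuousB R V V (cst c) id x).
      exact: cst_continuous.
    exact: cvg_id.
  by move=> x; have := continuous_comp (cr x) ((sphi s).1 (c - x)).
move=> i; rewrite -[_ *: _]addr0; have [dr _] := pderiv_refl c ((sphi s).2 i).
by have [] := pderiv_lin ((-1) ^+ size s) dr (d0 i).
Qed.

Lemma enorm_ge0 (x : V) : 0 <= enorm x.
Proof. exact: sqrtr_ge0. Qed.

Lemma enormZ (a : R) (x : V) : 0 <= a -> enorm (a *: x) = a * enorm x.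
Proof.
move=> a0; rewrite /enorm.
under eq_bigr do rewrite mxE exprMn.
by rewrite -mulr_sumr sqrtrM ?sqr_ge0// sqrtr_sqr ger0_norm.
Qed.

Lemma enorm_max (x y : V) :
  enorm (x + y) <= 2 * Num.max (enorm x) (enorm y).
Proof.
have sum_ge0 (z : V) : 0 <= \sum_(i < d) z ord0 i ^+ 2.
  by apply: sumr_ge0 => i _; exact: sqr_ge0.
have m0 : 0 <= Num.max (enorm x) (enorm y) by rewrite le_max enorm_ge0.
rewrite -(ler_pXn2r (_ : 0 < 2)%N) ?nnegrE ?enorm_ge0 ?mulr_ge0//.
rewrite exprMn {1}/enorm sqr_sqrtr//.
have [mx my] : enorm x ^+ 2 <= Num.max (enorm x) (enorm y) ^+ 2 /\
    enorm y ^+ 2 <= Num.max (enorm x) (enorm y) ^+ 2.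
  by split; rewrite lerXn2r ?nnegrE ?enorm_ge0// le_max lexx ?orbT.
apply: (@le_trans _ _ (2 * (enorm x ^+ 2 + enorm y ^+ 2))); last lra.
rewrite /enorm !sqr_sqrtr// -big_split mulr_sumr; apply: ler_sum => i _ /=.
rewrite mxE; have := sqr_ge0 (x ord0 i - y ord0 i); lra.
Qed.

End Functions.

Section Spaces.
Context {R : realType} (d : nat).
Local Notation V := 'rV[R]_d.
Local Notation F := (V -> R[i]^o).
Local Notation lcs := (@lcspace R (V -> R[i]^o)).
Implicit Types (M A : nat -> {posnum R}) (W : nat -> V -> {posnum R}).

Variant ultra_case := Beurling | Roumieu.

(* limit over h -> oo (intersection over all h > 0) or h -> 0+ (union)        *)
Definition hlim (c : ultra_case) (E : {posnum R} -> lcs) : lcs :=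
  match c with Beurling => projlim E | Roumieu => indlim E end.

(* e^{A(lambda x)} with the Euclidean norm *)
Definition exp_weight A (lambda : {posnum R}) : V -> {posnum R} :=
  fun x => PosNum (expR_gt0 (assoc_fun A (enorm (lambda%:num *: x)))).

(* Gelfand-Shilov space: S^{(M)}_{(A)} (Beurling) or S^{{M}}_{{A}} (Roumieu)   *)
Definition GS c M A : lcs := hlim c (fun h => Bstep M (exp_weight A h) h).

(* B^*_w *)
Definition Bspace c M (w : V -> {posnum R}) : lcs := hlim c (Bstep M w).

(* B^*_W for an increasing weight system W *)
Definition Bincr c M W : lcs :=
  hlim c (fun h => projlim (fun N => Bstep M (W N) h)).

(* B^*_W and WC for a decreasing weight system W *)
Definition Bdecr c M W : lcs := indlim (fun n => Bspace c M (W n)).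
Definition Cdecr W : lcs := indlim (fun n => Cstep (W n)).

Definition incr_weight_system W :=
  (forall N, continuous (fun x => (W N x)%:num : R^o)) /\
  (forall N x, (W N x)%:num <= (W N.+1 x)%:num).

Definition dual_weights W : nat -> V -> {posnum R} :=
  fun N x => ((W N x)%:num^-1)%:pos.

(* w_N(x) / w_K(x) = O(|x|^{-(d+1)}) as |x| -> oo *)
Definition weight_decay W := forall N, exists2 K, (N < K)%N &
  exists C r : R, forall x, r < enorm x ->
    (W N x)%:num / (W K x)%:num <= C * (enorm x) ^- d.+1.

Definition admissible_bound A W N K (lambda : R) := exists2 C : R, 0 < C &
  forall x t : V, (W N (x + t))%:num <=
    C * (W K x)%:num * expR (assoc_fun A (enorm (lambda *: t))).

Definition admissible c A W :=
  match c with
  | Beurling => forall N, exists2 lambda : R, 0 < lambda &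
      exists2 K, (N <= K)%N & admissible_bound A W N K lambda
  | Roumieu => forall N (lambda : R), 0 < lambda ->
      exists2 K, (N <= K)%N & admissible_bound A W N K lambda
  end.

Definition gs_refl_trans c M A (x : V) (phi : GS c M A) : GS c M A :=
  insubd 0 (refl_trans x (val phi)).

Lemma exp_weight_refl A (h k : {posnum R}) (x y : V) : weight_seq A ->
  h%:num <= k%:num / 2 -> (exp_weight A h y)%:num <=
    (exp_weight A k x)%:num * (exp_weight A k (x - y))%:num.
Proof.
move=> wA hk; rewrite /= -expRD ler_expR !enormZ//.
have m : h%:num * enorm y <=
    Num.max (k%:num * enorm x) (k%:num * enorm (x - y)).
  have := enorm_max x (y - x); rewrite addrCA subrr addr0.
  have -> : enorm (y - x) = enorm (x - y).
    by rewrite /enorm; congr Num.sqrt; apply: eq_bigr => i _; rewrite !mxE -sqrrN opprB.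
  rewrite -maxr_pMr// => yle; apply: le_trans (ler_wpM2r (enorm_ge0 y) hk) _.
  by rewrite -mulrA ler_wpM2l// mulrC ler_pdivrMr// mulrC.
have [kx ky] : 0 <= k%:num * enorm x /\ 0 <= k%:num * enorm (x - y).
  by split; rewrite mulr_ge0// enorm_ge0.
have h0 : 0 <= h%:num * enorm y by rewrite mulr_ge0// enorm_ge0.
move: m; rewrite le_max => /orP[] m.
  by rewrite ler_wpDr ?assoc_fun_ge0// assoc_fun_le.
by rewrite ler_wpDl ?assoc_fun_ge0// assoc_fun_le.
Qed.

Lemma Bstep_refl M A (h k : {posnum R}) (x : V) (phi : F) : weight_seq A ->
  h%:num <= k%:num / 2 -> lcs_set (Bstep M (exp_weight A k) k) phi ->
  lcs_set (Bstep M (exp_weight A h) h) (refl_trans x phi).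
Proof.
move=> wA hk [sphi [b phib]]; split; first exact: smooth_refl.
exists ((exp_weight A k x)%:num * b) => _ [[alpha y] _ <-].
have phile : ultra_seminorm M k (exp_weight A k) (alpha, x - y) phi <= b.
  by apply: phib; exists (alpha, x - y).
have := exp_weight_refl x y wA hk.
move: phile; rewrite /ultra_seminorm /fst /snd.
move: (exp_weight A k x) (exp_weight A h y) (exp_weight A k (x - y)).
move=> wx wh wk; move: (mi_len alpha) => m.
rewrite /mderiv pderivs_refl// !fctE Normc.normcM.
set n := size _; set D := pderivs _ _.
have -> : normc ((-1) ^+ n : R[i]) = 1.
  have n1 : normc (-1 : R[i]) = 1.
    by rewrite /normc/= oppr0 expr0n/= addr0 sqrrN expr1n sqrtr1.
  by elim: n => [|n IH]; rewrite ?Normc.normc1// exprS Normc.normcM IH n1 mul1r.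
rewrite mul1r /refl_trans; set w := normc _.
have w0 : 0 <= w by rewrite /w; case: (D _) => ? ?; exact: sqrtr_ge0.
move: w w0 => w w0 phile whle.
have hkm : h%:num ^+ m <= k%:num ^+ m.
  by rewrite lerXn2r ?nnegrE//; have := hk; have : 0 < k%:num by []; lra.
apply: le_trans (_ : wx%:num * (k%:num ^+ m * w * wk%:num / (M m)%:num) <= _).
  rewrite !mulrA ler_wpM2r//.
  rewrite [leRHS](_ : _ = k%:num ^+ m * (w * (wx%:num * wk%:num))); last by ring.
  rewrite -mulrA ler_pM// ?mulr_ge0//.
  by rewrite ler_wpM2l.
by rewrite ler_wpM2l.
Qed.

(* the default value 0 in gs_refl_trans is never reached *)
Lemma gs_refl_transE c M A (x : V) (phi : GS c M A) : weight_seq A ->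
  val (gs_refl_trans x phi) = refl_trans x (val phi).
Proof.
move=> wA; rewrite insubdK//; apply/mem_set.
case: c phi => phi.
  move=> h _; apply: (Bstep_refl x wA _ (lcs_eltP phi (h%:num * 2)%:pos I)).
  by rewrite /= mulfK.
have [s sE ->] := lcs_eltP phi.
exists (map (refl_trans x) s); last first.
  rewrite big_map; elim: s {sE} => [|f s IH]; first by rewrite !big_nil.
  by rewrite !big_cons -IH.
move=> _ /mapP[f /sE[h fh] ->]; exists (h%:num / 2)%:pos.
exact: (Bstep_refl x wA _ fh).
Qed.

Definition convolution c M A (f : GS c M A -> R[i]^o) (phi : GS c M A) : F :=
  fun x => f (gs_refl_trans x phi).

(* f, a functional on S^*, belongs to the dual of E, i.e. S^* is included in E and  *)
(* f is the restriction to S^* of a continuous linear functional on E          *)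
Definition in_dual c M A (f : GS c M A -> R[i]^o) (E : lcs) :=
  exists2 g : {linear E -> R[i]^o}, continuous g &
    forall phi : GS c M A, exists2 psi : E, val psi = val phi & f phi = g psi.

Definition conv_into c M A (f : GS c M A -> R[i]^o) (E : lcs) :=
  forall phi : GS c M A, lcs_set E (convolution f phi).

Definition conv_continuous c M A (f : GS c M A -> R[i]^o) (E : lcs) :=
  exists2 T : GS c M A -> E,
    (forall phi, val (T phi) = convolution f phi) & continuous T.

End Spaces.

(* Main.v *)
(* If |f(psi)| is bounded by a seminorm of B_W, the admissibility of W, applied to psi  *)
(* = phi(x - .), bounds (f * phi)(x) by a multiple of w_K(x); as derivatives of f * phi *)
(* are convolutions with derivatives of phi, (i) implies (v). Conversely, under (ii) a  *)
(* gliding hump argument, instead of the closed graph theorem, gives |f * phi| <= C     *)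
(* |phi| w_N with a continuous seminorm |phi| on S. Neither density nor a parametrix is *)
(* needed for (i): a primitive of |phi0|^2 along a coordinate line through a point      *)
(* where a given phi0 in S does not vanish is, once normalised, a step G from 0 to 1    *)
(* whose differences G(s + 1) - G(s) decay rapidly and telescope, so that their tensor  *)
(* product chi lies in S and sum_k chi(k - x) = 1, k in Z^d. Hence f(phi) = sum_k (f *  *)
(* theta_k)(k) with theta_k(y) = phi(k - y) chi(y). By admissibility |theta_k| = O(1 /  *)
(* w_L(k)) as soon as phi is in B_W, and by the decay of w_N / w_L the series defines a *)
(* continuous functional on B_W extending f.                                            *)

From HB Require Import structures.
Require Import Defs.
From mathcomp Require Import all_boot all_order all_algebra.
From mathcomp Require Import all_classical all_reals all_analysis.
From mathcomp Require Import complex ring lra.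

Set Implicit Arguments.
Unset Strict Implicit.
Unset Printing Implicit Defensive.

Import Order.TTheory GRing.Theory Num.Theory numFieldNormedType.Exports.

Local Open Scope classical_set_scope.
Local Open Scope ring_scope.

(** Everything rests on two implications, (i) to (v) and (ii) to (i); the remaining ones follow from
    the continuous inclusion of [Bdecr] in [Cdecr].

    From (i) to (v). Continuity of [f] on the space of [W] bounds [f psi] by a multiple of the
    supremum of [h^|s| |psi^(s)| w_N / M_|s|]. Take for [psi] the reflected translate of a
    derivative of [phi], centred at [x]. Admissibility moves the weight from [y] to [x] at the price
    of an exponential weight in [y - x], which the decay of [phi] pays for, while (M.2) pays for the
    derivative ([fconv_estimate]). Reflected translates are differentiable in [x] for the
    Gelfand-Shilov norms ([refl_taylor]), so derivatives of [f * phi] are convolutions with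
    derivatives of [phi] ([fconv_smooth]). The estimate depends on [phi] only through a seminorm,
    hence gives membership and continuity together ([uniform_Bspace], [uniform_hex]).

    From (ii) to (i). A gliding hump ([gliding_hump], [conv_into_uniform]) makes the weight index
    and the constant in [|f * phi| <= C w_N] uniform in [phi]. A nonzero element of the Beurling
    space yields steps ([step_jet]) whose unit differences telescope; their tensor product [chi] is
    a window whose integer translates sum to 1. For [phi] in the space of [W], the piece of [phi]
    cut out by the window at a lattice point [k] has Gelfand-Shilov size O(1 / w_L(k))
    ([theta_gsb]), so [f] of this piece is O(w_N(k) / w_L(k)), which is summable ([weight_decay2]).
    The sum of these values is a continuous functional ([local_sum_functional]). For [phi] in the
    Gelfand-Shilov space its partial sums are [f] of [phi] times a cutoff ([box_sum_cutoff]), and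
    they tend to [f phi] ([fval_cutoff]), so the functional extends [f]. *)

(** * Modulus of complex numbers *)

Section Normc.
Context {R : realType}.
Implicit Types z w : R[i].

Lemma normc_ge0 z : 0 <= Normc.normc z.
Proof. by case: z => a b; exact: sqrtr_ge0. Qed.

Lemma norm_normc z : `|z| = (Normc.normc z)%:C%C.
Proof. by case: z. Qed.

Lemma normcB z w : Normc.normc (z - w) = Normc.normc (w - z).
Proof. by rewrite -normcN opprB. Qed.

Lemma normcR (a : R) : Normc.normc a%:C%C = `|a|.
Proof. by rewrite /Normc.normc/= expr0n/= addr0 sqrtr_sqr. Qed.

Lemma normc_Re z : `|complex.Re z| <= Normc.normc z.
Proof.
by case: z => a b /=; rewrite -sqrtr_sqr ler_sqrt ?addr_ge0 ?sqr_ge0// lerDl sqr_ge0.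
Qed.

Lemma normc_Im z : `|complex.Im z| <= Normc.normc z.
Proof.
by case: z => a b /=; rewrite -sqrtr_sqr ler_sqrt ?addr_ge0 ?sqr_ge0// lerDr sqr_ge0.
Qed.

Lemma normc_le_ReIm z : Normc.normc z <= `|complex.Re z| + `|complex.Im z|.
Proof.
case: z => a b /=; rewrite -(ler_pXn2r (_ : 0 < 2)%N) ?nnegrE ?sqrtr_ge0 ?addr_ge0//.
rewrite sqr_sqrtr ?addr_ge0 ?sqr_ge0// sqrrD !real_normK ?num_real// lerD2r.
by rewrite lerDl mulrn_wge0// mulr_ge0.
Qed.

Lemma normc_sum (I : Type) (r : seq I) (P : pred I) (F : I -> R[i]) :
  Normc.normc (\sum_(i <- r | P i) F i) <= \sum_(i <- r | P i) Normc.normc (F i).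
Proof.
elim/big_ind2 : _ => [|x1 x2 y1 y2 h1 h2|//]; first by rewrite Normc.normc0.
exact: le_trans (le_normcD _ _) (lerD h1 h2).
Qed.

Lemma normcX z n : Normc.normc (z ^+ n) = Normc.normc z ^+ n.
Proof.
by elim: n => [|n IH]; rewrite ?expr0 ?Normc.normc1// !exprS Normc.normcM IH.
Qed.

Lemma normc_signM n z : Normc.normc ((-1) ^+ n * z) = Normc.normc z.
Proof. by rewrite Normc.normcM normcX normcN Normc.normc1 expr1n mul1r. Qed.

(** The norm on [R[i]] is itself complex valued; here continuity becomes an estimate with a real
    epsilon. *)
Lemma continuous_normcP (T : topologicalType) (phi : T -> R[i]^o) x :
  {for x, continuous phi} <->
  forall e, 0 < e -> \forall y \near x, Normc.normc (phi y - phi x) < e.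
Proof.
split => [/cvgrPdist_lt cphi e e0|H].
  have e0' : 0 < e%:C%C :> R[i] by rewrite ltcR.
  apply: filterS (cphi _ e0') => y /=.
  by rewrite norm_normc ltcR normcB.
apply/cvgrPdist_lt => -[a b]; rewrite ltcE/= => /andP[/eqP -> a0].
by apply: filterS (H _ a0) => y /=; rewrite norm_normc ltcR normcB.
Qed.

End Normc.

(** * Derivatives as estimates, and mean value inequalities *)

Lemma derivable_distP (R : realType) (V : normedModType R) (u : V -> R^o) (x e : V) (l : R) :
  (derivable u x e /\ 'D_e u x = l) <->
  forall eps, 0 < eps -> exists2 del, 0 < del & forall h : R, `|h| < del ->
    `|u (x + h *: e) - u x - h * l| <= eps * `|h|.
Proof.
split => [[du <-]|H].
  move=> eps eps0.
  have /cvgrPdist_le/(_ _ eps0)[del /= del0 Hdel] :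
    h^-1 *: ((u \o shift x) (h *: e) - u x) @[h --> 0^'] --> 'D_e u x by exact: du.
  exists del => // h hdel.
  have [->|h0] := eqVneq h 0; first by rewrite scale0r addr0 subrr mul0r subr0 normr0 mulr0.
  have := Hdel h; rewrite /ball_/= sub0r normrN => /(_ hdel h0).
  rewrite -(ler_pM2r (_ : 0 < `|h|)) ?normr_gt0//; apply: le_trans.
  rewrite -normrM distrC mulrBl (addrC x) le_eqVlt; apply/orP; left; apply/eqP.
  congr `|_|; rewrite /GRing.scale/= [in RHS]mulrAC mulVf// mul1r; congr (_ - _); exact: mulrC.
have vl : h^-1 *: ((u \o shift x) (h *: e) - u x) @[h --> 0^'] --> l.
  apply/cvgrPdist_le => eps eps0; have [del del0 Hdel] := H _ eps0.
  exists del => //= h; rewrite /ball_/= sub0r normrN => hdel h0.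
  have := Hdel _ hdel; rewrite -ler_pdivrMr ?normr_gt0//; apply: le_trans.
  rewrite -normfV -normrM distrC (addrC x) le_eqVlt; apply/orP; left; apply/eqP.
  congr `|_|; rewrite /GRing.scale/= mulrBl mulrAC divff// mul1r; congr (_ - _); exact: mulrC.
split; last exact: cvg_lim vl.
by apply/cvg_ex; exists l.
Qed.

Section Derivation.
Context {R : realType} {d : nat}.
Local Notation V := 'rV[R]_d.
Local Notation F := (V -> R[i]^o).
Local Notation "''e_' i" := (delta_mx ord0 i : V) (at level 8, i at level 2).
Implicit Types (phi psi : F).

Definition ispd (i : 'I_d) phi psi := pderivable i phi /\ pderiv i phi = psi.

(** The modulus dominates the real and imaginary parts and is at most their sum, so both derivatives
    are captured by one complex estimate and later arguments need not split into parts. *)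
Lemma ispdP i phi psi : ispd i phi psi <->
  forall x eps, 0 < eps -> exists2 del, 0 < del & forall h : R, `|h| < del ->
    Normc.normc (phi (x + h *: 'e_i) - phi x - h%:C%C * psi x) <= eps * `|h|.
Proof.
have E : ispd i phi psi <-> forall x,
   (derivable (reF phi) x 'e_i /\ 'D_'e_i (reF phi) x = complex.Re (psi x)) /\
   (derivable (imF phi) x 'e_i /\ 'D_'e_i (imF phi) x = complex.Im (psi x)).
  split => [[dphi <-] x|H]; first by have [? ?] := dphi x.
  split => [x|]; first by have [[? _] [? _]] := H x.
  by apply/funext => x; rewrite /pderiv; have [[_ ->] [_ ->]] := H x; case: (psi x).
rewrite {}E; split => H x.
  move=> eps eps0; have [/derivable_distP Hr /derivable_distP Hi] := H x.
  have e2 : 0 < eps / 2 by rewrite divr_gt0.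
  have [d1 d10 H1] := Hr _ e2; have [d2 d20 H2] := Hi _ e2.
  exists (Num.min d1 d2); first by rewrite lt_min d10.
  move=> h; rewrite lt_min => /andP[/H1 h1 /H2 h2].
  rewrite (splitr eps) mulrDl; apply: le_trans (normc_le_ReIm _) (lerD _ _).
    apply: le_trans h1; rewrite le_eqVlt; apply/orP; left; apply/eqP; congr `|_|.
    rewrite /reF; case: (phi _) (phi _) (psi _) => ? ? [? ?] [? ?] /=; ring.
  apply: le_trans h2; rewrite le_eqVlt; apply/orP; left; apply/eqP; congr `|_|.
  rewrite /imF; case: (phi _) (phi _) (psi _) => ? ? [? ?] [? ?] /=; ring.
split; apply/derivable_distP => eps eps0; have [del del0 Hd] := H x _ eps0;
    exists del => // h /Hd; apply: le_trans.
  apply: le_trans (normc_Re _); rewrite le_eqVlt; apply/orP; left; apply/eqP; congr `|_|.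
  rewrite /reF; case: (phi _) (phi _) (psi _) => ? ? [? ?] [? ?] /=; ring.
apply: le_trans (normc_Im _); rewrite le_eqVlt; apply/orP; left; apply/eqP; congr `|_|.
rewrite /imF; case: (phi _) (phi _) (psi _) => ? ? [? ?] [? ?] /=; ring.
Qed.

Lemma is_derive_line (u : V -> R^o) (x e : V) (t : R) : derivable u (x + t *: e) e ->
  is_derive t 1 (fun t => u (x + t *: e) : R^o) ('D_e u (x + t *: e)).
Proof.
have E : (fun h : R => h^-1 *: (((fun t => u (x + t *: e) : R^o) \o shift t) (h *: 1)
      - u (x + t *: e))) =
    (fun h => h^-1 *: ((u \o shift (x + t *: e)) (h *: e) - u (x + t *: e))).
  apply/funext => h /=; congr (_ *: (u _ - _)).
  by rewrite [h *: 1](mulr1 h : h *: (1 : R) = h) scalerDl addrCA.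
by move=> du; apply: DeriveDef; rewrite /derivable /derive ?E.
Qed.

Lemma MVT_dist (f df : R -> R) (a b K : R) :
  (forall s : R, is_derive s 1 f (df s)) ->
  (forall s, `|s - a| <= `|b - a| -> `|df s| <= K) ->
  `|f b - f a| <= K * `|b - a|.
Proof.
move=> fdf dfK.
have cf : continuous f.
  move=> s; apply: differentiable_continuous; apply/derivable1_diffP.
  by have [] := fdf s.
have [ab|/ltW ba] := leP a b.
  have [|c + ->] := MVT_segment ab (fun s _ => fdf s).
    exact: continuous_subspaceT.
  rewrite in_itv/= => /andP[ac cb]; rewrite normrM ler_wpM2r//; apply: dfK.
  by rewrite !ger0_norm ?subr_ge0// lerB.
have [|c + fba] := MVT_segment ba (fun s _ => fdf s).
  exact: continuous_subspaceT.
rewrite in_itv/= => /andP[bc ca]; rewrite distrC fba normrM (distrC a) ler_wpM2r//.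
by apply: dfK; rewrite distrC (distrC b) !ger0_norm ?subr_ge0// lerB.
Qed.

(** [MVT_dist] is applied to [f] minus its tangent at [a], whose derivative is at most [K * |s - a|]
    by [MVT_dist] again. *)
Lemma MVT_dist2 (f df ddf : R -> R) (a b K : R) :
  (forall s : R, is_derive s 1 f (df s)) -> (forall s : R, is_derive s 1 df (ddf s)) ->
  (forall s, `|s - a| <= `|b - a| -> `|ddf s| <= K) ->
  `|f b - f a - (b - a) * df a| <= K * `|b - a| ^+ 2.
Proof.
move=> fdf dfddf ddfK.
have K0 : 0 <= K by apply: le_trans (ddfK a _); rewrite ?subrr ?normr0.
pose g : R -> R := f - df a *: (id : R -> R).
have gdg (s : R) : is_derive s 1 g (df s - df a).
  apply: is_derive_eq; by rewrite [df a *: _]mulr1.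
have := @MVT_dist g _ a b (K * `|b - a|) gdg.
have -> : g b - g a = f b - f a - (b - a) * df a.
  by rewrite /g; change (f b - df a * b - (f a - df a * a) = f b - f a - (b - a) * df a); ring.
rewrite expr2 mulrA.
apply => s sab; apply: le_trans (_ : K * `|s - a| <= _); last by rewrite ler_wpM2l.
by apply: MVT_dist dfddf _ => r rs; apply: ddfK; apply: le_trans rs sab.
Qed.

End Derivation.

Lemma complex_ext (R : rcfType) (z w : R[i]) :
  complex.Re z = complex.Re w -> complex.Im z = complex.Im w -> z = w.
Proof. by case: z w => ? ? [? ?] /= -> ->. Qed.

(** * Partial derivatives of complex valued functions *)

Section PartialDerivatives.
Context {R : realType} {d : nat}.
Local Notation V := 'rV[R]_d.
Local Notation F := (V -> R[i]^o).
Local Notation "''e_' i" := (delta_mx ord0 i : V) (at level 8, i at level 2).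
Implicit Types (phi psi chi : F).

Lemma ispd_line i phi psi x : ispd i phi psi ->
  (forall t : R, is_derive t 1 (fun t : R => complex.Re (phi (x + t *: 'e_i)) : R^o)
     (complex.Re (psi (x + t *: 'e_i)))) /\
  (forall t : R, is_derive t 1 (fun t : R => complex.Im (phi (x + t *: 'e_i)) : R^o)
     (complex.Im (psi (x + t *: 'e_i)))).
Proof.
move=> [dphi <-]; split => t; have [dr di] := dphi (x + t *: 'e_i).
  exact: (is_derive_line dr).
exact: (is_derive_line di).
Qed.

(** The factor 2 comes from treating real and imaginary parts separately, as the mean value theorem
    has no complex form. *)
Lemma ispd_MVT i phi psi x (t K : R) : ispd i phi psi ->
  (forall s : R, `|s| <= `|t| -> Normc.normc (psi (x + s *: 'e_i)) <= K) ->
  Normc.normc (phi (x + t *: 'e_i) - phi x) <= 2 * K * `|t|.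
Proof.
move=> dphi psiK; have [dr di] := ispd_line x dphi.
have hr := @MVT_dist R _ _ 0 t K dr; have hi := @MVT_dist R _ _ 0 t K di.
rewrite !subr0 scale0r addr0 in hr hi.
rewrite -mulrA mulrDl !mul1r; apply: le_trans (normc_le_ReIm _) (lerD _ _).
  rewrite raddfB/=; apply: hr => s; rewrite subr0 => /psiK; apply: le_trans.
  exact: normc_Re.
rewrite raddfB/=; apply: hi => s; rewrite subr0 => /psiK; apply: le_trans.
exact: normc_Im.
Qed.

Lemma ispd_MVT2 i phi psi chi x (t K : R) : ispd i phi psi -> ispd i psi chi ->
  (forall s : R, `|s| <= `|t| -> Normc.normc (chi (x + s *: 'e_i)) <= K) ->
  Normc.normc (phi (x + t *: 'e_i) - phi x - t%:C%C * psi x) <= 2 * K * `|t| ^+ 2.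
Proof.
move=> dphi dpsi chiK.
have [dr di] := ispd_line x dphi; have [ddr ddi] := ispd_line x dpsi.
have hr := @MVT_dist2 R _ _ _ 0 t K dr ddr.
have hi := @MVT_dist2 R _ _ _ 0 t K di ddi.
rewrite !subr0 !scale0r !addr0 in hr hi.
rewrite -mulrA mulrDl !mul1r; apply: le_trans (normc_le_ReIm _) (lerD _ _).
  rewrite (_ : complex.Re _ = complex.Re (phi (x + t *: 'e_i)) - complex.Re (phi x) - t * complex.Re (psi x)).
    by apply: hr => s; rewrite subr0 => /chiK; apply: le_trans (normc_Re _).
  by case: (phi _) (phi _) (psi _) => ? ? [? ?] [? ?] /=; ring.
rewrite (_ : complex.Im _ = complex.Im (phi (x + t *: 'e_i)) - complex.Im (phi x) - t * complex.Im (psi x)).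
  by apply: hi => s; rewrite subr0 => /chiK; apply: le_trans (normc_Im _).
by case: (phi _) (phi _) (psi _) => ? ? [? ?] [? ?] /=; ring.
Qed.

Lemma norm_coord (x : V) i : `|x ord0 i| <= `|x|.
Proof.
rewrite [in leRHS]/Num.Def.normr/= mx_normrE.
exact: (le_bigmax _ (fun ij => `|x ij.1 ij.2|) (ord0, i)).
Qed.

Lemma norm_le_coord (x : V) (r : R) : 0 <= r -> (forall i, `|x ord0 i| <= r) -> `|x| <= r.
Proof.
move=> r0 xr; rewrite [in leLHS]/Num.Def.normr/= mx_normrE.
by apply: bigmax_le => // -[j i] _ /=; rewrite (ord1 j).
Qed.

Lemma ispd_lipschitz phi (psi : 'I_d -> F) x r (K : R) :
  (forall i, ispd i phi (psi i)) ->
  (forall i z, `|z - x| <= r -> Normc.normc (psi i z) <= K) ->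
  forall y, `|y - x| <= r -> Normc.normc (phi y - phi x) <= 2 * K * `|y - x| * d%:R.
Proof.
move=> dphi psiK y yx.
(* The path from [x] to [y] changes one coordinate at a time and stays in the ball, which is a cube
   for the maximum norm. *)
pose z k : V := \row_j if (j < k)%N then y ord0 j else x ord0 j.
have zx k (w : R) (i : 'I_d) : (i = k :> nat) -> `|w| <= `|(y - x) ord0 i| -> `|z k + w *: 'e_i - x| <= r.
  move=> ik wr; apply: le_trans yx; apply: norm_le_coord => // j; rewrite !mxE eqxx/=.
  have [<-|ji] := eqVneq i j; last first.
    rewrite mulr0 addr0; case: ifP => _; last by rewrite subrr normr0.
    by have := norm_coord (y - x) j; rewrite !mxE.
  rewrite mulr1 ik ltnn addrAC subrr add0r; apply: le_trans wr _; exact: norm_coord.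
have z0 : z 0%N = x by apply/rowP => j; rewrite !mxE.
have zd : z d = y by apply/rowP => j; rewrite !mxE ltn_ord.
have zS (i : 'I_d) : z i.+1 = z i + (y - x) ord0 i *: 'e_i.
  apply/rowP => j; rewrite !mxE eqxx/= ltnS leq_eqVlt.
  have [ji|ji] := eqVneq j i.
    by rewrite ji ltnn eqxx/= mulr1 [RHS]addrC subrK.
  by rewrite mulr0 addr0 -val_eqE/= in ji *; rewrite (negbTE ji).
rewrite -{1}z0 -{1}zd -(telescope_sumr (fun k => phi (z k)) (leq0n d)) big_mkord.
apply: le_trans (normc_sum _ _ _) _.
apply: le_trans (_ : \sum_(i < d) 2 * K * `|y - x| <= _); last first.
  by rewrite sumr_const card_ord mulr_natr.
apply: ler_sum => i _; rewrite zS.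
apply: le_trans (ispd_MVT (K := K) (dphi i) _) _.
  by move=> s sle; apply/psiK/zx.
rewrite ler_wpM2l//; last exact: norm_coord.
rewrite mulr_ge0//; apply: le_trans (normc_ge0 (psi i x)) (psiK _ _ _).
by rewrite subrr normr0 (le_trans _ yx).
Qed.

(** Convolutions are shown to be continuous in this way, from local bounds on their first
    derivatives. *)
Lemma ispd_continuous phi (psi : 'I_d -> F) :
  (forall i, ispd i phi (psi i)) ->
  (forall x, exists r K, 0 < r /\
     forall i z, `|z - x| <= r -> Normc.normc (psi i z) <= K) ->
  continuous phi.
Proof.
move=> dphi psiK x; apply/continuous_normcP => e e0.
have [r [K [r0 xK]]] := psiK x.
have lip := ispd_lipschitz dphi xK.
pose L := 2 * `|K| * d%:R + 1.
have L0 : 0 < L by rewrite /L ltr_wpDl ?mulr_ge0.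
have rL : 0 < Num.min r (e / L) by rewrite lt_min r0 divr_gt0.
apply: filterS (nbhsx_ballx x _ rL) => y.
rewrite -ball_normE/= distrC lt_min => /andP[yr yL].
apply: le_lt_trans (lip _ (ltW yr)) _.
move: yL; rewrite ltr_pdivlMr//; apply: le_lt_trans; rewrite /L.
rewrite mulrAC mulrC; apply: ler_wpM2l => //.
have := ler_norm K; have : (0 : R) <= d%:R by []; nra.
Qed.

(** One mean value estimate in each variable compares the second difference over a square of side
    [h] with the mixed derivative at its corner. *)
Lemma second_difference (f f1 f21 : R -> R -> R) (h e : R) :
  (forall s t : R, is_derive s 1 (f^~ t) (f1 s t)) ->
  (forall s t : R, is_derive t 1 (f1 s) (f21 s t)) ->
  (forall s t : R, `|s| <= `|h| -> `|t| <= `|h| -> `|f21 s t - f21 0 0| <= e) ->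
  `|f h h - f h 0 - f 0 h + f 0 0 - h ^+ 2 * f21 0 0| <= e * `|h| ^+ 2.
Proof.
move=> df df1 He.
pose g : R -> R := f^~ h - f^~ 0 - (h * f21 0 0) *: (id : R -> R).
have dg (s : R) : is_derive s 1 g (f1 s h - f1 s 0 - h * f21 0 0).
  by apply: is_derive_eq; rewrite [_ *: _]mulr1.
have := @MVT_dist R g _ 0 h (e * `|h|) dg.
have -> : g h - g 0 = f h h - f h 0 - f 0 h + f 0 0 - h ^+ 2 * f21 0 0.
  rewrite /g; change (f h h - f h 0 - h * f21 0 0 * h - (f 0 h - f 0 0 - h * f21 0 0 * 0) =
    f h h - f h 0 - f 0 h + f 0 0 - h ^+ 2 * f21 0 0); ring.
rewrite !subr0 expr2 mulrA; apply => s; rewrite subr0 => sh.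
pose k : R -> R := f1 s - f21 0 0 *: (id : R -> R).
have dk (t : R) : is_derive t 1 k (f21 s t - f21 0 0).
  by apply: is_derive_eq; rewrite [_ *: _]mulr1.
have := @MVT_dist R k _ 0 h e dk.
have -> : k h - k 0 = f1 s h - f1 s 0 - h * f21 0 0.
  rewrite /k; change (f1 s h - f21 0 0 * h - (f1 s 0 - f21 0 0 * 0) =
    f1 s h - f1 s 0 - h * f21 0 0); ring.
by rewrite !subr0; apply => t; rewrite subr0 => th; exact: He.
Qed.

(** The second difference is symmetric in the two variables, so after division by [h ^+ 2] it tends
    to both mixed derivatives. *)
Lemma real_schwarz (f f1 f2 f21 f12 : R -> R -> R) :
  (forall s t : R, is_derive s 1 (f^~ t) (f1 s t)) ->
  (forall s t : R, is_derive t 1 (f1 s) (f21 s t)) ->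
  (forall s t : R, is_derive t 1 (f s) (f2 s t)) ->
  (forall s t : R, is_derive s 1 (f2^~ t) (f12 s t)) ->
  (forall e, 0 < e -> exists2 h, 0 < h & forall s t : R, `|s| <= h -> `|t| <= h ->
    `|f21 s t - f21 0 0| <= e /\ `|f12 s t - f12 0 0| <= e) ->
  f21 0 0 = f12 0 0.
Proof.
move=> df df1 df2 df12 cf.
apply/eqP; rewrite -subr_eq0 -normr_le0; apply/ler_addgt0Pr => e e0.
rewrite add0r (splitr e); have e2 : 0 < e / 2 by rewrite divr_gt0.
have [h h0 He] := cf _ e2.
have hh : `|h| = h by rewrite gtr0_norm.
have h2 : 0 < h ^+ 2 by rewrite exprn_gt0.
have A := @second_difference f f1 f21 h (e / 2) df df1.
have B := @second_difference (fun s t => f t s) (fun s t => f2 t s)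
  (fun s t => f12 t s) h (e / 2) (fun s t => df2 t s) (fun s t => df12 t s).
rewrite hh in A B.
have {}A := A (fun s t sh th => (He s t sh th).1).
have {}B := B (fun s t sh th => (He t s th sh).2).
rewrite -(ler_pM2r h2) mulrDl.
rewrite -[X in _ * X](gtr0_norm h2) -normrM.
apply: le_trans (lerD A B).
rewrite (_ : (_ - _) * _ =
  (f h h - f 0 h - f h 0 + f 0 0 - h ^+ 2 * f12 0 0) -
  (f h h - f h 0 - f 0 h + f 0 0 - h ^+ 2 * f21 0 0)); last by ring.
by rewrite [leRHS]addrC; exact: ler_normB.
Qed.

Lemma ispd_pderivs phi s i : smooth phi ->
  ispd i (pderivs s phi) (pderivs (i :: s) phi).
Proof. by move=> sphi; split => //; exact: (sphi s).2. Qed.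

Lemma near_box (P : set V) (x : V) (i j : 'I_d) : (\forall y \near x, P y) ->
  exists2 h : R, 0 < h & forall s t : R, `|s| <= h -> `|t| <= h ->
    P (x + s *: 'e_i + t *: 'e_j).
Proof.
move=> /nbhs_ballP[r /= r0 xrP]; exists (r / 3); first by rewrite divr_gt0.
have ne k : `|'e_k| <= (1 : R).
  apply: norm_le_coord => // l; rewrite mxE eqxx/=.
  by case: eqP => _; rewrite ?normr1 ?normr0.
move=> s t sr tr; apply: xrP; rewrite -ball_normE/= -addrA opprD addrA subrr sub0r normrN.
apply: le_lt_trans (ler_normD _ _) _; rewrite !normrZ.
apply: (@le_lt_trans _ _ (r / 3 + r / 3)); last by lra.
by apply: lerD; rewrite -[leRHS]mulr1 ler_pM.
Qed.

Lemma pderiv_schwarz i j phi : smooth phi ->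
  pderiv i (pderiv j phi) = pderiv j (pderiv i phi).
Proof.
move=> sphi; apply/funext => x.
have ip s k := ispd_pderivs s k sphi.
have cij := (sphi [:: i; j]).1; have cji := (sphi [:: j; i]).1.
have E (s t : R) : x + s *: 'e_i + t *: 'e_j = x + t *: 'e_j + s *: 'e_i.
  by rewrite addrAC.
have near e : 0 < e -> exists2 h : R, 0 < h & forall s t : R, `|s| <= h -> `|t| <= h ->
    Normc.normc (pderivs [:: j; i] phi (x + s *: 'e_i + t *: 'e_j) - pderivs [:: j; i] phi x) <= e /\
    Normc.normc (pderivs [:: i; j] phi (x + s *: 'e_i + t *: 'e_j) - pderivs [:: i; j] phi x) <= e.
  move=> e0; apply: (near_box (P := fun y =>
    Normc.normc (pderivs [:: j; i] phi y - pderivs [:: j; i] phi x) <= e /\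
    Normc.normc (pderivs [:: i; j] phi y - pderivs [:: i; j] phi x) <= e)).
  have /continuous_normcP/(_ _ e0) n1 := cji x.
  have /continuous_normcP/(_ _ e0) n2 := cij x.
  by apply: filterS2 n1 n2 => y /ltW ? /ltW ?.
have x0 : x = x + 0 *: 'e_i + 0 *: 'e_j by rewrite !scale0r !addr0.
suff [hr hi] : complex.Re (pderivs [:: j; i] phi x) = complex.Re (pderivs [:: i; j] phi x)
    /\ complex.Im (pderivs [:: j; i] phi x) = complex.Im (pderivs [:: i; j] phi x).
  exact: complex_ext (esym hr) (esym hi).
split.
  rewrite x0; apply: (@real_schwarz
     (fun s t => complex.Re (phi (x + s *: 'e_i + t *: 'e_j)))
     (fun s t => complex.Re (pderivs [:: i] phi (x + s *: 'e_i + t *: 'e_j)))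
     (fun s t => complex.Re (pderivs [:: j] phi (x + s *: 'e_i + t *: 'e_j)))
     (fun s t => complex.Re (pderivs [:: j; i] phi (x + s *: 'e_i + t *: 'e_j)))
     (fun s t => complex.Re (pderivs [:: i; j] phi (x + s *: 'e_i + t *: 'e_j)))).
  - move=> s t; under eq_fun do rewrite E; rewrite E.
    by have [] := ispd_line (x + t *: 'e_j) (ip [::] i).
  - by move=> s t; have [] := ispd_line (x + s *: 'e_i) (ip [:: i] j).
  - by move=> s t; have [] := ispd_line (x + s *: 'e_i) (ip [::] j).
  - move=> s t; under eq_fun do rewrite E; rewrite E.
    by have [] := ispd_line (x + t *: 'e_j) (ip [:: j] i).
  - move=> e /near[h h0 H]; exists h => // s t sh th; rewrite -x0.
    have [h1 h2] := H _ _ sh th.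
    split; rewrite -raddfB; [exact: le_trans (normc_Re _) h1|exact: le_trans (normc_Re _) h2].
rewrite x0; apply: (@real_schwarz
   (fun s t => complex.Im (phi (x + s *: 'e_i + t *: 'e_j)))
   (fun s t => complex.Im (pderivs [:: i] phi (x + s *: 'e_i + t *: 'e_j)))
   (fun s t => complex.Im (pderivs [:: j] phi (x + s *: 'e_i + t *: 'e_j)))
   (fun s t => complex.Im (pderivs [:: j; i] phi (x + s *: 'e_i + t *: 'e_j)))
   (fun s t => complex.Im (pderivs [:: i; j] phi (x + s *: 'e_i + t *: 'e_j)))).
- move=> s t; under eq_fun do rewrite E; rewrite E.
  by have [] := ispd_line (x + t *: 'e_j) (ip [::] i).
- by move=> s t; have [] := ispd_line (x + s *: 'e_i) (ip [:: i] j).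
- by move=> s t; have [] := ispd_line (x + s *: 'e_i) (ip [::] j).
- move=> s t; under eq_fun do rewrite E; rewrite E.
  by have [] := ispd_line (x + t *: 'e_j) (ip [:: j] i).
- move=> e /near[h h0 H]; exists h => // s t sh th; rewrite -x0.
  have [h1 h2] := H _ _ sh th.
  split; rewrite -raddfB; [exact: le_trans (normc_Im _) h1|exact: le_trans (normc_Im _) h2].
Qed.

Lemma smooth_pderivs phi s : smooth phi -> smooth (pderivs s phi).
Proof. by move=> sphi t; rewrite /pderivs -foldr_cat; exact: sphi. Qed.

Lemma pderivs_perm phi s t : smooth phi -> perm_eq s t -> pderivs s phi = pderivs t phi.
Proof.
move=> sphi; have swap a i b : pderivs (a ++ i :: b) phi = pderivs (i :: a ++ b) phi.
  elim: a => //= j a IH; rewrite IH /=.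
  exact: pderiv_schwarz (smooth_pderivs (a ++ b) sphi).
elim: s t => [|i s IH] t.
  by rewrite perm_sym => /perm_nilP ->.
move=> st; have : i \in t by rewrite -(perm_mem st) mem_head.
move=> /splitPr it; case: it st => a b; rewrite perm_sym perm_catC /= perm_cons perm_catC perm_sym.
by move=> /IH abE; rewrite swap /= abE.
Qed.

(** Mixed derivatives commute, so a word of coordinates matters only through its letter counts,
    which form a multi-index. *)
Definition index_count s : {ffun 'I_d -> nat} := [ffun i => count_mem i s].

Lemma index_count_len s : mi_len (index_count s) = size s.
Proof.
rewrite /mi_len; under eq_bigr do rewrite ffunE.
elim: s => [|i s IH]; first by rewrite big1.
rewrite big_split/= IH -[RHS]add1n; congr (_ + _)%N.
by rewrite (bigD1 i)//= eqxx big1 ?addn0// => j /negbTE; rewrite eq_sym => ->.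
Qed.

Lemma mderiv_pderivs phi s : smooth phi -> mderiv (index_count s) phi = pderivs s phi.
Proof.
move=> sphi; apply: pderivs_perm => //; apply/permP => P.
rewrite count_flatten -map_comp sumnE big_map big_enum/=.
under eq_bigr do rewrite count_nseq ffunE.
elim: s => [|i s IH]; first by rewrite big1// => i _; rewrite muln0.
rewrite /= -IH; under eq_bigr do rewrite mulnDr.
rewrite big_split/=; congr (_ + _)%N.
by rewrite (bigD1 i)//= eqxx muln1 big1 ?addn0// => j /negbTE; rewrite eq_sym => ->; rewrite muln0.
Qed.

Lemma mderivE alpha : exists s : seq 'I_d, size s = mi_len alpha /\
  forall phi, mderiv alpha phi = pderivs s phi.
Proof.
exists (flatten [seq nseq (alpha i) i | i <- enum 'I_d]); split => //.
rewrite size_flatten /shape -map_comp sumnE big_map big_enum/=.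
by apply: eq_bigr => i _; rewrite size_nseq.
Qed.

(** A candidate for each iterated derivative, differentiating to the next ones, gives smoothness and
    the value of all derivatives at once. Products, conjugates, limits, lifts and convolutions all
    pass through this lemma. *)
Lemma smooth_family (Phi : seq 'I_d -> F) :
  (forall s, continuous (Phi s)) ->
  (forall s i, ispd i (Phi s) (Phi (i :: s))) ->
  smooth (Phi [::]) /\ forall s, pderivs s (Phi [::]) = Phi s.
Proof.
move=> cP dP; have E s : pderivs s (Phi [::]) = Phi s.
  by elim: s => //= i s ->; have [_ ->] := dP s i.
by split => // s; rewrite E; split => // i; have [] := dP s i.
Qed.

End PartialDerivatives.

(** * Leibniz rule and ultradifferentiable bounds for products *)

(** By (M.1) consecutive quotients increase, so each factor leading from [M 0] to [M j] is at most
    the matching factor leading from [M l] to [M (j + l)]. *)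
Lemma sub_mult (R : realType) (M : nat -> {posnum R}) : M1 M ->
  forall j l, (M j)%:num * (M l)%:num <= (M 0)%:num * (M (j + l)%N)%:num.
Proof.
move=> m1; pose r p := (M p.+1)%:num / (M p)%:num.
have rS p : r p <= r p.+1.
  by rewrite /r ler_pdivrMr// mulrAC ler_pdivlMr// [leRHS]mulrC -expr2; have := m1 p.+1 isT.
have rle p q : (p <= q)%N -> r p <= r q by exact: (homo_leq lexx le_trans).
have Mr p : (M p.+1)%:num = r p * (M p)%:num by rewrite /r divfK.
move=> j l; elim: j => [|j IH]; first by [].
rewrite addSn !Mr -mulrA [leRHS]mulrCA.
have r0 p : 0 <= r p by rewrite divr_ge0.
apply: ler_pM => //.
exact/rle/leq_addr.
Qed.

Section Products.
Context {R : realType} {d : nat}.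
Local Notation V := 'rV[R]_d.
Local Notation F := (V -> R[i]^o).
Local Notation "''e_' i" := (delta_mx ord0 i : V) (at level 8, i at level 2).
Implicit Types (phi psi chi : F).

Lemma ispd0 i : ispd i (0 : F) 0.
Proof. by split; [exact: (smooth0 [::]).2|exact: (pderivs0 [:: i])]. Qed.

Lemma ispdD i phi psi phi' psi' : ispd i phi phi' -> ispd i psi psi' ->
  ispd i (phi + psi) (phi' + psi').
Proof.
move=> [dphi <-] [dpsi <-]; have [] := pderiv_lin 1 dphi dpsi.
by rewrite !scale1r.
Qed.

Lemma ispd_sum (I : Type) (r : seq I) i (f g : I -> F) :
  (forall j, ispd i (f j) (g j)) -> ispd i (\sum_(j <- r) f j) (\sum_(j <- r) g j).
Proof.
move=> fg; elim: r => [|j r IH]; first by rewrite !big_nil; exact: ispd0.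
by rewrite !big_cons; exact: ispdD.
Qed.

Definition fmul phi psi : F := fun x => phi x * psi x.

Lemma ispdM i phi psi phi' psi' : ispd i phi phi' -> ispd i psi psi' ->
  ispd i (fmul phi psi) (fmul phi' psi + fmul phi psi').
Proof.
move=> [dphi <-] [dpsi <-].
have Er : reF (fmul phi psi) = reF phi * reF psi - imF phi * imF psi.
  by apply/funext => x; rewrite /reF /imF !fctE /fmul; case: (phi x) (psi x) => ? ? [? ?].
have Ei : imF (fmul phi psi) = reF phi * imF psi + imF phi * reF psi.
  by apply/funext => x; rewrite /reF /imF !fctE /fmul; case: (phi x) (psi x) => ? ? [? ?].
split=> [x|].
  have [[a b] [a' b']] := (dphi x, dpsi x); rewrite Er Ei; split.
    exact: derivableB (derivableM a a') (derivableM b b').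
  exact: derivableD (derivableM a b') (derivableM b a').
apply/funext => x; have [[a b] [a' b']] := (dphi x, dpsi x).
rewrite /pderiv Er Ei.
rewrite (deriveB (derivableM a a') (derivableM b b')).
rewrite (deriveD (derivableM a b') (derivableM b a')).
rewrite (deriveM a a') (deriveM b b') (deriveM a b') (deriveM b a').
have -> : (fmul (pderiv i phi) psi + fmul phi (pderiv i psi)) x =
  pderiv i phi x * psi x + phi x * pderiv i psi x by [].
have -> : phi x = (reF phi x +i* imF phi x)%C by rewrite /reF /imF; case: (phi x).
have -> : psi x = (reF psi x +i* imF psi x)%C by rewrite /reF /imF; case: (psi x).
rewrite /pderiv.
move: (reF phi x) (imF phi x) (reF psi x) (imF psi x) => p q p' q'.
move: ('D_'e_i (reF phi) x) ('D_'e_i (imF phi) x) ('D_'e_i (reF psi) x) ('D_'e_i (imF psi) x).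
move=> r t r' t'; apply: complex_ext; rewrite /= /GRing.scale/=; ring.
Qed.

(** The index set of the Leibniz rule: all distributions of the letters of a word over two factors,
    with multiplicity. *)
Fixpoint splits (T : Type) (s : seq T) : seq (seq T * seq T) :=
  if s is i :: s' then [seq (i :: p.1, p.2) | p <- splits s'] ++
                       [seq (p.1, i :: p.2) | p <- splits s']
  else [:: ([::], [::])].

Lemma size_splits (T : Type) (s : seq T) : size (splits s) = (2 ^ size s)%N.
Proof. by elim: s => //= i s IH; rewrite size_cat !size_map IH expnS mul2n addnn. Qed.

Lemma splits_size (s : seq 'I_d) p : p \in splits s -> (size p.1 + size p.2 = size s)%N.
Proof.
elim: s p => [|i s IH] p /=; first by rewrite inE => /eqP ->.
by rewrite mem_cat => /orP[] /mapP[q /IH qs ->] /=; rewrite ?addSn ?addnS qs.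
Qed.

Lemma continuous_sum (I : Type) (r : seq I) (f : I -> F) :
  (forall j, continuous (f j)) -> continuous (\sum_(j <- r) f j).
Proof.
move=> cf; elim: r => [|j r IH]; first by rewrite big_nil; exact: cst_continuous.
by rewrite big_cons; have := @continuous_lin R d 1 _ _ (cf j) IH; rewrite scale1r.
Qed.

Lemma continuous_fmul phi psi : continuous phi -> continuous psi -> continuous (fmul phi psi).
Proof. by move=> cphi cpsi x; exact: cvgM (cphi x) (cpsi x). Qed.

Lemma leibniz phi psi : smooth phi -> smooth psi ->
  smooth (fmul phi psi) /\ forall s, pderivs s (fmul phi psi) =
    \sum_(p <- splits s) fmul (pderivs p.1 phi) (pderivs p.2 psi).
Proof.
move=> sphi spsi.
pose Phi s : F := \sum_(p <- splits s) fmul (pderivs p.1 phi) (pderivs p.2 psi).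
have E : Phi [::] = fmul phi psi by rewrite /Phi /= big_seq1.
have := @smooth_family R d Phi; rewrite E; apply => [s|s i].
  apply: continuous_sum => p; apply: continuous_fmul; first exact: (sphi _).1.
  exact: (spsi _).1.
rewrite /Phi /= big_cat/= !big_map/= -big_split/=.
by apply: ispd_sum => p; apply: ispdM; exact: ispd_pderivs.
Qed.

(* Derivatives are indexed by words in the coordinates rather than by multi-indices; by *)
(* [mderivE] the resulting bounds are the same.                                         *)
Definition ubd (M : nat -> {posnum R}) (k : R) (w : V -> R) (c : R) phi :=
  forall s x, Normc.normc (pderivs s phi x) * w x * k ^+ size s <= c * (M (size s))%:num.

Lemma ubd_ge0 M k w c phi : (exists x, 0 <= w x) -> ubd M k w c phi -> 0 <= c.
Proof.
move=> [x wx] /(_ [::] x); rewrite expr0 mulr1 => H.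
have : 0 <= c * (M 0)%:num by apply: le_trans H; rewrite mulr_ge0 ?normc_ge0.
by rewrite pmulr_lge0.
Qed.

Lemma ubd_le M k k' w w' c c' phi : 0 <= k' <= k -> (forall x, 0 <= w' x <= w x) -> c <= c' ->
  ubd M k w c phi -> ubd M k' w' c' phi.
Proof.
move=> /andP[k0 kk] ww cc H s x; have /andP[w0 wx] := ww x.
apply: le_trans (_ : c * (M (size s))%:num <= _); last by rewrite ler_wpM2r.
apply: le_trans (H s x); apply: ler_pM => //.
- by rewrite mulr_ge0 ?normc_ge0.
- by rewrite exprn_ge0.
- by rewrite ler_wpM2l ?normc_ge0.
- by rewrite lerXn2r ?nnegrE// (le_trans k0).
Qed.

(** Halving [k] absorbs the [2 ^ n] terms of the Leibniz sum at order [n]; [sub_mult] merges the two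
    values of [M] and produces the factor [M 0]. *)
Lemma ubd_mul M k w1 w2 a b phi psi : M1 M -> 0 < k ->
  (forall x, 0 <= w1 x) -> (forall x, 0 <= w2 x) -> smooth phi -> smooth psi ->
  ubd M k w1 a phi -> ubd M k w2 b psi ->
  ubd M (k / 2) (fun x => w1 x * w2 x) (a * b * (M 0)%:num) (fmul phi psi).
Proof.
move=> m1 k0 w10 w20 sphi spsi Ha Hb s x.
have a0 : 0 <= a by apply: ubd_ge0 Ha; exists 0.
have b0 : 0 <= b by apply: ubd_ge0 Hb; exists 0.
have [_ ->] := leibniz sphi spsi; set n := size s.
rewrite fct_sumE expr_div_n.
apply: (@le_trans _ _ ((\sum_(p <- splits s) a * b * (M 0)%:num * (M n)%:num) / 2 ^+ n)); last first.
  rewrite big_const_seq count_predT size_splits -/n iter_addr_0 -[X in X / _ <= _]mulr_natr natrX.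
  by rewrite mulfK// expf_neq0.
rewrite !mulrA ler_wpM2r//.
apply: (@le_trans _ _ (\sum_(p <- splits s) Normc.normc (fmul (pderivs p.1 phi) (pderivs p.2 psi) x) * w1 x * w2 x * k ^+ n)).
  rewrite -!mulr_suml !ler_wpM2r ?exprn_ge0 ?(ltW k0)//; exact: normc_sum.
rewrite [leLHS]big_seq [leRHS]big_seq; apply: ler_sum => p /splits_size ps.
rewrite /fmul Normc.normcM -[n]ps exprD.
rewrite [leLHS](_ : _ = (Normc.normc (pderivs p.1 phi x) * w1 x * k ^+ size p.1) *
   (Normc.normc (pderivs p.2 psi x) * w2 x * k ^+ size p.2)); last by ring.
apply: (@le_trans _ _ ((a * (M (size p.1))%:num) * (b * (M (size p.2))%:num))).
  by apply: ler_pM => //; rewrite !mulr_ge0 ?normc_ge0 ?exprn_ge0 ?(ltW k0).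
rewrite [leLHS](_ : _ = a * b * ((M (size p.1))%:num * (M (size p.2))%:num)); last by ring.
by rewrite -[leRHS]mulrA ler_wpM2l ?mulr_ge0//; exact: sub_mult.
Qed.

Lemma ubdD M k w a b phi psi : 0 <= k -> (forall x, 0 <= w x) -> smooth phi -> smooth psi ->
  ubd M k w a phi -> ubd M k w b psi -> ubd M k w (a + b) (phi + psi).
Proof.
move=> k0 w0 sphi spsi Ha Hb s x; rewrite pderivsD// mulrDl.
apply: le_trans (lerD (Ha s x) (Hb s x)); rewrite -!mulrDl.
by rewrite !ler_wpM2r ?exprn_ge0//; exact: le_normcD.
Qed.

Lemma ubdZ M k w a z phi : smooth phi ->
  ubd M k w a phi -> ubd M k w (Normc.normc z * a) (z *: phi).
Proof.
move=> sphi Ha s x; rewrite pderivsZ//.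
change ((z *: pderivs s phi) x) with (z * pderivs s phi x).
rewrite Normc.normcM -!mulrA ler_wpM2l ?normc_ge0// !mulrA; exact: Ha.
Qed.

Definition fconj phi : F := fun x => (phi x)^*%C.

Lemma ispd_conj i phi psi : ispd i phi psi -> ispd i (fconj phi) (fconj psi).
Proof.
move=> /ispdP H; apply/ispdP => x e /H-/(_ x)[del del0 Hd]; exists del => // h /Hd.
rewrite /fconj; set z := (X in Normc.normc X <= _); set z' := (X in _ -> Normc.normc X <= _).
suff -> : z' = z^*%C.
  have -> // : Normc.normc z^*%C = Normc.normc z.
  by case: (z) => a b; rewrite /Normc.normc/= sqrrN.
by rewrite /z /z'; case: (phi _) (phi _) (psi _) => ? ? [? ?] [? ?]; apply: complex_ext => /=; ring.
Qed.

Lemma pderivs_conj phi : smooth phi ->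
  smooth (fconj phi) /\ forall s, pderivs s (fconj phi) = fconj (pderivs s phi).
Proof.
move=> sphi; apply: (@smooth_family R d (fun s => fconj (pderivs s phi))) => [s x|s i].
  apply/continuous_normcP => e e0; have /continuous_normcP/(_ _ e0) := (sphi s).1 x.
  apply: filterS => y; congr (_ < _); rewrite /fconj -rmorphB/=.
  by case: (_ - _) => a b; rewrite /Normc.normc/= sqrrN.
exact/ispd_conj/ispd_pderivs.
Qed.

Lemma ubd_conj M k w c phi : smooth phi -> ubd M k w c phi -> ubd M k w c (fconj phi).
Proof.
move=> sphi H s x; have [_ ->] := pderivs_conj sphi; rewrite /fconj.
have -> : Normc.normc (pderivs s phi x)^*%C = Normc.normc (pderivs s phi x).
  by case: (pderivs s phi x) => a b; rewrite /Normc.normc/= sqrrN.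
exact: H.
Qed.

End Products.

(** * Limits of smooth functions, and functions of one coordinate *)

Lemma complex_cauchy (R : realType) (z : nat -> R[i]) :
  (forall e, 0 < e -> exists N, forall n m, (N <= n)%N -> (N <= m)%N ->
     Normc.normc (z n - z m) <= e) ->
  exists l, forall e, 0 < e -> exists N, forall n, (N <= n)%N -> Normc.normc (z n - l) <= e.
Proof.
move=> zc.
have real_cauchy (u : nat -> R) : (forall n m, `|u n - u m| <= Normc.normc (z n - z m)) ->
    exists l, forall e, 0 < e -> exists N, forall n, (N <= n)%N -> `|u n - l| <= e.
  move=> uz; have /cvg_ex[l ul] : cvg (u @ \oo).
    apply/cauchy_cvgP/cauchy_exP => e e0.
    have [|N NP] := zc (e / 2); first by rewrite divr_gt0.
    exists (u N); exists N => // n /= Nn.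
    rewrite /ball/=; apply: le_lt_trans (uz _ _) _.
    apply: le_lt_trans (NP _ _ (leqnn N) Nn) _; lra.
  exists l => e e0; move/cvgrPdist_le : ul => /(_ _ e0)[N _ NP].
  by exists N => n /NP; rewrite /= distrC.
have [n m|a aP] := real_cauchy (fun n => complex.Re (z n)).
  by rewrite -raddfB; exact: normc_Re.
have [n m|b bP] := real_cauchy (fun n => complex.Im (z n)).
  by rewrite -raddfB; exact: normc_Im.
exists (a +i* b)%C => e e0.
have e2 : 0 < e / 2 by rewrite divr_gt0.
have [N NP] := aP _ e2; have [K KP] := bP _ e2.
exists (maxn N K) => n; rewrite geq_max => /andP[/NP h1 /KP h2].
rewrite (splitr e); apply: le_trans (normc_le_ReIm _) _; rewrite !raddfB/=.
exact: lerD.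
Qed.

Section Limits.
Context {R : realType} {d : nat}.
Local Notation V := 'rV[R]_d.
Local Notation F := (V -> R[i]^o).
Local Notation "''e_' i" := (delta_mx ord0 i : V) (at level 8, i at level 2).
Implicit Types (phi psi chi : F).

Lemma normc_lim_le (z : nat -> R[i]) l a K (N0 : nat) :
  (forall e, 0 < e -> exists N, forall n, (N <= n)%N -> Normc.normc (z n - l) <= e) ->
  (forall n, (N0 <= n)%N -> Normc.normc (z n - a) <= K) -> Normc.normc (l - a) <= K.
Proof.
move=> zl zK; apply/ler_addgt0Pr => e e0; have [N NP] := zl _ e0.
have -> : l - a = (z (maxn N N0) - a) - (z (maxn N N0) - l) by ring.
apply: le_trans (le_normcD _ _) _; rewrite normcN lerD//.
  by apply: zK; rewrite leq_maxr.
by apply: NP; rewrite leq_maxl.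
Qed.

(** The mean value estimate for [u m - u n] makes the difference quotients converge uniformly in the
    increment, so limit and derivative may be exchanged. *)
Lemma smooth_limit (u : nat -> F) : (forall n, smooth (u n)) ->
  (forall s e, 0 < e -> exists N, forall n m, (N <= n)%N -> (N <= m)%N -> forall x,
     Normc.normc (pderivs s (u n) x - pderivs s (u m) x) <= e) ->
  exists2 phi, smooth phi & forall s x e, 0 < e -> exists N, forall n, (N <= n)%N ->
     Normc.normc (pderivs s (u n) x - pderivs s phi x) <= e.
Proof.
move=> su uc.
have /choice[Phi0 Phi0P] : forall sx : seq 'I_d * V, exists l : R[i], forall e, 0 < e ->
    exists N, forall n, (N <= n)%N -> Normc.normc (pderivs sx.1 (u n) sx.2 - l) <= e.
  move=> [s x]; apply: complex_cauchy => e /(uc s)[N NP].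
  by exists N => n m Nn Nm; exact: NP.
pose Phi s : F := fun x => Phi0 (s, x).
have PhiP s x := Phi0P (s, x).
have unif s e : 0 < e -> exists N, forall n, (N <= n)%N -> forall x,
    Normc.normc (Phi s x - pderivs s (u n) x) <= e.
  move=> e0; have [N NP] := uc s _ e0; exists N => n Nn x.
  by apply: (normc_lim_le (N0 := N) (PhiP s x)) => m Nm; exact: NP.
have [||sPhi E] := @smooth_family R d Phi; last first.
- exists (Phi [::]); first exact: sPhi.
  move=> s x e e0; have [N NP] := PhiP s x _ e0; exists N => n Nn.
  rewrite E; exact: NP.
- move=> s i; apply/ispdP => x eps eps0.
  (* Three errors add up: at most [eps / 4] for replacing the limit by [u n] in the quotient,
     [eps / 4] for the differentiability of [u n], and [eps / 8] for the convergence of the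
     derivatives. *)
  have e8 : 0 < eps / 8 by rewrite divr_gt0.
  have [N NP] := uc (i :: s) _ e8.
  have [K KP] := unif (i :: s) _ e8.
  pose n := maxn N K.
  have e4 : 0 < eps / 4 by rewrite divr_gt0.
  have /ispdP/(_ x _ e4)[del del0 Hd] := ispd_pderivs s i (su n).
  exists del => // h hd; set y := x + h *: 'e_i.
  have H1 : Normc.normc ((Phi s y - Phi s x) - (pderivs s (u n) y - pderivs s (u n) x)) <= eps / 4 * `|h|.
    apply: (@normc_lim_le (fun m => pderivs s (u m) y - pderivs s (u m) x) _ _ _ N).
      move=> e e0; have e2 : 0 < e / 2 by rewrite divr_gt0.
      have [N1 N1P] := PhiP s y _ e2; have [N2 N2P] := PhiP s x _ e2.
      exists (maxn N1 N2) => m; rewrite geq_max => /andP[/N1P h1 /N2P h2].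
      rewrite (_ : _ - _ - _ = (pderivs s (u m) y - Phi s y) - (pderivs s (u m) x - Phi s x)); last by ring.
      by rewrite (splitr e) (le_trans (le_normcD _ _))// normcN lerD.
    move=> m Nm.
    have dm : ispd i (pderivs s (u m) - pderivs s (u n)) (pderivs (i :: s) (u m) - pderivs (i :: s) (u n)).
      rewrite -![- pderivs _ (u n)]scaleN1r ![_ + -1 *: _]addrC.
      have [dn dm] := (ispd_pderivs s i (su n), ispd_pderivs s i (su m)).
      by have [] := pderiv_lin (-1) dn.1 dm.1; rewrite dn.2 dm.2.
    rewrite (_ : eps / 4 = 2 * (eps / 8)); last by field.
    have H (a b c e : R[i]) : a - b - (c - e) = a - c - (b - e) by ring.
    rewrite H; apply: (ispd_MVT dm) => t _; apply: NP => //; exact: leq_maxl.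
  have H2 := Hd _ hd; have H3 := KP n (leq_maxr _ _) x.
  rewrite (_ : _ - _ = (Phi s y - Phi s x - (pderivs s (u n) y - pderivs s (u n) x)) +
      (pderivs s (u n) y - pderivs s (u n) x - h%:C%C * pderivs (i :: s) (u n) x) -
      h%:C%C * (Phi (i :: s) x - pderivs (i :: s) (u n) x)); last by ring.
  apply: le_trans (le_normcD _ _) _; rewrite normcN Normc.normcM normcR.
  apply: le_trans (lerD (le_normcD _ _) (lexx _)) _.
  have : `|h| * Normc.normc (Phi (i :: s) x - pderivs (i :: s) (u n) x) <= `|h| * (eps / 8).
    by rewrite ler_wpM2l.
  have := normr_ge0 h; have := H1; have := H2; rewrite -/y.
  set A := Normc.normc _; set B := Normc.normc _; set C := _ * Normc.normc _; nra.
- move=> s x; apply/continuous_normcP => e e0.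
  have e3 : 0 < e / 3 by rewrite divr_gt0.
  have [N NP] := unif s _ e3.
  have /continuous_normcP/(_ _ e3) := (su N s).1 x.
  apply: filterS => y yx.
  rewrite (_ : _ - _ = (Phi s y - pderivs s (u N) y) + (pderivs s (u N) y - pderivs s (u N) x) - (Phi s x - pderivs s (u N) x)); last by ring.
  apply: le_lt_trans (le_normcD _ _) _; rewrite normcN.
  apply: le_lt_trans (lerD (le_normcD _ _) (lexx _)) _.
  have := NP N (leqnn N) y; have := NP N (leqnn N) x; lra.
Qed.

Lemma ubd_limit (M : nat -> {posnum R}) k w c (u : nat -> F) phi N0 : 0 < k ->
  (forall x, 0 <= w x) ->
  (forall s x e, 0 < e -> exists N, forall n, (N <= n)%N ->
     Normc.normc (pderivs s (u n) x - pderivs s phi x) <= e) ->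
  (forall n, (N0 <= n)%N -> ubd M k w c (u n)) -> ubd M k w c phi.
Proof.
move=> k0 w0 ul ub s x.
have [wx|wx] := eqVneq (w x) 0.
  have := ub _ (leqnn _) s x; rewrite wx !mulr0 !mul0r.
  done.
have wk : 0 < w x * k ^+ size s by rewrite mulr_gt0 ?exprn_gt0// lt_def wx w0.
rewrite -mulrA -ler_pdivlMr// -[X in Normc.normc X]subr0.
apply: (normc_lim_le (N0 := N0) (ul s x)) => n Nn; rewrite subr0 ler_pdivlMr// mulrA.
exact: ub.
Qed.

Lemma ubd_refl (M : nat -> {posnum R}) k w w' c K x phi : 0 <= k -> 0 <= K -> smooth phi ->
  (forall y, w' y <= K * w (x - y)) -> ubd M k w c phi ->
  ubd M k w' (K * c) (refl_trans x phi).
Proof.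
move=> k0 K0 sphi ww H s y; rewrite pderivs_refl//.
change ((_ *: refl_trans x (pderivs s phi)) y) with ((-1) ^+ size s * pderivs s phi (x - y)).
rewrite normc_signM -[leRHS]mulrA.
apply: le_trans (ler_wpM2l K0 (H s (x - y))).
rewrite mulrA ler_wpM2r ?exprn_ge0// mulrCA.
by rewrite ler_wpM2l ?normc_ge0.
Qed.

(** Derivatives are carried along as data, so that affine changes of variable and differences keep
    explicit derivatives of every order. *)
Definition is_jet (v : nat -> R -> R) := forall n (t : R), is_derive t 1 (v n) (v n.+1 t).

Definition clift (i : 'I_d) (v : nat -> R -> R) : F := fun x => (v 0%N (x ord0 i))%:C%C.

Lemma pderivs_lift i v : is_jet v -> smooth (clift i v) /\
  forall s, pderivs s (clift i v) =
    fun x => if all (pred1 i) s then (v (size s) (x ord0 i))%:C%C else 0.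
Proof.
move=> jv.
apply: (@smooth_family R d (fun s x => if all (pred1 i) s then (v (size s) (x ord0 i))%:C%C else 0)).
  move=> s; case: (all (pred1 i) s); last exact: cst_continuous.
  move=> x; apply/continuous_normcP => e e0.
  have cv : {for x, continuous (fun y : V => v (size s) (y ord0 i) : R^o)}.
    apply: continuous_comp; first exact: coord_continuous.
    by apply: differentiable_continuous; apply/derivable1_diffP; have [] := jv (size s) (x ord0 i).
  move/cvgrPdist_lt : cv => /(_ _ e0); apply: filterS => y.
  by rewrite -rmorphB normcR distrC.
move=> s j; apply/ispdP => x e e0 /=.
have [ji|ji] := eqVneq j i; last first.
  exists 1 => // h _ /=; rewrite !mxE eqxx/= (eq_sym i) (negbTE ji) !mulr0 addr0 subr0 subrr.
  by rewrite Normc.normc0 mulr_ge0// ltW.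
case: (all (pred1 i) s); last first.
  exists 1 => // h _; change (Normc.normc ((0 : R[i]) - 0 - h%:C%C * 0) <= e * `|h|).
  by rewrite mulr0 !subrr Normc.normc0 mulr_ge0// ltW.
have [d1 d2] := jv (size s) (x ord0 i).
have /derivable_distP/(_ _ e0)[del del0 H] := conj d1 d2.
exists del => // h /H; rewrite [h *: _]mulr1 -(normcR (_ - _)).
have -> : x ord0 i + h = (x + h *: 'e_j) ord0 i by rewrite !mxE eqxx ji eqxx mulr1.
change ((true && true)) with true.
by rewrite !rmorphB rmorphM.
Qed.

Definition jbd (M : nat -> {posnum R}) (k : R) (w : R -> R) (c : R) (v : nat -> R -> R) :=
  forall n t, `|v n t| * w t * k ^+ n <= c * (M n)%:num.

Lemma ubd_lift M k w c i v : is_jet v -> 0 <= c -> jbd M k w c v ->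
  ubd M k (fun x => w (x ord0 i)) c (clift i v).
Proof.
move=> jv c0 H s x; have [_ ->] := pderivs_lift i jv.
case: ifP => _; first by rewrite normcR; exact: H.
by rewrite Normc.normc0 !mul0r mulr_ge0.
Qed.

Lemma jet_restrict phi x i : smooth phi ->
  is_jet (fun n t => complex.Re (pderivs (nseq n i) phi (x + t *: 'e_i))).
Proof. by move=> sphi n t; have [] := ispd_line x (ispd_pderivs (nseq n i) i sphi). Qed.

End Limits.

(** * Continuity of seminorms on projective and inductive limits *)

Section Domination.
Context {R : realType} {F : lmodType R[i]}.
Local Notation lcs := (@lcspace R F).
Implicit Types (E : lcs) (Q q : F -> R) (X : set F) (S : set (F -> R)).

(** Continuity of a seminorm in quantitative form. The domain and the family of seminorms are
    independent, because the seminorms of one step are often compared on a smaller set. *)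
Definition dominated X S Q := exists s C, [/\ forall q, q \in s -> S q, 0 <= C &
  forall x, X x -> Q x <= C * \sum_(q <- s) q x].

Definition lcs_dominated E Q := dominated (lcs_set E) (lcs_sn E) Q.

Definition lcs_mk E x (Ex : lcs_set E x) : E := LCSElt (mem_set Ex : x \in lcs_pred E).

Lemma lcs_insubdK E x : lcs_set E x -> val (insubd (0 : E) x) = x.
Proof. by move=> Ex; rewrite insubdK//; exact: mem_set. Qed.

Lemma lcs_insubd_val E (x : E) : insubd (0 : E) (val x) = x.
Proof. by apply: val_inj; rewrite lcs_insubdK//; exact: lcs_eltP. Qed.

Lemma lcs_setZ E a x : lcs_set E x -> lcs_set E (a *: x).
Proof. by move=> Ex; rewrite -[_ *: _]addr0; apply: lcs_setP => //; exact: lcs_set0. Qed.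

Lemma lcs_setD E x y : lcs_set E x -> lcs_set E y -> lcs_set E (x + y).
Proof. by move=> Ex Ey; rewrite -[x]scale1r; exact: lcs_setP. Qed.

Lemma lcs_sn_nneg E q x : lcs_sn E q -> lcs_set E x -> 0 <= q x.
Proof. by move=> Sq Ex; exact: (lcs_sn_ge0 (lcs_mk Ex) Sq). Qed.

Lemma seminorm_sub X Q x y : (forall a y, X y -> X (a *: y)) ->
  (forall x y, X x -> X y -> X (x + y)) -> seminorm_on X Q ->
  X x -> X y -> `|Q x - Q y| <= Q (y - x).
Proof.
move=> XZ XD [QZ QD] Xx Xy.
have XN z : X z -> X (- z) by move=> Xz; rewrite -scaleN1r; exact: XZ.
have QN z : X z -> Q (- z) = Q z.
  by move=> Xz; rewrite -scaleN1r QZ// normcN Normc.normc1 mul1r.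
have Xyx : X (y - x) by apply: XD => //; exact: XN.
rewrite ler_norml; apply/andP; split.
  rewrite lerBrDl lerBlDr; have := QD (y - x) x Xyx Xx; rewrite subrK.
  by rewrite addrC.
rewrite lerBlDr; have := QD (x - y) y; rewrite subrK -opprB QN//.
by apply => //; exact: XN.
Qed.

Lemma dominated_sum E (s : seq (F -> R)) C e : (forall q, q \in s -> lcs_sn E q) -> 0 <= C -> 0 < e ->
  exists2 del, 0 < del & forall x, lcs_set E x -> (forall q, q \in s -> q x < del) ->
    C * \sum_(q <- s) q x < e.
Proof.
move=> sE C0 e0; pose D := (C + 1) * (size s).+1%:R.
have D0 : 0 < D by rewrite mulr_gt0// ltr_wpDl.
exists (e / D); first by rewrite divr_gt0.
move=> x Ex sx.
apply: le_lt_trans (_ : C * ((size s)%:R * (e / D)) < e).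
  rewrite ler_wpM2l// mulr_natl -iter_addr_0 -(count_predT s) -big_const_seq.
  by rewrite big_seq [leRHS]big_seq; apply: ler_sum => q /sx /ltW.
rewrite !mulrA ltr_pdivrMr// mulrC ltr_pM2l// /D.
have : (size s)%:R < (size s).+1%:R :> R by rewrite ltr_nat.
have : 0 <= (size s)%:R :> R by [].
nra.
Qed.

(** By homogeneity: a vector rescaled so that the seminorms of [s] fall below [e] has [Q] at most
    1. *)
Lemma dominated_of_ball E Q (s : seq (F -> R)) e : seminorm_on (lcs_set E) Q ->
  (forall q, q \in s -> lcs_sn E q) -> 0 < e ->
  (forall x, lcs_set E x -> (forall q, q \in s -> q x < e) -> Q x <= 1) ->
  lcs_dominated E Q.
Proof.
move=> [QZ QD] sE e0 H; exists s, (2 / e); split => //; first by rewrite divr_ge0// ltW.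
move=> x Ex; set S := \sum_(q <- s) q x.
have S0 : 0 <= S.
  by rewrite /S big_seq; apply: sumr_ge0 => q /sE qE; exact: lcs_sn_nneg qE Ex.
have qS q : q \in s -> q x <= S.
  move=> qs; rewrite /S (big_rem q)//= lerDl big_seq; apply: sumr_ge0 => p /mem_rem /sE pE.
  exact: lcs_sn_nneg pE Ex.
(* The positive [tau] keeps the scaling factor defined when all the seminorms of [x] vanish; it is
   taken arbitrarily small at the end. *)
have step tau : 0 < tau -> Q x <= 2 / e * (S + tau).
  move=> tau0; have St : 0 < S + tau by rewrite ltr_wpDl.
  pose t := e / 2 / (S + tau); have t0 : 0 < t by rewrite !divr_gt0.
  have := H (t%:C%C *: x) (lcs_setZ _ Ex).
  rewrite QZ// normcR gtr0_norm// => Ht.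
  have {}Ht : t * Q x <= 1.
    apply: Ht => q qs; have [qZ _] := lcs_snP (sE q qs).
    rewrite qZ// normcR gtr0_norm//; apply: le_lt_trans (_ : t * S < e).
      by rewrite ler_wpM2l ?(ltW t0)// qS.
    rewrite /t mulrAC ltr_pdivrMr//; nra.
  have := ler_wpM2l (_ : 0 <= 2 / e * (S + tau)) Ht.
  rewrite mulr1 mulrA (_ : 2 / e * (S + tau) * t = 1) ?mul1r.
    by apply; rewrite mulr_ge0 ?divr_ge0// ltW.
  by rewrite /t; field; rewrite !gt_eqF.
apply/ler_addgt0Pr => eps eps0.
have := step (eps * e / 2) _.
rewrite mulrDr (_ : 2 / e * (eps * e / 2) = eps); last by field; rewrite gt_eqF.
by apply; rewrite divr_gt0// mulr_gt0.
Qed.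

Lemma dominated_continuous_at E (W : set E) Q (x : E) e :
  lcs_dominated E Q -> 0 < e ->
  (forall y : E, Q (val (y - x)) < e -> W y) -> nbhs x W.
Proof.
move=> [s [C [sE C0 QC]]] e0 H.
have [del del0 Hdel] := dominated_sum sE C0 e0.
exists s, del; split => // y yx; apply: H.
apply: le_lt_trans (QC _ (lcs_eltP (y - x))) _; apply: Hdel => //.
exact: lcs_eltP.
Qed.

Lemma insubd_lin E a x y : lcs_set E x -> lcs_set E y ->
  insubd (0 : E) (a *: x + y) = a *: insubd (0 : E) x + insubd (0 : E) y.
Proof.
move=> Ex Ey; apply: val_inj; rewrite linearP/= !lcs_insubdK//.
exact: lcs_setP.
Qed.

(** Composition with [insubd 0] makes a functional on the subspace into a function on all of [F],
    which is where seminorms are defined. *)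
Lemma linear_seminorm E (g : {linear E -> R[i]^o}) :
  seminorm_on (lcs_set E) (fun x => Normc.normc (g (insubd 0 x))).
Proof.
split=> [a x Ex|x y Ex Ey].
  have := insubd_lin a Ex (lcs_set0 E); rewrite addr0 => ->.
  rewrite (_ : insubd (0 : E) 0 = 0); last first.
    by apply: val_inj; rewrite lcs_insubdK//; exact: lcs_set0.
  by rewrite addr0 linearZ Normc.normcM.
have := insubd_lin 1 Ex Ey; rewrite !scale1r => ->.
rewrite linearD; exact: le_normcD.
Qed.

Lemma linear_dominated E (g : {linear E -> R[i]^o}) : continuous g ->
  lcs_dominated E (fun x => Normc.normc (g (insubd 0 x))).
Proof.
move=> cg; have /continuous_normcP/(_ _ ltr01)[s [e [sE e0 H]]] := cg 0.
apply: (@dominated_of_ball _ _ s e) => //; first exact: linear_seminorm.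
move=> x Ex sx; apply: ltW; rewrite -[X in Normc.normc X]subr0 -(linear0 g).
by apply: H => q qs; rewrite subr0 lcs_insubdK//; exact: sx.
Qed.

Lemma dominated_linear E (g : {linear E -> R[i]^o}) :
  lcs_dominated E (fun x => Normc.normc (g (insubd 0 x))) -> continuous g.
Proof.
move=> dg x; apply/continuous_normcP => e e0.
apply: (dominated_continuous_at dg e0) => y.
by rewrite lcs_insubd_val linearB.
Qed.

Lemma lcs_dominated_sn E q : lcs_sn E q -> lcs_dominated E q.
Proof.
move=> qE; exists [:: q], 1; split => // [p|x _]; first by rewrite inE => /eqP ->.
by rewrite big_seq1 mul1r.
Qed.

Lemma dominatedS X X' S S' Q : X' `<=` X -> S `<=` S' -> dominated X S Q -> dominated X' S' Q.
Proof.
by move=> XX SS [s [C [sS C0 H]]]; exists s, C; split => // [q /sS/SS|x /XX/H].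
Qed.

Lemma dominated_le X S Q Q' C : 0 <= C -> (forall x, X x -> Q' x <= C * Q x) ->
  dominated X S Q -> dominated X S Q'.
Proof.
move=> C0 QQ [s [D [sS D0 H]]]; exists s, (C * D); split => //; first exact: mulr_ge0.
by move=> x Xx; rewrite (le_trans (QQ _ Xx))// -mulrA ler_wpM2l// H.
Qed.

Lemma dominated_trans X X' S S' Q : X' `<=` X -> (forall q x, S' q -> X' x -> 0 <= q x) ->
  (forall q, S q -> dominated X' S' q) -> dominated X S Q -> dominated X' S' Q.
Proof.
move=> XX S0 SS [t [D [tS D0 Ht]]]; apply: dominated_le D0 (fun x h => Ht x (XX x h)) _.
elim: t tS {Ht} => [|q t IH] tS.
  by exists [::], 0; split => // x _; rewrite big_nil mul0r.
have [|t1 [D1 [t1S D10 H1]]] := IH; first by move=> p pt; apply: tS; rewrite inE pt orbT.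
have [t2 [D2 [t2S D20 H2]]] := SS _ (tS q (mem_head _ _)).
exists (t1 ++ t2), (D1 + D2); split.
- by move=> p; rewrite mem_cat => /orP[/t1S|/t2S].
- by rewrite addr_ge0.
- move=> x Xx; rewrite big_cons big_cat/=.
  have p1 : 0 <= \sum_(p <- t1) p x by rewrite big_seq sumr_ge0// => p /t1S/S0; exact.
  have p2 : 0 <= \sum_(p <- t2) p x by rewrite big_seq sumr_ge0// => p /t2S/S0; exact.
  have := H1 _ Xx; have := H2 _ Xx; nra.
Qed.

(** Only finitely many seminorms enter a bound, and in a directed family all of them can be replaced
    by those of one index. *)
Lemma dominated_dir (I : Type) X (S : I -> set (F -> R)) Q (i0 : I) :
  (forall i x q, S i q -> X x -> 0 <= q x) ->
  (forall i j, exists k, forall q, S i q \/ S j q -> dominated X (S k) q) ->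
  dominated X (\bigcup_i S i) Q -> exists k, dominated X (S k) Q.
Proof.
move=> S0 Sdir [s [C [sS C0 H]]].
suff [k Hk] : exists k, dominated X (S k) (fun x => \sum_(q <- s) q x).
  by exists k; exact: dominated_le C0 H Hk.
elim: s sS {H} => [|q s IH] sS.
  by exists i0, [::], 0; split => // x _; rewrite big_nil mul0r.
have [|k Hk] := IH; first by move=> p ps; apply: sS; rewrite inE ps orbT.
have [i _ iq] := sS q (mem_head _ _).
have [l Hl] := Sdir i k; exists l.
have [t1 [D1 [t1S D10 H1]]] := Hl q (or_introl iq).
have [t2 [D2 [t2S D20 H2]]] :=
  dominated_trans (@subset_refl _ X) (fun q x => S0 l x q) (fun q h => Hl q (or_intror h)) Hk.
exists (t1 ++ t2), (D1 + D2); split.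
- by move=> p; rewrite mem_cat => /orP[/t1S|/t2S].
- by rewrite addr_ge0.
- move=> x Xx; rewrite big_cons big_cat/=.
  have p1 : 0 <= \sum_(p <- t1) p x by rewrite big_seq sumr_ge0// => p /t1S/S0; exact.
  have p2 : 0 <= \sum_(p <- t2) p x by rewrite big_seq sumr_ge0// => p /t2S/S0; exact.
  have := H1 _ Xx; have := H2 _ Xx; nra.
Qed.

Lemma dominated_projlim (I : Type) (E : I -> lcs) i Q :
  lcs_dominated (E i) Q -> lcs_dominated (projlim E) Q.
Proof.
apply: dominatedS; first by move=> x; exact.
by move=> q; exists i.
Qed.

Lemma indlim_step (I : Type) (E : I -> lcs) i x : lcs_set (E i) x -> lcs_set (indlim E) x.
Proof. by move=> Ex; exists [:: x]; rewrite ?big_seq1// => y; rewrite inE => /eqP ->; exists i. Qed.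

Lemma indlim_sub (I : Type) (E : I -> lcs) (G : lcs) :
  (forall i, lcs_set (E i) `<=` lcs_set G) -> lcs_set (indlim E) `<=` lcs_set G.
Proof.
move=> EG x [s sE ->]; elim: s sE => [_|y s IH sE]; first by rewrite big_nil; exact: lcs_set0.
rewrite big_cons; apply: lcs_setD; last by apply: IH => z zs; apply: sE; rewrite inE zs orbT.
by case: (sE y (mem_head _ _)) => i; exact: EG.
Qed.

(** On each step, domination gives continuity by the reverse triangle inequality. *)
Lemma indlim_snI (I : Type) (E : I -> lcs) Q : seminorm_on (lcs_set (indlim E)) Q ->
  (forall i, lcs_dominated (E i) Q) -> lcs_sn (indlim E) Q.
Proof.
move=> sQ dQ; split => // i x W /nbhs_ballP[e /= e0 eW].
have QZ (a : R[i]) y : lcs_set (E i) y -> lcs_set (E i) (a *: y) by exact: lcs_setZ.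
have QD y z : lcs_set (E i) y -> lcs_set (E i) z -> lcs_set (E i) (y + z) by exact: lcs_setD.
have sQi : seminorm_on (lcs_set (E i)) Q by apply: seminorm_onS sQ => y; exact: indlim_step.
apply: (dominated_continuous_at (dQ i) e0) => y yx; apply: eW.
apply: le_lt_trans yx.
exact: (seminorm_sub QZ QD sQi (lcs_eltP _) (lcs_eltP _)).
Qed.

Lemma indlim_snE (I : Type) (E : I -> lcs) q i : lcs_sn (indlim E) q -> lcs_dominated (E i) q.
Proof.
move=> [sq /(_ i 0) cq].
have sqi : seminorm_on (lcs_set (E i)) q by apply: seminorm_onS sq => y; exact: indlim_step.
have [s [e [sE e0 H]]] := cq _ (nbhsx_ballx (q (val (0 : E i)) : R^o) 1 ltr01).
apply: (@dominated_of_ball _ _ s e) => // x Ex sx.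
have [qZ _] := sqi; have q0 : q 0 = 0.
  by rewrite -(scale0r (0 : F)) qZ ?Normc.normc0 ?mul0r//; exact: lcs_set0.
have : `|q 0 - q x| < 1.
  by apply: (H (lcs_mk Ex)) => p ps; rewrite subr0; exact: sx.
rewrite q0 sub0r normrN => /ltW; apply: le_trans; exact: ler_norm.
Qed.

Lemma indlim_dominated (I : Type) (E : I -> lcs) Q i :
  lcs_dominated (indlim E) Q -> lcs_dominated (E i) Q.
Proof.
apply: dominated_trans => [x|q x|q]; [exact: indlim_step|exact: lcs_sn_nneg|].
exact: indlim_snE.
Qed.

Lemma dominated_indlim (I : Type) (E : I -> lcs) Q : seminorm_on (lcs_set (indlim E)) Q ->
  (forall i, lcs_dominated (E i) Q) -> lcs_dominated (indlim E) Q.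
Proof. by move=> sQ EQ; apply/lcs_dominated_sn/indlim_snI. Qed.

End Domination.

Lemma lcs_map_continuous (R : realType) (F F' : lmodType R[i]) (E : @lcspace R F)
    (G : @lcspace R F') (T : E -> G) : (forall x y, T x - T y = T (x - y)) ->
  (forall q, lcs_sn G q -> lcs_dominated E (fun x => q (val (T (insubd 0 x))))) ->
  continuous T.
Proof.
move=> TB dT x W [s [e [sG e0 H]]].
suff : nbhs x (fun y => forall q, q \in s -> q (val (T (y - x))) < e).
  by apply: filterS => y yx; apply: H => q qs; rewrite TB; exact: yx.
elim: s sG {H} => [|q s IH] sG.
  by apply: filterS filterT => y _ q; rewrite in_nil.
have h1 : nbhs x (fun y => forall q, q \in s -> q (val (T (y - x))) < e).
  by apply: IH => p ps; apply: sG; rewrite inE ps orbT.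
have h2 : nbhs x (fun y => q (val (T (y - x))) < e).
  apply: (dominated_continuous_at (dT q (sG q (mem_head _ _))) e0) => y.
  by rewrite lcs_insubd_val.
by apply: filterS2 h1 h2 => y h1 h2 p; rewrite inE => /predU1P[->|/h1].
Qed.

(** * The associated function and its exponential weights *)

Section AssociatedFunction.
Context {R : realType} (A : nat -> {posnum R}) (wA : weight_seq A).

Definition eassoc (t : R) : R := expR (assoc_fun A t).

Lemma eassoc_gt0 t : 0 < eassoc t. Proof. exact: expR_gt0. Qed.

Lemma eassoc_ge1 t : 0 <= t -> 1 <= eassoc t.
Proof. by move=> t0; rewrite -expR0 ler_expR assoc_fun_ge0. Qed.

Lemma eassoc_le s t : 0 <= s -> s <= t -> eassoc s <= eassoc t.
Proof. by move=> s0 st; rewrite ler_expR assoc_fun_le. Qed.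

Lemma eassoc_pow p t : 0 <= t -> t ^+ p * (A 0)%:num / (A p)%:num <= eassoc t.
Proof.
rewrite le_eqVlt => /predU1P[<-|t0].
  case: p => [|p]; first by rewrite expr0 mul1r divff// eassoc_ge1.
  by rewrite expr0n/= !mul0r ltW// eassoc_gt0.
have r0 : 0 < t ^+ p * (A 0)%:num / (A p)%:num by rewrite !mulr_gt0// exprn_gt0.
rewrite -[leLHS]lnK ?posrE// ler_expR /assoc_fun gt_eqF//.
by apply: ub_le_sup; [exact: assoc_fun_has_ubound|exists p].
Qed.

(** (M.2) bounds the product of the terms of index [p] and [q] at [t] by the term of index [p + q]
    at [H * t]; then suprema are taken over [p] and [q]. This is what allows one weight to be spent
    twice. *)
Lemma eassoc_sqr : M2 A -> exists C H : R, [/\ 1 <= C, 1 <= H &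
  forall t, 0 <= t -> eassoc t * eassoc t <= C * eassoc (H * t)].
Proof.
(* The added 1 makes the constant at least 1 and settles [t = 0]. *)
move=> [C [H [C1 H1 CH]]]; exists (C * (A 0)%:num + 1), H.
have CA : 0 < C * (A 0)%:num by rewrite mulr_gt0// (lt_le_trans _ C1).
have H0 : 0 < H by exact: lt_le_trans H1.
split; [by rewrite lerDr ltW|exact: H1|move=> t].
rewrite le_eqVlt => /predU1P[<-|t0].
  rewrite mulr0 {1 2}/eassoc /assoc_fun eqxx expR0 mulr1.
  have := eassoc_ge1 (lexx 0); nra.
have Ht0 : 0 < H * t by rewrite mulr_gt0.
pose r s p := s ^+ p * (A 0)%:num / (A p)%:num.
have r0 s p : 0 < s -> 0 < r s p by move=> s0; rewrite !mulr_gt0// exprn_gt0.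
have rr p q : r t p * r t q <= C * (A 0)%:num * r (H * t) (p + q)%N.
  rewrite /r exprMn; set a := (A 0)%:num; set T := t ^+ (p + q).
  have -> : t ^+ p * a / (A p)%:num * (t ^+ q * a / (A q)%:num) =
      T * a ^+ 2 / ((A p)%:num * (A q)%:num).
    by rewrite /T exprD; field; rewrite !gt_eqF.
  have -> : C * a * (H ^+ (p + q) * T * a / (A (p + q)%N)%:num) =
      T * a ^+ 2 / (A (p + q)%N)%:num * (C * H ^+ (p + q)).
    by field; rewrite gt_eqF.
  have T0 : 0 <= T by rewrite exprn_ge0// ltW.
  rewrite ler_pdivrMr// [leRHS](_ : _ = T * a ^+ 2 *
      (C * H ^+ (p + q) * (A p)%:num * (A q)%:num / (A (p + q)%N)%:num)); last first.
    by field; rewrite gt_eqF.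
  apply: ler_peMr; first by apply: mulr_ge0 => //; exact: sqr_ge0.
  by rewrite ler_pdivlMr// mul1r; exact: CH.
have u := assoc_fun_has_ubound wA t0; have v := assoc_fun_has_ubound wA Ht0.
have lnr p q : ln (r t p) + ln (r t q) <= ln (C * (A 0)%:num) + assoc_fun A (H * t).
  have [rp rq rpq] := And3 (r0 _ p t0) (r0 _ q t0) (r0 _ (p + q)%N Ht0).
  rewrite -lnM ?posrE//; apply: le_trans (_ : ln (C * (A 0)%:num * r (H * t) (p + q)%N) <= _).
    by rewrite ler_ln ?posrE ?rr//; exact: mulr_gt0.
  rewrite lnM ?posrE// lerD2l /assoc_fun (gt_eqF Ht0).
  by apply: ub_le_sup => //; exists (p + q)%N.
have ne : range (fun p => ln (r t p)) !=set0 by exists (ln (r t 0)), 0%N.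
have step q : assoc_fun A t <= ln (C * (A 0)%:num) + assoc_fun A (H * t) - ln (r t q).
  rewrite {1}/assoc_fun (gt_eqF t0); apply: ge_sup => // _ [p _ <-].
  by rewrite lerBrDr; exact: lnr.
have : assoc_fun A t <= ln (C * (A 0)%:num) + assoc_fun A (H * t) - assoc_fun A t.
  rewrite {1}/assoc_fun (gt_eqF t0); apply: ge_sup => // _ [q _ <-].
  by have := step q; rewrite !lerBrDr addrC.
rewrite lerBrDr => h; rewrite /eassoc -expRD.
apply: (@le_trans _ _ (expR (ln (C * (A 0)%:num) + assoc_fun A (H * t)))).
  by rewrite ler_expR.
by rewrite expRD lnK ?posrE// ler_wpM2r ?lerDl// ltW// expR_gt0.
Qed.

End AssociatedFunction.

Section GelfandShilovWeights.
Context {R : realType} {d : nat} (A : nat -> {posnum R}) (wA : weight_seq A).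
Local Notation V := 'rV[R]_d.
Implicit Types (x y : V).

Definition gsw (h : R) x : R := eassoc A (h * enorm x).

Lemma exp_weightE (h : {posnum R}) x : (exp_weight A h x)%:num = gsw h%:num x.
Proof. by rewrite /= enormZ. Qed.

Lemma gsw_gt0 h x : 0 < gsw h x. Proof. exact: eassoc_gt0. Qed.

Lemma gsw_ge0 h x : 0 <= gsw h x. Proof. exact/ltW/gsw_gt0. Qed.

Lemma gsw_ge1 h x : 0 <= h -> 1 <= gsw h x.
Proof. by move=> h0; rewrite eassoc_ge1// mulr_ge0// enorm_ge0. Qed.

Lemma gsw_le h k x : 0 <= h -> h <= k -> gsw h x <= gsw k x.
Proof. by move=> h0 hk; rewrite eassoc_le// ?mulr_ge0 ?ler_wpM2r ?enorm_ge0. Qed.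

(** The associated function is nondecreasing and nonnegative, so at the larger of two arguments it
    is at most the sum of both values; enlarging the parameter replaces subadditivity. *)
Lemma gsw_max (C : R) h k x y z : 0 <= h -> 0 <= k -> C * h <= k -> 0 <= C ->
  enorm y <= C * Num.max (enorm x) (enorm z) -> gsw h y <= gsw k x * gsw k z.
Proof.
move=> h0 k0 hk C0 yxz.
have m : h * enorm y <= k * Num.max (enorm x) (enorm z).
  apply: le_trans (ler_wpM2l h0 yxz) _; rewrite mulrA (mulrC h) ler_wpM2r//.
  by rewrite le_max enorm_ge0.
have gx : 1 <= gsw k x by exact: gsw_ge1.
have gz : 1 <= gsw k z by exact: gsw_ge1.
have hy : 0 <= h * enorm y by rewrite mulr_ge0// enorm_ge0.
have mulge (a b c : R) : 1 <= b -> 1 <= c -> a <= b \/ a <= c -> a <= b * c.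
  move=> b1 c1 [] le; apply: le_trans le _; [apply: ler_peMr|apply: ler_peMl] => //;
  exact: le_trans ler01 _.
apply: mulge => //; move: m; rewrite maxr_pMr// le_max => /orP[] m; [left|right]; exact: eassoc_le.
Qed.

Lemma enormN x : enorm (- x) = enorm x.
Proof. by rewrite /enorm; congr Num.sqrt; apply: eq_bigr => i _; rewrite mxE sqrrN. Qed.

Lemma gsw_refl h k x y : 0 <= h -> 2 * h <= k -> gsw h y <= gsw k x * gsw k (x - y).
Proof.
move=> h0 hk; have k0 : 0 <= k by lra.
apply: (gsw_max (C := 2)) => //.
by have := enorm_max x (y - x); rewrite addrCA subrr addr0 -(enormN (y - x)) opprB.
Qed.

Lemma gsw_mul C H h x :
  (forall t, 0 <= t -> eassoc A t * eassoc A t <= C * eassoc A (H * t)) -> 0 <= h ->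
  gsw h x * gsw h x <= C * gsw (H * h) x.
Proof. by move=> CH h0; rewrite /gsw -mulrA; apply: CH; rewrite mulr_ge0// enorm_ge0. Qed.

End GelfandShilovWeights.

(** * Steps of the limits over the parameter *)

Section Steps.
Context {R : realType} {d : nat}.
Local Notation V := 'rV[R]_d.
Local Notation F := (V -> R[i]^o).
Local Notation lcs := (@lcspace R F).
Implicit Types (phi : F) (M A : nat -> {posnum R}) (w : V -> {posnum R}) (h : {posnum R}).

Definition nweight w (x : V) : R := (w x)%:num.

Lemma ultra_seminorm_ubd M h w c phi : smooth phi ->
  (forall ax, ultra_seminorm M h w ax phi <= c) <-> ubd M h%:num (nweight w) c phi.
Proof.
move=> sphi; split => [H s x|H [alpha x]].
  have := H (index_count s, x); rewrite /ultra_seminorm/= index_count_len mderiv_pderivs//.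
  by rewrite ler_pdivrMr// -mulrA (mulrC (_ ^+ _)).
rewrite /ultra_seminorm/=; have [s [sz E]] := @mderivE R d alpha; rewrite -sz E.
by rewrite ler_pdivrMr// -mulrA (mulrC (_ ^+ _)); exact: H.
Qed.

Lemma BstepP M w h phi : lcs_set (Bstep M w h) phi <->
  smooth phi /\ exists c, ubd M h%:num (nweight w) c phi.
Proof.
split=> [[sphi [c cP]]|[sphi [c cP]]]; split => //.
  by exists c; apply: (proj1 (ultra_seminorm_ubd M h w c sphi)) => ax; apply: cP; exists ax.
exists c => _ [ax _ <-]; exact: (proj2 (ultra_seminorm_ubd M h w c sphi) cP ax).
Qed.

(** The step norm is a supremum, so a bound by it is a bound by each upper bound [b]; later
    estimates can then avoid suprema. *)
Lemma Bstep_dominatedP M w h (X : set F) Q : X `<=` lcs_set (Bstep M w h) ->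
  dominated X (lcs_sn (Bstep M w h)) Q <->
  exists2 C, 0 <= C & forall phi b, X phi -> ubd M h%:num (nweight w) b phi -> Q phi <= C * b.
Proof.
move=> XB; pose p := sup_norm (ultra_seminorm M h w).
have pE q : lcs_sn (Bstep M w h) q <-> q = p by [].
have p_le phi b : X phi -> ubd M h%:num (nweight w) b phi -> p phi <= b.
  move=> /XB[sphi _] bphi; have H := proj2 (ultra_seminorm_ubd M h w b sphi) bphi.
  apply: ge_sup.
    by eexists; exists ([ffun=> 0%N], 0).
  by move=> _ [ax _ <-].
split => [[s [C [sE C0 H]]]|[C C0 H]].
  exists (C * (size s)%:R); first by rewrite mulr_ge0.
  move=> phi b Xphi bphi; apply: le_trans (H _ Xphi) _; rewrite -mulrA ler_wpM2l//.
  rewrite mulr_natl -iter_addr_0 -(count_predT s) -big_const_seq big_seq [leRHS]big_seq.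
  by apply: ler_sum => q /sE/pE ->; exact: p_le.
exists [:: p], C; split => // [q|phi Xphi]; first by rewrite inE => /eqP ->.
rewrite big_seq1; apply: H => //; have [sphi bphi] := XB _ Xphi.
apply: (proj1 (ultra_seminorm_ubd M h w _ sphi)) => ax.
by apply: ub_le_sup => //; exists ax.
Qed.

Definition gsb M A (h c : R) phi := smooth phi /\ ubd M h (gsw A h) c phi.

Lemma gsb_le M A (h k c c' : R) phi : weight_seq A -> 0 <= h -> h <= k -> c <= c' ->
  gsb M A k c phi -> gsb M A h c' phi.
Proof.
move=> wA h0 hk cc [sphi H]; split => //; apply: ubd_le H => //; first by rewrite h0.
by move=> x; rewrite gsw_ge0 gsw_le.
Qed.

Lemma BstepGS M A h phi : lcs_set (Bstep M (exp_weight A h) h) phi <->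
  exists c, gsb M A h%:num c phi.
Proof.
have E : nweight (exp_weight A h) = gsw A h%:num by apply/funext => x; exact: exp_weightE.
split=> [/BstepP[sphi [c]]|[c [sphi cphi]]]; first by rewrite E => cphi; exists c.
by apply/BstepP; split => //; exists c; rewrite E.
Qed.

(* [hall] describes membership in the limit over [h], [hex] boundedness of a seminorm on it. *)
Definition hall (c : ultra_case) (P : {posnum R} -> Prop) :=
  if c is Beurling then forall h, P h else exists h, P h.
Definition hex (c : ultra_case) (P : {posnum R} -> Prop) :=
  if c is Beurling then exists h, P h else forall h, P h.

Definition decreasing_steps (E : {posnum R} -> lcs) := forall h k, h%:num <= k%:num ->
  lcs_set (E k) `<=` lcs_set (E h) /\
  forall q, lcs_sn (E h) q -> lcs_dominated (E k) q.

Lemma posnum_max h h' : exists k : {posnum R}, h%:num <= k%:num /\ h'%:num <= k%:num.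
Proof.
by exists (Num.max h%:num h'%:num)%:pos; rewrite /= !le_max !lexx orbT.
Qed.

Lemma posnum_min h h' : exists k : {posnum R}, k%:num <= h%:num /\ k%:num <= h'%:num.
Proof.
by exists (Num.min h%:num h'%:num)%:pos; rewrite /= !ge_min !lexx orbT.
Qed.

Lemma hlim_set c E : decreasing_steps E ->
  lcs_set (hlim c E) = [set phi | hall c (fun h => lcs_set (E h) phi)].
Proof.
move=> dE; case: c.
  by apply/seteqP; split => phi H h; [exact: H|move=> _; exact: H].
rewrite /hlim indlim_setE; last first.
- move=> h h'; have [k [kh kh']] := posnum_min h h'.
  by exists k => phi [/(proj1 (dE _ _ kh))|/(proj1 (dE _ _ kh'))].
- exact: (inhabits 1%:pos).
by apply/seteqP; split => phi [h]; [move=> _ ?; exists h|move=> ?; exists h].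
Qed.

(** A continuous seminorm is bounded on one step of a projective limit, on every step of an
    inductive one. The intersection with the step gives both cases the same form: it is the whole
    limit in the Beurling case and the step in the Roumieu case. *)
Lemma hlim_dominated c E Q : decreasing_steps E ->
  seminorm_on (lcs_set (hlim c E)) Q -> lcs_dominated (hlim c E) Q <->
  hex c (fun h => dominated (lcs_set (hlim c E) `&` lcs_set (E h)) (lcs_sn (E h)) Q).
Proof.
move=> dE; case: c => sQ /=.
  have sub h : lcs_set (projlim E) `<=` lcs_set (E h) by move=> phi; exact.
  split => [H|[h]].
    have h1 (h : {posnum R}) phi q : lcs_sn (E h) q -> lcs_set (projlim E) phi -> 0 <= q phi.
      by move=> qE /(sub h); exact: lcs_sn_nneg.
    have h2 (h h' : {posnum R}) : exists k, forall q, lcs_sn (E h) q \/ lcs_sn (E h') q ->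
        dominated (lcs_set (projlim E)) (lcs_sn (E k)) q.
      have [k [hk hk']] := posnum_max h h'; exists k => q [] qE.
        exact: dominatedS (sub k) (@subset_refl _ _) (proj2 (dE _ _ hk) q qE).
      exact: dominatedS (sub k) (@subset_refl _ _) (proj2 (dE _ _ hk') q qE).
    have [h Hh] := dominated_dir 1%:pos h1 h2 H.
    by exists h; apply: dominatedS Hh => // phi [].
  apply: dominatedS; first by move=> phi H; split => //; exact: sub.
  by move=> q; exists h.
split => [H h|H].
  have := indlim_dominated h H; apply: dominatedS => //; exact: subIsetr.
apply: dominated_indlim => // h; apply: dominatedS (H h) => // phi ephi.
by split => //; exact: indlim_step ephi.
Qed.

End Steps.

(** * Function spaces and their topologies *)

Lemma posnum_ext (R : realType) (x y : {posnum R}) : x%:num = y%:num -> x = y.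
Proof. by move=> xy; apply: val_inj. Qed.

Definition pscale (R : realType) (r h : {posnum R}) : {posnum R} := (r%:num * h%:num)%:pos.

Definition posinv (R : realType) (r : {posnum R}) : {posnum R} := (r%:num^-1)%:pos.

Lemma pscaleK (R : realType) (r h : {posnum R}) : pscale r (pscale (posinv r) h) = h.
Proof. by apply: posnum_ext; rewrite /= mulrA divff// mul1r. Qed.

Section Spaces.
Context {R : realType} {d : nat}.
Local Notation V := 'rV[R]_d.
Local Notation F := (V -> R[i]^o).
Local Notation lcs := (@lcspace R F).
Implicit Types (phi : F) (M A : nat -> {posnum R}) (w : V -> {posnum R}) (h k : {posnum R}).
Implicit Types (c : ultra_case) (W : nat -> V -> {posnum R}).

Lemma Bstep_mono M w w' h k : h%:num <= k%:num -> (forall x, nweight w x <= nweight w' x) ->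
  lcs_set (Bstep M w' k) `<=` lcs_set (Bstep M w h) /\
  forall q, lcs_sn (Bstep M w h) q -> lcs_dominated (Bstep M w' k) q.
Proof.
move=> hk ww.
have le phi b : ubd M k%:num (nweight w') b phi -> ubd M h%:num (nweight w) b phi.
  apply: ubd_le => //; first by rewrite hk andbT.
  by move=> x; rewrite ww andbT /nweight.
have sub : lcs_set (Bstep M w' k) `<=` lcs_set (Bstep M w h).
  by move=> phi /BstepP[sphi [b /le bphi]]; apply/BstepP; split => //; exists b.
split => // q qE.
have /(Bstep_dominatedP q sub)[C C0 H] : dominated (lcs_set (Bstep M w' k)) (lcs_sn (Bstep M w h)) q.
  exact: dominatedS sub (@subset_refl _ _) (lcs_dominated_sn qE).
apply/(Bstep_dominatedP _ (@subset_refl _ _)); exists C => // phi b Ephi /le.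
exact: H.
Qed.

Lemma Bspace_decr M w : decreasing_steps (Bstep M w).
Proof. by move=> h k hk; apply: Bstep_mono. Qed.

Lemma BspaceP c M w phi : lcs_set (Bspace c M w) phi <->
  hall c (fun h => smooth phi /\ exists b, ubd M h%:num (nweight w) b phi).
Proof.
rewrite /Bspace hlim_set; last exact: Bspace_decr.
by case: c => /=; [split=> H h; apply/BstepP; exact: H|split=> -[h /BstepP]; exists h].
Qed.

Lemma Bspace_dominatedP c M w Q : seminorm_on (lcs_set (Bspace c M w)) Q ->
  lcs_dominated (Bspace c M w) Q <->
  hex c (fun h => exists2 C, 0 <= C & forall phi b, lcs_set (Bspace c M w) phi ->
    smooth phi -> ubd M h%:num (nweight w) b phi -> Q phi <= C * b).
Proof.
move=> sQ; apply: iff_trans (hlim_dominated (@Bspace_decr M w) sQ) _.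
have E h : dominated (lcs_set (hlim c (Bstep M w)) `&` lcs_set (Bstep M w h)) (lcs_sn (Bstep M w h)) Q
  <-> exists2 C, 0 <= C & forall phi b, lcs_set (Bspace c M w) phi ->
    smooth phi -> ubd M h%:num (nweight w) b phi -> Q phi <= C * b.
  apply: iff_trans (Bstep_dominatedP Q _) _; first by move=> phi [].
  split=> [[C C0 H]|[C C0 H]]; exists C => // phi b.
    by move=> Bphi sphi bphi; apply: H => //; split => //; apply/BstepP; split => //; exists b.
  by move=> [Bphi /BstepP[sphi _]]; exact: H.
by case: c E sQ => E _ /=; [split=> -[h /E]; exists h|split=> H h; apply/E; exact: H].
Qed.

Lemma GS_decr M A : weight_seq A -> decreasing_steps (fun h => @Bstep R d M (exp_weight A h) h).
Proof.
move=> wA h k hk; apply: (Bstep_mono M hk) => x; rewrite /nweight !exp_weightE.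
exact: gsw_le.
Qed.

Lemma GSP c M A phi : weight_seq A -> lcs_set (GS d c M A) phi <->
  hall c (fun h => exists b, gsb M A h%:num b phi).
Proof.
move=> wA; rewrite /GS hlim_set; last exact: GS_decr.
by case: c => /=; [split=> H h; apply/BstepGS; exact: H|split=> -[h /BstepGS]; exists h].
Qed.

Lemma GS_dominatedP c M A Q : weight_seq A -> seminorm_on (lcs_set (GS d c M A)) Q ->
  lcs_dominated (GS d c M A) Q <->
  hex c (fun h => exists2 C, 0 <= C & forall phi b, lcs_set (GS d c M A) phi ->
    gsb M A h%:num b phi -> Q phi <= C * b).
Proof.
move=> wA sQ; apply: iff_trans (hlim_dominated (c := c) (@GS_decr M A wA) sQ) _.
have E h : dominated (lcs_set (GS d c M A) `&` lcs_set (Bstep M (exp_weight A h) h)) (lcs_sn (Bstep M (exp_weight A h) h)) Q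
  <-> exists2 C, 0 <= C & forall phi b, lcs_set (GS d c M A) phi ->
    gsb M A h%:num b phi -> Q phi <= C * b.
  have Ew : nweight (@exp_weight R d A h) = gsw A h%:num by apply/funext => x; exact: exp_weightE.
  apply: iff_trans (Bstep_dominatedP Q _) _; first by move=> phi [].
  rewrite Ew; split=> -[C C0 H]; (exists C; first exact: C0) => phi b.
    move=> Bphi bphi; apply: H (proj2 bphi); split; first exact: Bphi.
    by apply/BstepGS; exists b; exact: bphi.
  move=> [Bphi /BstepGS[b' [sphi _]]] bphi; apply: H; first exact: Bphi.
  by split; [exact: sphi|exact: bphi].
by case: c E sQ => E _ /=; [split=> -[h /E]; exists h|split=> H h; apply/E; exact: H].
Qed.

Lemma incr_weight_le W N K x : incr_weight_system W -> (N <= K)%N ->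
  nweight (W N) x <= nweight (W K) x.
Proof.
move=> [_ WS] /subnK <-; elim: (K - N)%N => [|n IH] //.
by apply: le_trans IH _; exact: WS.
Qed.

Definition Bincr_step M W h : lcs := projlim (fun N => Bstep M (W N) h).

Lemma Bincr_stepP M W h phi : lcs_set (Bincr_step M W h) phi <->
  smooth phi /\ forall N, exists b, ubd M h%:num (nweight (W N)) b phi.
Proof.
split=> [H|[sphi H] N _]; last by apply/BstepP.
split=> [|N]; first by have /BstepP[] := H 0%N Logic.I.
by have /BstepP[] := H N Logic.I.
Qed.

Lemma Bincr_decr M W : decreasing_steps (Bincr_step M W).
Proof.
move=> h k hk; split=> [phi H N _|q [N _ qN]].
  by have [sub _] := Bstep_mono M hk (fun x => lexx (nweight (W N) x)); apply: sub; exact: H.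
have [_ /(_ q qN)] := Bstep_mono M hk (fun x => lexx (nweight (W N) x)).
exact: (@dominated_projlim R _ _ (fun N => Bstep M (W N) k) N).
Qed.

Lemma BincrP c M W phi : lcs_set (Bincr c M W) phi <->
  hall c (fun h => smooth phi /\ forall N, exists b, ubd M h%:num (nweight (W N)) b phi).
Proof.
rewrite /Bincr hlim_set; last exact: Bincr_decr.
by case: c => /=; [split=> H h; apply/Bincr_stepP; exact: H|split=> -[h /Bincr_stepP]; exists h].
Qed.

Lemma Bincr_dominatedP c M W Q : incr_weight_system W -> seminorm_on (lcs_set (Bincr c M W)) Q ->
  lcs_dominated (Bincr c M W) Q <->
  hex c (fun h => exists N, exists2 C, 0 <= C & forall phi b, lcs_set (Bincr c M W) phi ->
    lcs_set (Bincr_step M W h) phi -> ubd M h%:num (nweight (W N)) b phi -> Q phi <= C * b).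
Proof.
move=> iW sQ; apply: iff_trans (hlim_dominated (@Bincr_decr M W) sQ) _.
have E h : dominated (lcs_set (hlim c (Bincr_step M W)) `&` lcs_set (Bincr_step M W h)) (lcs_sn (Bincr_step M W h)) Q
  <-> exists N, exists2 C, 0 <= C & forall phi b, lcs_set (Bincr c M W) phi ->
    lcs_set (Bincr_step M W h) phi -> ubd M h%:num (nweight (W N)) b phi -> Q phi <= C * b.
  set X := _ `&` _.
  have sub N : X `<=` lcs_set (Bstep M (W N) h) by move=> phi [_ H]; exact: H.
  have E N := Bstep_dominatedP Q (sub N).
  split=> [H|[N [C C0 H]]]; last first.
    have : dominated X (lcs_sn (Bstep M (W N) h)) Q.
      by apply/E; exists C => // phi b [] Bphi Bhphi; exact: H.
    by apply: dominatedS => // q; exists N.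
  have h1 N phi q : lcs_sn (Bstep M (W N) h) q -> X phi -> 0 <= q phi.
    by move=> qE /(sub N); exact: lcs_sn_nneg.
  have h2 N N' : exists K, forall q, lcs_sn (Bstep M (W N) h) q \/ lcs_sn (Bstep M (W N') h) q ->
      dominated X (lcs_sn (Bstep M (W K) h)) q.
    have mono N0 : (N0 <= maxn N N')%N -> forall q, lcs_sn (Bstep M (W N0) h) q ->
        dominated X (lcs_sn (Bstep M (W (maxn N N')) h)) q.
      move=> N0le q qE; have [_ /(_ q qE)] := Bstep_mono M (lexx h%:num) (fun x => incr_weight_le x iW N0le).
      by apply: dominatedS => //; exact: sub.
    by exists (maxn N N') => q [] /mono; apply; rewrite ?leq_maxl ?leq_maxr.
  have [N /E[C C0 HN]] := dominated_dir 0%N h1 h2 H.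
  by exists N, C => // phi b Bphi Bhphi; exact: HN.
by case: c E sQ => E _ /=; [split=> -[h /E]; exists h|split=> H h; apply/E; exact: H].
Qed.

(** The loss of a fixed factor in the parameter is harmless in either limit. *)
Lemma hall_map c (P P' : {posnum R} -> Prop) (rho : {posnum R}) :
  (forall h, P (pscale rho h) -> P' h) -> hall c P -> hall c P'.
Proof.
case: c => PP /=; first by move=> H h; exact/PP/H.
by move=> [h Ph]; exists (pscale (posinv rho) h); apply: PP; rewrite pscaleK.
Qed.

Lemma hex_map c (P P' : {posnum R} -> Prop) (rho : {posnum R}) :
  (forall h, P h -> P' (pscale rho h)) -> hex c P -> hex c P'.
Proof.
case: c => PP /=; first by move=> [h /PP Ph]; exists (pscale rho h).
by move=> H h; rewrite -(pscaleK rho h); exact/PP/H.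
Qed.

(** An element of the space and a continuous seminorm always meet at some parameter; [rho] gives the
    element room for estimates that lose a factor. *)
Lemma hall_hex c (P P' : {posnum R} -> Prop) (rho : {posnum R}) :
  hall c P -> hex c P' -> exists h, P (pscale rho h) /\ P' h.
Proof.
case: c => /=; first by move=> HP [h Ph]; exists h.
by move=> [h Ph] HP'; exists (pscale (posinv rho) h); rewrite pscaleK.
Qed.

(** (M.2) splits [M (m + n)] into [M m] and [M n]. The power [H ^+ m] goes into the parameter; what
    remains depends only on the fixed word [s]. *)
Lemma ubd_pderivs M k (w : V -> R) b (C H : R) s phi : 0 <= C -> 1 <= H ->
  (forall p q, (M (p + q)%N)%:num <= C * H ^+ (p + q) * (M p)%:num * (M q)%:num) ->
  (forall x, 0 <= w x) -> ubd M k%:num w b phi ->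
  ubd M (k%:num / H) w (C * b * (H / k%:num) ^+ size s * (M (size s))%:num) (pderivs s phi).
Proof.
move=> C0 H1 MH w0 bphi u x.
have b0 : 0 <= b by apply: ubd_ge0 bphi; exists 0.
have H0 : 0 < H by exact: lt_le_trans H1.
rewrite /pderivs -foldr_cat -/(pderivs _ _).
have := bphi (u ++ s) x; rewrite size_cat.
set m := size u; set n := size s; set D := Normc.normc _ * _ => Dle.
have {}Dle : D * k%:num ^+ (m + n) <= b * (C * H ^+ (m + n) * (M m)%:num * (M n)%:num).
  by apply: le_trans Dle _; rewrite ler_wpM2l.
move: Dle; rewrite /D; move: (_ * w x) => D' Dle.
have [Hm kn] : H ^+ m != 0 /\ k%:num ^+ n != 0 by rewrite !gt_eqF// exprn_gt0.
have -> : D' * (k%:num / H) ^+ m = D' * k%:num ^+ (m + n) / (H ^+ m * k%:num ^+ n).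
  by rewrite expr_div_n exprD; field; rewrite Hm kn.
have -> : C * b * (H / k%:num) ^+ n * (M n)%:num * (M m)%:num =
    b * (C * H ^+ (m + n) * (M m)%:num * (M n)%:num) / (H ^+ m * k%:num ^+ n).
  by rewrite expr_div_n exprD; field; rewrite Hm kn.
by rewrite ler_wpM2r// invr_ge0 mulr_ge0// exprn_ge0// ltW.
Qed.

Lemma gsb_refl M A (h k b : R) x phi : weight_seq A -> 0 < h -> 2 * h <= k ->
  gsb M A k b phi -> gsb M A h (gsw A k x * b) (refl_trans x phi).
Proof.
move=> wA h0 hk [sphi bphi]; have k0 : 0 <= k by lra.
split; first exact: smooth_refl.
have : ubd M k (gsw A h) (gsw A k x * b) (refl_trans x phi).
  apply: ubd_refl bphi => //; first exact: gsw_ge0.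
  by move=> y; apply: gsw_refl => //; exact: ltW.
apply: ubd_le => //; first by rewrite ltW//=; lra.
by move=> y; rewrite gsw_ge0 lexx.
Qed.

Lemma GS_refl c M A x phi : weight_seq A -> lcs_set (GS d c M A) phi ->
  lcs_set (GS d c M A) (refl_trans x phi).
Proof.
move=> wA /(GSP _ _ _ wA) H; apply/(GSP _ _ _ wA).
apply: hall_map (2%:pos) _ H => h [b bphi]; exists (gsw A (2 * h%:num) x * b).
exact: gsb_refl bphi.
Qed.

Lemma GS_pderivs c M A s phi : weight_seq A -> M2 M -> lcs_set (GS d c M A) phi ->
  lcs_set (GS d c M A) (pderivs s phi).
Proof.
move=> wA [C [H [C1 H1 CH]]] /(GSP _ _ _ wA) P; apply/(GSP _ _ _ wA).
have H0 : 0 < H by exact: lt_le_trans H1.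
apply: hall_map (PosNum H0) _ P => h [b [sphi bphi]].
have := ubd_pderivs s (le_trans ler01 C1) H1 CH (fun x => gsw_ge0 A _ x) bphi.
set B := (X in ubd _ _ _ X); move=> bd; exists B; split; first exact: smooth_pderivs.
apply: ubd_le bd => //.
  by rewrite /= mulrAC divff ?gt_eqF// mul1r lexx andbT.
move=> x; rewrite gsw_ge0/=; apply: gsw_le => //=.
by rewrite ler_peMl.
Qed.

End Spaces.

(** * Differentiability of reflected translates *)

Section Convolution.
Context {R : realType} {d : nat}.
Local Notation V := 'rV[R]_d.
Local Notation F := (V -> R[i]^o).
Local Notation "''e_' i" := (delta_mx ord0 i : V) (at level 8, i at level 2).

Lemma enorm_le (x : V) : enorm x <= d%:R * `|x|.
Proof.
rewrite -(ler_pXn2r (_ : 0 < 2)%N) ?nnegrE ?enorm_ge0 ?mulr_ge0//.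
rewrite /enorm sqr_sqrtr ?sumr_ge0// => [|i _]; last exact: sqr_ge0.
apply: (@le_trans _ _ (\sum_(i < d) `|x| ^+ 2)).
  by apply: ler_sum => i _; rewrite -real_normK ?num_real// lerXn2r ?nnegrE// norm_coord.
rewrite sumr_const card_ord exprMn -[leLHS]mulr_natl ler_wpM2r ?exprn_ge0//.
by rewrite -natrX ler_nat; case: (d) => // n; rewrite leq_pmull.
Qed.

Lemma norm_delta (s : R) (i : 'I_d) : `|(s *: 'e_i : V)| <= `|s|.
Proof.
apply: norm_le_coord => // j; rewrite !mxE eqxx/=.
by case: eqP => _; rewrite ?mulr1// mulr0 normr0.
Qed.

Lemma gsw_near A (k : R) (x : V) : weight_seq A -> 0 <= k ->
  exists2 G, 0 <= G & forall z, `|z - x| <= 1 -> gsw A k z <= G.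
Proof.
move=> wA k0; have k20 : 0 <= 2 * k by rewrite mulr_ge0.
exists (gsw A (2 * k) x * eassoc A (2 * k * d%:R)).
  by apply: mulr_ge0; [exact: gsw_ge0|exact/ltW/eassoc_gt0].
move=> z zx; apply: le_trans (gsw_refl wA x z k0 (lexx _)) _.
apply: ler_wpM2l; first exact: gsw_ge0.
apply: eassoc_le => //; first by rewrite mulr_ge0 ?enorm_ge0.
apply: ler_wpM2l => //; apply: le_trans (enorm_le _) _.
by rewrite -[leRHS]mulr1 ler_wpM2l// distrC.
Qed.

Lemma pderivs_cat s t (phi : F) : pderivs (s ++ t) phi = pderivs s (pderivs t phi).
Proof. by rewrite /pderivs foldr_cat. Qed.

Lemma pderivs_reflE s (x y : V) (phi : F) : smooth phi ->
  pderivs s (refl_trans x phi) y = (-1) ^+ size s * pderivs s phi (x - y).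
Proof. by move=> sphi; rewrite pderivs_refl. Qed.

(** Second derivatives of [psi] control the Taylor remainder of [refl_trans x psi] in the variable
    [x], in a Gelfand-Shilov norm. Being quadratic in [t], it stays negligible after a continuous
    functional is applied. *)
Lemma refl_taylor M A (h b G t : R) (x : V) i (psi : F) : weight_seq A -> 0 < h -> 0 <= b ->
  0 <= G -> smooth psi -> `|t| <= 1 -> (forall z, `|z - x| <= 1 -> gsw A (2 * h) z <= G) ->
  ubd M (2 * h) (gsw A (2 * h)) b (pderivs [:: i; i] psi) ->
  gsb M A h (2 * t ^+ 2 * b * G) ((- t%:C%C) *: refl_trans x (pderivs [:: i] psi) +
    ((-1) *: refl_trans x psi + refl_trans (x + t *: 'e_i) psi)).
Proof.
move=> wA h0 b0 G0 spsi t1 HG bd.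
have sr y s : smooth (refl_trans y (pderivs s psi)) by apply: smooth_refl; exact: smooth_pderivs.
split.
  by apply: smoothP; [exact: sr|apply: smoothP; [exact: (sr x [::])|exact: (sr _ [::])]].
move=> s y; rewrite pderivs_lin; [|exact: sr|apply: smoothP; [exact: (sr x [::])|exact: (sr _ [::])]].
rewrite pderivs_lin; [|exact: (sr x [::])|exact: (sr _ [::])].
set n := size s; rewrite (_ : (_ + _) y = (-1) ^+ n * (pderivs s psi (x - y + t *: 'e_i) -
    pderivs s psi (x - y) - t%:C%C * pderivs (i :: s) psi (x - y))); last first.
  transitivity (- t%:C%C * pderivs s (refl_trans x (pderivs [:: i] psi)) y +
    (-1 * pderivs s (refl_trans x psi) y + pderivs s (refl_trans (x + t *: 'e_i) psi) y)) => //.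
  rewrite !pderivs_reflE//; last exact: smooth_pderivs.
  have -> : pderivs s (pderivs [:: i] psi) = pderivs (i :: s) psi.
    by rewrite -pderivs_cat; apply: pderivs_perm; rewrite // perm_catC.
  rewrite (addrAC x) -/n; move: (pderivs s psi _) (pderivs s psi _) (pderivs (i :: s) psi _) => X Y Z.
  by ring.
rewrite normc_signM.
have gy : 0 < gsw A h y by exact: gsw_gt0.
have ghn : 0 < gsw A h y * h ^+ n by rewrite mulr_gt0 ?exprn_gt0.
(* Chosen so that [2 * K * |t| ^+ 2], times the weight and [h ^+ n], is the claimed bound. *)
pose K := b * (M n)%:num * G / (gsw A h y * h ^+ n).
have := ispd_MVT2 (x := x - y) (t := t) (K := K) (ispd_pderivs s i spsi) (ispd_pderivs (i :: s) i spsi).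
set X := Normc.normc _; move=> XK.
rewrite -mulrA -ler_pdivlMr//; apply: le_trans (XK _) _; last first.
  rewrite real_normK ?num_real// /K le_eqVlt; apply/orP; left; apply/eqP.
  by field; rewrite !gt_eqF// exprn_gt0.
move=> r rt; rewrite /K ler_pdivlMr//.
have -> : pderivs [:: i, i & s] psi = pderivs s (pderivs [:: i; i] psi).
  by rewrite -pderivs_cat; apply: pderivs_perm; rewrite // -[_ :: _ :: s]/([:: i; i] ++ s) perm_catC.
set z := x - y + r *: 'e_i.
have zE : z = (x + r *: 'e_i) - y by rewrite /z addrAC.
(* [G] controls the weight at every centre within distance 1 of [x], hence uniformly along the
   segment. *)
have gz : gsw A h y <= G * gsw A (2 * h) z.
  rewrite zE; apply: le_trans (gsw_refl wA (x + r *: 'e_i) y (ltW h0) (lexx _)) _.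
  apply: ler_wpM2r; first exact: gsw_ge0.
  by apply: HG; rewrite addrAC subrr add0r; apply: le_trans (norm_delta _ _) (le_trans rt t1).
have := bd s z; rewrite -/n.
move: (Normc.normc _) (normc_ge0 (pderivs s (pderivs [:: i; i] psi) z)) gz gy => D D0.
move: (gsw A h y) (gsw A (2 * h) z) => g g2 gz gy HD.
have hn0 : 0 <= h ^+ n by rewrite exprn_ge0// ltW.
apply: (@le_trans _ _ (D * (G * g2 * (2 * h) ^+ n))).
  apply: ler_wpM2l => //; apply: ler_pM => //; first exact: ltW.
  by rewrite lerXn2r ?nnegrE ?mulr_ge0 ?(ltW h0)// ler_peMl ?(ltW h0)// ler1n.
have -> : D * (G * g2 * (2 * h) ^+ n) = G * (D * g2 * (2 * h) ^+ n) by ring.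
by rewrite mulrC; apply: ler_wpM2r.
Qed.

End Convolution.

(** * Convolution with elements of the dual *)

(* The weight index [K] is uniform in the Beurling case and depends on [k] in the Roumieu case. *)
Definition uniform_map (R : realType) (d : nat) (c : ultra_case) (M A : nat -> {posnum R})
    (W : nat -> 'rV[R]_d -> {posnum R}) (H : R) (S : set ('rV[R]_d -> R[i]^o))
    (T : ('rV[R]_d -> R[i]^o) -> 'rV[R]_d -> R[i]^o) :=
  let est (k : {posnum R}) K := exists2 D, 0 <= D & forall phi b, S phi ->
    gsb M A k%:num b phi ->
    ubd M (k%:num / H) (nweight (dual_weights W K)) (D * b) (T phi) in
  if c is Beurling
  then exists K (k0 : R), forall k : {posnum R}, k0 <= k%:num -> est k K
  else forall k, exists K, est k K.

Section Dual.
Context {R : realType} {d : nat} {c : ultra_case} {M A : nat -> {posnum R}}.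
Hypotheses (wA : weight_seq A) (M2_M : M2 M).
Variable f : {linear GS d c M A -> R[i]^o}.
Hypothesis f_cont : continuous f.
Local Notation V := 'rV[R]_d.
Local Notation F := (V -> R[i]^o).
Local Notation S := (lcs_set (GS d c M A)).
Local Notation "''e_' i" := (delta_mx ord0 i : V) (at level 8, i at level 2).

(** Lets [f] act on plain functions; an argument outside the space is replaced by 0. *)
Definition fval (psi : F) : R[i] := f (insubd 0 psi).
Definition fconv (psi : F) : F := fun x => fval (refl_trans x psi).

Lemma fconvE (phi : GS d c M A) : convolution f phi = fconv (val phi).
Proof. by []. Qed.

Lemma fval_lin a psi chi : S psi -> S chi -> fval (a *: psi + chi) = a * fval psi + fval chi.
Proof. by move=> Sp Sc; rewrite /fval insubd_lin// linearP. Qed.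

Lemma fval_hex : hex c (fun h => exists2 C, 0 <= C & forall psi b, S psi ->
  gsb M A h%:num b psi -> Normc.normc (fval psi) <= C * b).
Proof. by apply/(GS_dominatedP wA); [exact: linear_seminorm|exact: linear_dominated]. Qed.

Lemma refl_lin x a (psi chi : F) :
  refl_trans x (a *: psi + chi) = a *: refl_trans x psi + refl_trans x chi.
Proof. by []. Qed.

Lemma fconv_lin a psi chi : S psi -> S chi ->
  fconv (a *: psi + chi) = a *: fconv psi + fconv chi.
Proof.
move=> Sp Sc; apply/funext => x; rewrite /fconv refl_lin fval_lin//; exact: GS_refl.
Qed.

Lemma GS_smooth psi : S psi -> smooth psi.
Proof.
move=> /(GSP _ _ _ wA); case: (c) => /=.
  by move=> /(_ 1%:pos)[b []].
by move=> [h [b []]].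
Qed.

Lemma fconv_locally_bounded psi x : S psi ->
  exists K, forall z, `|z - x| <= 1 -> Normc.normc (fconv psi z) <= K.
Proof.
move=> Sp; have := proj1 (GSP _ _ _ wA) Sp.
move=> /(hall_hex 2%:pos)/(_ fval_hex)[h [[b bp] [C C0 H]]].
have h2 : 0 <= (pscale 2%:pos h)%:num by [].
have [G G0 HG] := gsw_near x wA h2.
have b0 : 0 <= b by apply: ubd_ge0 (proj2 bp); exists 0; exact: gsw_ge0.
exists (C * (G * b)) => z /HG gz.
apply: le_trans (H _ _ (GS_refl z wA Sp) (gsb_refl z wA _ (lexx _) bp)) _ => //.
by apply: ler_wpM2l => //; apply: ler_wpM2r.
Qed.

(** The error in the difference quotient is [f] of the remainder in [refl_taylor], so it is
    quadratic in the increment. *)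
Lemma fconv_ispd i psi : S psi -> ispd i (fconv psi) (fconv (pderivs [:: i] psi)).
Proof.
move=> Sp; apply/ispdP => x eps eps0.
have Sp1 := GS_pderivs [:: i] wA M2_M Sp; have Sp2 := GS_pderivs [:: i; i] wA M2_M Sp.
have := proj1 (GSP _ _ _ wA) Sp2.
move=> /(hall_hex 2%:pos)/(_ fval_hex)[h [[b bp] [C C0 H]]].
have h2 : 0 <= (pscale 2%:pos h)%:num by [].
have [G G0 HG] := gsw_near x wA h2.
have b0 : 0 <= b by apply: ubd_ge0 (proj2 bp); exists 0; exact: gsw_ge0.
(* For [|t| <= eps / L] the quadratic error is at most [eps * |t|]; the 1 keeps [L] positive. *)
pose L := C * (2 * b * G) + 1.
have L1 : 0 <= C * (2 * b * G) by rewrite !mulr_ge0.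
have L0 : 0 < L by rewrite ltr_wpDl.
exists (Num.min 1 (eps / L)); first by rewrite lt_min ltr01 divr_gt0.
move=> t; rewrite lt_min => /andP[/ltW t1 tL].
have h0 : 0 < h%:num by [].
have := refl_taylor (t := t) (G := G) wA h0 b0 G0 (GS_smooth Sp) t1 HG (proj2 bp).
set D := _ *: _ + _ => HD.
have SD : S D.
  by do 2! (apply: lcs_setP; first exact: GS_refl); exact: GS_refl.
have -> : fconv psi (x + t *: 'e_i) - fconv psi x - t%:C%C * fconv (pderivs [:: i] psi) x = fval D.
  rewrite /D fval_lin; [|exact: GS_refl|apply: lcs_setP; exact: GS_refl].
  rewrite fval_lin; [|exact: GS_refl|exact: GS_refl].
  by rewrite /fconv; move: (fval _) (fval _) (fval _) => X Y Z; ring.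
apply: le_trans (H _ _ SD HD) _.
rewrite -(real_normK (num_real t)).
have {}tL : `|t| * L <= eps by rewrite -ler_pdivlMr// ltW.
have -> : C * (2 * `|t| ^+ 2 * b * G) = `|t| * (C * (2 * b * G)) * `|t| by ring.
apply: ler_wpM2r => //; apply: le_trans tL; apply: ler_wpM2l => //.
by rewrite /L lerDl.
Qed.

Lemma fconv_smooth psi : S psi -> smooth (fconv psi) /\
  forall s, pderivs s (fconv psi) = fconv (pderivs s psi).
Proof.
move=> Sp; have SD s := GS_pderivs s wA M2_M Sp.
have dP s i : ispd i (fconv (pderivs s psi)) (fconv (pderivs (i :: s) psi)).
  exact: fconv_ispd (SD s).
apply: (@smooth_family R d (fun s => fconv (pderivs s psi))) => // s.
apply: (@ispd_continuous R d _ (fun i => fconv (pderivs (i :: s) psi))) => // x.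
have /choice[K KP] : forall i, exists K, forall z, `|z - x| <= 1 ->
    Normc.normc (fconv (pderivs (i :: s) psi) z) <= K.
  by move=> i; apply: fconv_locally_bounded; exact: SD.
exists 1, (\sum_i `|K i|); split => // i z /(KP i) Hz.
apply: le_trans Hz _; rewrite (bigD1 i)//=; apply: le_trans (ler_norm _) _.
by rewrite lerDl sumr_ge0.
Qed.

Section Estimate.
Variable W : nat -> V -> {posnum R}.

(** Admissibility with shift [y - x] trades [W N y] for [W K x] times an exponential weight in
    [x - y]. As [lambda <= k], the decay of [phi] absorbs that weight, and [ubd_pderivs] absorbs the
    derivative. *)
Lemma fconv_estimate (h k : {posnum R}) N K (C Ca C0 H lambda b : R) phi :
  0 <= C -> 0 < Ca -> 0 <= C0 -> 1 <= H ->
  (forall p q, (M (p + q)%N)%:num <= C0 * H ^+ (p + q) * (M p)%:num * (M q)%:num) ->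
  (forall x t : V, (W N (x + t))%:num <=
    Ca * (W K x)%:num * expR (assoc_fun A (enorm (lambda *: t)))) ->
  0 < lambda -> lambda <= k%:num -> h%:num * H <= k%:num ->
  (forall psi b, S psi -> lcs_set (Bincr_step M W h) psi ->
     ubd M h%:num (nweight (W N)) b psi -> Normc.normc (fval psi) <= C * b) ->
  (forall s x, lcs_set (Bincr_step M W h) (refl_trans x (pderivs s phi))) ->
  S phi -> gsb M A k%:num b phi ->
  ubd M (k%:num / H) (nweight (dual_weights W K)) (C * Ca * C0 * b) (fconv phi).
Proof.
move=> C_0 Ca0 C00 H1 MH adm la0 lak hk fW stepW Sp [sphi bphi] s x.
have H0 : 0 < H by exact: lt_le_trans H1.
have bd := ubd_pderivs s C00 H1 MH (fun x => gsw_ge0 A _ x) bphi.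
have [_ ->] := fconv_smooth Sp; set n := size s in bd *.
have wk : 0 <= Ca * (W K x)%:num by rewrite mulr_ge0// ltW.
have kH : 0 <= k%:num / H by rewrite divr_ge0// ltW.
have refl : ubd M h%:num (nweight (W N))
    (Ca * (W K x)%:num * (C0 * b * (H / k%:num) ^+ n * (M n)%:num)) (refl_trans x (pderivs s phi)).
  apply: (@ubd_le _ _ M (k%:num / H) h%:num (nweight (W N)) (nweight (W N)) _ _ _ _ _ (lexx _)).
  - by rewrite ler_pdivlMr // hk andbT.
  - by move=> y; rewrite lexx /nweight andbT.
  apply: (ubd_refl kH wk (smooth_pderivs s sphi) _ bd).
  move=> y; have := adm x (y - x); rewrite addrC subrK => adm'.
  apply: le_trans adm' _; apply: ler_wpM2l => //.
  rewrite (enormZ _ (ltW la0)) -(enormN (y - x)) opprB.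
  exact: (gsw_le wA (x - y) (ltW la0) lak).
have Sr : S (refl_trans x (pderivs s phi)) by apply: GS_refl => //; exact: GS_pderivs.
have := fW _ _ Sr (stepW s x) refl.
rewrite /fconv; move: (Normc.normc _) => D HD.
have Wi : 0 <= (nweight (dual_weights W K) x) * (k%:num / H) ^+ n by apply: mulr_ge0; [rewrite /nweight|exact: exprn_ge0].
rewrite -mulrA; apply: le_trans (ler_wpM2r Wi HD) _.
have Hn : H ^+ n != 0 by rewrite gt_eqF// exprn_gt0.
have kn : k%:num ^+ n != 0 by rewrite gt_eqF// exprn_gt0.
have Wn : (W K x)%:num != 0 by rewrite gt_eqF.
rewrite /nweight /= !expr_div_n le_eqVlt; apply/orP; left; apply/eqP.
by field; rewrite Hn kn Wn.
Qed.

(** Admissibility at the origin bounds [W N] by a multiple of an exponential weight. *)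
Lemma gsb_weight (k : {posnum R}) N K (lambda b : R) psi :
  0 < lambda -> lambda <= k%:num -> admissible_bound A W N K lambda ->
  gsb M A k%:num b psi -> exists b', ubd M k%:num (nweight (W N)) b' psi.
Proof.
move=> la0 lak [Ca Ca0 adm] [spsi bpsi].
have b0 : 0 <= b by apply: ubd_ge0 bpsi; exists 0; exact: gsw_ge0.
exists (Ca * (W K 0)%:num * b) => s x.
rewrite -[leRHS]mulrA; apply: le_trans (ler_wpM2l _ (bpsi s x)); last first.
  by rewrite mulr_ge0// ltW.
rewrite !mulrA; apply: ler_wpM2r; first by rewrite exprn_ge0.
rewrite -mulrA (mulrC (Ca * _)) -mulrA; apply: ler_wpM2l; first exact: normc_ge0.
have := adm 0 x; rewrite add0r /nweight => adm'; apply: le_trans adm' _.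
rewrite (mulrC (gsw _ _ _)); apply: ler_wpM2l; first by rewrite mulr_ge0// ltW.
rewrite (enormZ _ (ltW la0)); exact: (gsw_le wA x (ltW la0) lak).
Qed.

End Estimate.
End Dual.

(** * Inclusion of the smooth weighted spaces in the continuous ones *)

Section Inclusion.
Context {R : realType} {d : nat}.
Local Notation V := 'rV[R]_d.
Local Notation F := (V -> R[i]^o).
Local Notation lcs := (@lcspace R F).
Implicit Types (c : ultra_case) (M : nat -> {posnum R}) (W : nat -> V -> {posnum R}).

Lemma Bspace_Cstep c M w : lcs_set (Bspace c M w) `<=` lcs_set (@Cstep R d w) /\
  forall q, lcs_sn (@Cstep R d w) q -> lcs_dominated (Bspace c M w) q.
Proof.
have sub : lcs_set (Bspace c M w) `<=` lcs_set (@Cstep R d w).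
  move=> phi /BspaceP H.
  have [sphi [b [h bphi]]] : smooth phi /\ exists b (h : {posnum R}), ubd M h%:num (nweight w) b phi.
    case: (c) H => /=; first by move=> /(_ 1%:pos)[? [b ?]]; split => //; exists b, 1%:pos.
    by move=> [h [? [b ?]]]; split => //; exists b, h.
  split; first exact: (sphi [::]).1.
  exists (b * (M 0)%:num) => _ [x _ <-]; have := bphi [::] x.
  by rewrite expr0 mulr1.
split => // q ->; have sq := lcs_snP (erefl (sup_norm (weighted_abs w)) : lcs_sn (Cstep w) _).
apply: (proj2 (Bspace_dominatedP (seminorm_onS sub sq))).
have H (h : {posnum R}) : exists2 C, 0 <= C & forall phi b, lcs_set (Bspace c M w) phi ->
    smooth phi -> ubd M h%:num (nweight w) b phi -> sup_norm (weighted_abs w) phi <= C * b.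
  exists (M 0)%:num => // phi b _ sphi bphi; apply: ge_sup; first by eexists; exists 0.
  by move=> _ [x _ <-]; have := bphi [::] x; rewrite expr0 mulr1 (mulrC b).
by case: (c) H => H /=; [exists 1%:pos; exact: H|move=> h; exact: H].
Qed.

Lemma Bdecr_Cdecr c M W : lcs_set (Bdecr c M W) `<=` lcs_set (Cdecr W).
Proof.
apply: indlim_sub => n phi Bphi; apply: (@indlim_step _ _ _ (fun n => Cstep (W n)) n).
exact: (proj1 (Bspace_Cstep c M (W n))).
Qed.

Lemma Bdecr_Cdecr_continuous c M W : exists2 J : Bdecr c M W -> Cdecr W,
  (forall phi, val (J phi) = val phi) & continuous J.
Proof.
exists (fun phi => lcs_mk (Bdecr_Cdecr (lcs_eltP phi))) => //.
apply: lcs_map_continuous => [x y|q qC]; first by apply: val_inj.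
have [qZ qD] := lcs_snP qC.
have E : {in lcs_set (Bdecr c M W), forall x, q (val (insubd (0 : Bdecr c M W) x)) = q x}.
  by move=> x /set_mem Bx; rewrite lcs_insubdK.
apply: (@dominated_le _ _ _ _ q _ 1) => // [x Bx|].
  by rewrite mul1r /= (E x)//; exact: mem_set.
apply: dominated_indlim; first exact: seminorm_onS (@Bdecr_Cdecr c M W) (lcs_snP qC).
move=> n; have dq := indlim_snE n qC.
apply: dominated_trans dq; last exact: (proj2 (Bspace_Cstep c M (W n))).
- exact: (proj1 (Bspace_Cstep c M (W n))).
- by move=> p x; exact: lcs_sn_nneg.
Qed.

End Inclusion.

(** * Membership and continuity from uniform estimates *)

Section Uniform.
Context {R : realType} {d : nat} {c : ultra_case} {M A : nat -> {posnum R}}.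
Context {W : nat -> 'rV[R]_d -> {posnum R}} {H : R} (H1 : 1 <= H).
Local Notation V := 'rV[R]_d.
Local Notation F := (V -> R[i]^o).
Context {S : set F} {T : F -> F} (unif : uniform_map c M A W H S T).

Let H0 : 0 < H. Proof. exact: lt_le_trans H1. Qed.

Lemma ubd_dual_le n (h : {posnum R}) (k b : R) phi : h%:num * H <= k ->
  ubd M (k / H) (nweight (dual_weights W n)) b phi ->
  ubd M h%:num (nweight (dual_weights W n)) b phi.
Proof.
move=> hk; apply: ubd_le (lexx b) => [|x]; last by rewrite lexx andbT /nweight.
by rewrite ler_pdivlMr// hk andbT.
Qed.

Lemma exists_index (h : {posnum R}) (k0 : R) : exists2 k : {posnum R}, k0 <= k%:num & h%:num * H <= k%:num.
Proof.
have hH : 0 <= h%:num * H by rewrite mulr_ge0// ltW.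
have k_gt0 : 0 < h%:num * H + `|k0| by rewrite ltr_pwDl// mulr_gt0.
exists (PosNum k_gt0); rewrite /=; last by rewrite lerDl.
by apply: le_trans (ler_norm _) _; rewrite lerDr.
Qed.

Lemma uniform_Bspace phi : S phi -> hall c (fun h => exists b, gsb M A h%:num b phi) ->
  smooth (T phi) -> exists n, lcs_set (Bspace c M (dual_weights W n)) (T phi).
Proof.
move=> Sp; move: unif; rewrite /uniform_map; case: (c) => U HG sT.
  have [K [k0 HU]] := U; exists K; apply/BspaceP => h; split => //.
  have [k /HU[D D0 HD] hk] := exists_index h k0.
  have [b bp] := HG k; exists (D * b); exact: ubd_dual_le hk (HD _ _ Sp bp).
have [h [b bp]] := HG; have [K [D D0 HD]] := U h; exists K.
have hH : 0 < h%:num / H by rewrite divr_gt0.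
by apply/BspaceP; exists (PosNum hH); split => //; exists (D * b); exact: HD.
Qed.

(** In the Beurling case one [K] serves all test functions, so the seminorm is examined on a single
    step of the target. In the Roumieu case each step of the source is tested separately and may
    have its own [K]. *)
Lemma uniform_hex (Q : F -> R) :
  (forall phi, S phi -> hall c (fun h => exists b, gsb M A h%:num b phi)) ->
  (forall phi, S phi -> smooth (T phi)) ->
  (forall n, hex c (fun h => exists2 C, 0 <= C & forall phi b,
     lcs_set (Bspace c M (dual_weights W n)) phi -> smooth phi ->
     ubd M h%:num (nweight (dual_weights W n)) b phi -> Q phi <= C * b)) ->
  hex c (fun h => exists2 C, 0 <= C & forall phi b, S phi ->
    gsb M A h%:num b phi -> Q (T phi) <= C * b).
Proof.
move: unif; rewrite /uniform_map; case: (c) => U SG sT dQ; hnf.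
  have [K [k0 HU]] := U; have [h [C C0 HC]] := dQ K.
  have [k k0k hk] := exists_index h k0; have [D D0 HD] := HU k k0k.
  exists k, (C * D); first exact: mulr_ge0.
  move=> phi b Sp bp; rewrite -mulrA; apply: HC; [|exact: sT|exact: ubd_dual_le hk (HD _ _ Sp bp)].
  apply/BspaceP => h'; split; first exact: sT.
  have [k' /HU[D' D'0 HD'] hk'] := exists_index h' k0.
  have [b' bp'] := SG _ Sp k'; exists (D' * b'); exact: ubd_dual_le hk' (HD' _ _ Sp bp').
move=> k; have [K [D D0 HD]] := U k.
have kH : 0 < k%:num / H by rewrite divr_gt0.
have [C C0 HC] := dQ K (PosNum kH).
exists (C * D); first exact: mulr_ge0.
move=> phi b Sp bp; rewrite -mulrA; apply: HC; [|exact: sT|exact: HD].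
by apply/BspaceP; exists (PosNum kH); split; [exact: sT|exists (D * b); exact: HD].
Qed.

End Uniform.

Lemma hex_imp (R : realType) c (P P' : {posnum R} -> Prop) :
  (forall h, P h -> P' h) -> hex c P -> hex c P'.
Proof. by case: c => PP' /=; [move=> [h /PP']; exists h|move=> H h; exact: PP']. Qed.

(** * Convolution with an element of the dual *)

Section FromDual.
Context {R : realType} {d : nat} {c : ultra_case} {M A : nat -> {posnum R}}.
Hypotheses (wA : weight_seq A) (M2_M : M2 M).
Variable f : {linear GS d c M A -> R[i]^o}.
Hypothesis f_cont : continuous f.
Variable W : nat -> 'rV[R]_d -> {posnum R}.
Hypotheses (incrW : incr_weight_system W) (admW : admissible c A W).
Local Notation V := 'rV[R]_d.
Local Notation F := (V -> R[i]^o).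
Local Notation S := (lcs_set (GS d c M A)).

Lemma dual_fconv_uniform : in_dual f (Bincr c M W) ->
  exists2 H, 1 <= H & uniform_map c M A W H S (fconv f).
Proof.
move=> [g cg gf]; have [C0 [H [C01 H1 MH]]] := M2_M; exists H => //.
have C00 : 0 <= C0 by rewrite (le_trans _ C01).
have H0 : 0 < H by exact: lt_le_trans H1.
have fg psi : S psi -> lcs_set (Bincr c M W) psi /\ fval f psi = g (insubd 0 psi).
  move=> Sp; have [psi' vp fp] := gf (insubd 0 psi); rewrite lcs_insubdK// in vp.
  by split; [rewrite -vp; exact: lcs_eltP|rewrite /fval fp -vp lcs_insubd_val].
have {gf}SB psi : S psi -> lcs_set (Bincr c M W) psi by move=> /fg[].
have Hb : hex c (fun h : {posnum R} => exists N, exists2 C, 0 <= C & forall psi b, S psi ->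
     lcs_set (Bincr_step M W h) psi ->
     ubd M h%:num (nweight (W N)) b psi -> Normc.normc (fval f psi) <= C * b).
  apply: hex_imp (proj1 (Bincr_dominatedP incrW (linear_seminorm g)) (linear_dominated cg)).
  move=> h [N [C C_0 HC]]; exists N, C => // psi b Sp; have [Bp ->] := fg _ Sp; exact: HC.
rewrite /uniform_map; move: Hb SB f_cont {fg cg}; move: admW.
case: (c) (f) => f' adm' Hb SB cf.
  have [h [N [C C_0 HC]]] := Hb; have [lambda la0 [K _ [Ca Ca0 adm]]] := adm' N.
  (* A single pair [h], [N] controls [f] here, and any [k] above both thresholds meets the
     conditions of [fconv_estimate]. *)
  exists K, (Num.max lambda (h%:num * H)) => k; rewrite ge_max => /andP[lak hk].
  exists (C * Ca * C0); first by rewrite !mulr_ge0// ltW.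
  move=> phi b Sp bp.
  apply: (fconv_estimate wA M2_M cf C_0 Ca0 C00 H1 MH adm la0 lak hk HC _ Sp bp).
  move=> s x; have /BincrP/(_ h)[] := SB _ (GS_refl x wA (GS_pderivs s wA M2_M Sp)).
  by move=> ? ?; apply/Bincr_stepP.
(* Here [k] is given and [h = k / (2 H)] is chosen: the factor [H] pays for derivatives and 2 for
   the reflection. *)
move=> k; have r0 : 0 < 2 * H by rewrite mulr_gt0.
pose h := pscale (posinv (PosNum r0)) k.
have hE : h%:num = k%:num / H / 2 by rewrite /=; field; rewrite gt_eqF.
have k0 : 0 < k%:num by [].
have kH0 : 0 < k%:num / H by rewrite divr_gt0.
have hk : h%:num * H <= k%:num.
  by rewrite hE mulrAC divfK ?gt_eqF// ler_pdivrMr// ler_peMr// ler1n.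
have [N [C C_0 HC]] := Hb h.
have [K _ [Ca Ca0 adm]] := adm' N k%:num k0.
exists K, (C * Ca * C0); first by rewrite !mulr_ge0// ltW.
move=> phi b Sp bp.
apply: (fconv_estimate wA M2_M cf C_0 Ca0 C00 H1 MH adm k0 (lexx _) hk HC _ Sp bp).
move=> s x; apply/Bincr_stepP.
have [sphi bphi] := bp.
have bd := ubd_pderivs s C00 H1 MH (fun x => gsw_ge0 A _ x) bphi.
set B := (X in ubd _ _ _ X _) in bd.
have gd : gsb M A (k%:num / H) B (pderivs s phi).
  split; first exact: smooth_pderivs.
  apply: ubd_le bd => //; first by rewrite (ltW kH0) lexx.
  move=> y; rewrite gsw_ge0/=; apply: gsw_le => //; first exact: ltW.
  by rewrite ler_pdivrMr// ler_peMr// ltW.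
have hkH : 2 * h%:num <= k%:num / H by rewrite hE mulrC divfK.
have h0 : 0 < h%:num by [].
have gr := gsb_refl x wA h0 hkH gd.
split; first exact: proj1 gr.
move=> N'; have [K' _ adm''] := adm' N' h%:num h0.
exact: gsb_weight h0 (lexx _) adm'' gr.
Qed.

Lemma fconv_Bdecr H phi : 1 <= H -> uniform_map c M A W H S (fconv f) ->
  S phi -> lcs_set (Bdecr c M (dual_weights W)) (fconv f phi).
Proof.
move=> H1 unif Sp; have [sf _] := fconv_smooth wA M2_M f_cont Sp.
have [n Bn] := uniform_Bspace H1 unif Sp (proj1 (GSP _ _ _ wA) Sp) sf.
exact: (@indlim_step _ _ _ (fun n => Bspace c M (dual_weights W n)) n).
Qed.

Lemma fconv_Bdecr_continuous H : 1 <= H -> uniform_map c M A W H S (fconv f) ->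
  conv_continuous f (Bdecr c M (dual_weights W)).
Proof.
move=> H1 unif; have BS phi := @fconv_Bdecr H phi H1 unif.
exists (fun phi => lcs_mk (BS _ (lcs_eltP phi))) => //.
apply: lcs_map_continuous => [x y|q qB].
  apply: val_inj; change (fconv f (val x) - fconv f (val y) = fconv f (val (x - y))).
  have -> : val (x - y) = (-1) *: val y + val x by rewrite scaleN1r [RHS]addrC.
  by rewrite fconv_lin ?scaleN1r 1?addrC//; exact: lcs_eltP.
have [qZ qD] := lcs_snP qB.
have sq : seminorm_on S (fun x => q (fconv f x)).
  split=> [a x Sx|x y Sx Sy].
    have := fconv_lin wA f a Sx (lcs_set0 _); rewrite addr0 => ->.
    have -> : fconv f 0 = 0.
      have := fconv_lin wA f (-1) (lcs_set0 (GS d c M A)) (lcs_set0 _).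
      by rewrite scaler0 addr0 scaleN1r addNr.
    by rewrite addr0 qZ//; exact: BS.
  have := fconv_lin wA f 1 Sx Sy; rewrite !scale1r => ->.
  by apply: qD; exact: BS.
apply: (@dominated_le _ _ _ _ (fun x => q (fconv f x)) _ 1) => // [x Sx|].
  by rewrite mul1r /= lcs_insubdK.
apply/(GS_dominatedP wA sq).
have sqn n : seminorm_on (lcs_set (Bspace c M (dual_weights W n))) q.
  apply: seminorm_onS (lcs_snP qB) => x.
  exact: (@indlim_step _ _ _ (fun n => Bspace c M (dual_weights W n)) n).
have dqn n := proj1 (Bspace_dominatedP (sqn n)) (indlim_snE n qB).
have sf phi Sp := proj1 (@fconv_smooth _ _ _ _ _ wA M2_M f f_cont phi Sp).
exact: (uniform_hex H1 unif (fun phi => proj1 (GSP _ _ _ wA)) sf dqn).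
Qed.

End FromDual.

(** * Uniform boundedness *)

Section GlidingHump.
Context {R : realType} {d : nat} {M A : nat -> {posnum R}} (wA : weight_seq A).
Local Notation V := 'rV[R]_d.
Local Notation F := (V -> R[i]^o).
Implicit Types (phi psi : F).

Lemma pderivsB s phi psi : smooth phi -> smooth psi ->
  pderivs s (phi - psi) = pderivs s phi - pderivs s psi.
Proof.
move=> sp sq; rewrite addrC -scaleN1r (pderivs_lin s (-1) sq sp) scaleN1r.
exact: addrC.
Qed.

Lemma smoothB phi psi : smooth phi -> smooth psi -> smooth (phi - psi).
Proof. by move=> sp sq; rewrite addrC -scaleN1r; exact: smoothP. Qed.

Lemma gsbD (k a b : R) phi psi : 0 <= k -> gsb M A k a phi -> gsb M A k b psi ->
  gsb M A k (a + b) (phi + psi).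
Proof.
move=> k0 [sp bp] [sq bq]; split; first by rewrite -[phi]scale1r; exact: smoothP.
apply: ubdD => //; exact: gsw_ge0.
Qed.

Lemma gsbZ (k a : R) z phi : gsb M A k a phi -> gsb M A k (Normc.normc z * a) (z *: phi).
Proof.
move=> [sp bp]; split; last exact: ubdZ.
rewrite -[z *: phi]addr0; exact: smoothP sp (@smooth0 _ _).
Qed.

Lemma gsb0 (k a : R) : 0 <= a -> gsb M A k a (0 : F).
Proof.
move=> a0; split; first exact: smooth0.
by move=> s x; rewrite pderivs0 Normc.normc0 !mul0r mulr_ge0.
Qed.

Lemma gsb_ge0 (k a : R) phi : gsb M A k a phi -> 0 <= a.
Proof. by move=> [_ bp]; apply: ubd_ge0 bp; exists 0; exact: gsw_ge0. Qed.

Variable kappa : nat -> R.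
Hypotheses (kappa0 : forall n, 0 < kappa n) (kappa_le : forall n m, (n <= m)%N -> kappa n <= kappa m).
Let B n b phi := gsb M A (kappa n) b phi.

Let B_le n m a b phi : (n <= m)%N -> a <= b -> B m a phi -> B n b phi.
Proof. by move=> nm ab; apply: gsb_le => //; [exact: ltW|exact: kappa_le]. Qed.

(** Completeness along steps of varying parameter: increments bounded by a sequence that at least
    halves make all derivatives converge uniformly, and the geometric tail gives the factor 2. *)
Lemma gsb_complete (u : nat -> F) (e : nat -> R) (m : nat -> nat) :
  (forall j, smooth (u j)) ->
  (forall j, 0 < e j) -> (forall j, e j.+1 <= e j / 2) -> (forall j, (m j <= m j.+1)%N) ->
  (forall j, B (m j) (e j) (u j.+1 - u j)) ->
  exists2 v, smooth v & forall j, B (m j) (2 * e j) (v - u j).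
Proof.
move=> su e0 eS mS uB.
have m_le j k : (j <= k)%N -> (m j <= m k)%N by apply: (homo_leq leqnn leq_trans mS).
(* Subtracting [2 * e (j + n)] makes the induction close, because [e j.+1 <= e j / 2]. *)
have tail n j : B (m j) (2 * e j - 2 * e (j + n)%N) (u (j + n)%N - u j).
  elim: n => [|n IH]; first by rewrite addn0 !subrr; apply: gsb0.
  have h : B (m j) (e (j + n)%N) (u (j + n).+1 - u (j + n)%N).
    by apply: B_le (uB (j + n)%N) => //; exact/m_le/leq_addr.
  have E : u (j + n).+1 - u (j + n)%N + (u (j + n)%N - u j) = u (j + n).+1 - u j.
    by rewrite addrA subrK.
  have := gsbD (ltW (kappa0 _)) h IH; rewrite E addnS.
  by apply: B_le => //; have := eS (j + n)%N; lra.
have tail' n j : (j <= n)%N -> B (m j) (2 * e j) (u n - u j).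
  move=> /subnKC <-; apply: B_le (tail _ _) => //.
  by rewrite gerBl mulr_ge0// ltW.
have e_le j : e j <= e 0 / 2 ^+ j.
  elim: j => [|j IH]; first by rewrite expr0 divr1.
  apply: le_trans (eS j) _; rewrite exprSr invfM mulrA ler_pM2r//.
have [s e1 e10|v sv vl] := smooth_limit su.
  (* Twice the bound for one difference with [u N], as two such differences are combined; the
     weight, being at least 1, is dropped. *)
  pose D := 4 * e 0 * (M (size s))%:num / kappa (m 0) ^+ size s.
  have k0 : 0 < kappa (m 0) ^+ size s by rewrite exprn_gt0.
  have D0 : 0 < D by rewrite divr_gt0// !mulr_gt0.
  have [N NP] : exists N, D / 2 ^+ N <= e1.
    have : 2^-1 ^+ n @[n --> \oo] --> (0 : R) by apply: cvg_expr; rewrite ger0_norm// invf_lt1// ltr1n.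
    have e1D : 0 < e1 / D by rewrite divr_gt0.
    move=> /cvgrPdist_le/(_ _ e1D)[N _ /(_ N (leqnn N))] /=.
    rewrite sub0r normrN ger0_norm ?exprn_ge0// ler_pdivlMr// => H; exists N.
    by rewrite mulrC -exprVn.
  exists N => n k Nn Nk x.
  have H p : (N <= p)%N -> Normc.normc (pderivs s (u p) x - pderivs s (u N) x) <= D / 2 ^+ N / 2.
    move=> /tail'[_ /(_ s x)].
    rewrite (pderivsB s (su p) (su N)).
    change ((pderivs s (u p) - pderivs s (u N)) x) with (pderivs s (u p) x - pderivs s (u N) x).
    set z := Normc.normc _ => H.
    have z0 : 0 <= z by exact: normc_ge0.
    have {}H : z * kappa (m 0) ^+ size s <= 2 * e N * (M (size s))%:num.
      apply: le_trans H; rewrite -[leRHS]mulrA; apply: ler_wpM2l => //.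
      rewrite -[leLHS]mul1r; apply: ler_pM => //.
      - by rewrite exprn_ge0// ltW.
      - by apply: gsw_ge1 => //; exact: ltW.
      - by rewrite lerXn2r ?nnegrE ?(ltW (kappa0 _))//; apply/kappa_le/m_le.
    rewrite -(ler_pM2r k0); apply: le_trans H _.
    rewrite (_ : D / 2 ^+ N / 2 * _ = 2 * (e 0 / 2 ^+ N) * (M (size s))%:num).
      by rewrite ler_wpM2r// ler_wpM2l.
    by rewrite /D; field; rewrite !gt_eqF// exprn_gt0.
  have -> : pderivs s (u n) x - pderivs s (u k) x = (pderivs s (u n) x - pderivs s (u N) x) -
     (pderivs s (u k) x - pderivs s (u N) x) by ring.
  apply: le_trans (le_normcD _ _) _; rewrite normcN; apply: le_trans NP.
  by rewrite [leRHS]splitr; apply: lerD; exact: H.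
exists v; first exact: sv.
move=> j; split; first exact: smoothB.
apply: (@ubd_limit _ _ M _ _ _ (fun n => u n - u j) _ j) => //.
- by move=> x; exact: gsw_ge0.
- move=> s x e1 /(vl s x)[N NP]; exists N => n /NP.
  have E w : smooth w -> pderivs s (w - u j) x = pderivs s w x - pderivs s (u j) x.
    by move=> sw; rewrite (pderivsB s sw (su j)).
  rewrite (E _ (su n)) (E _ sv).
  by rewrite opprB addrA subrK.
- by move=> n jn; have [] := tail' n j jn.
Qed.

Variables (S : set F) (T : F -> F) (w : nat -> V -> R).
Hypotheses (w0 : forall n x, 0 < w n x) (wS : forall n m x, (n <= m)%N -> w n x <= w m x).
Hypothesis SP : forall a phi psi, S phi -> S psi -> S (a *: phi + psi).
Hypothesis S0 : S 0.
Hypothesis S_smooth : forall phi, S phi -> smooth phi.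
Hypothesis S_complete : forall v, smooth v ->
  (forall n, exists u b, S u /\ B n b (v - u)) -> S v.
Hypothesis TP : forall a phi psi, S phi -> S psi -> T (a *: phi + psi) = a *: T phi + T psi.
Hypothesis T_cont : exists n0, forall x, exists2 C, 0 <= C &
  forall phi b, S phi -> B n0 b phi -> Normc.normc (T phi x) <= C * b.
Hypothesis T_bound : forall phi, S phi -> exists N, forall x,
  Normc.normc (T phi x) <= N%:R * w N x.

(* If the bound failed for all [n], [N], a rapidly convergent sum of test functions [phi_j]    *)
(* with [T phi_j] large at suitable points relative to [w j] would violate [T_bound].           *)
Lemma gliding_hump : exists n N, exists2 C, 0 <= C & forall phi b, S phi -> B n b phi ->
  forall x, Normc.normc (T phi x) <= C * b * w N x.
Proof.
have [n0 Tn0] := T_cont.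
(* A bound on one ball suffices, by homogeneity; a small [tau] is added to [b] to allow [b = 0]. *)
suff [n [N [e [C [e0 C0 H]]]]] : exists n N e C, [/\ 0 < e, 0 <= C &
    forall phi, S phi -> B n e phi -> forall x, Normc.normc (T phi x) <= C * w N x].
  exists n, N, (C / e); first by rewrite divr_ge0// ltW.
  move=> phi b Sp Bp x; have b0 := gsb_ge0 Bp.
  apply/ler_addgt0Pr => eta eta0.
  have W0 := w0 N x.
  pose tau := eta / (C / e * w N x + 1).
  have Q0 : 0 <= C / e * w N x by rewrite mulr_ge0 ?divr_ge0// ltW.
  have D0 : 0 < C / e * w N x + 1 by rewrite ltr_wpDl.
  have tau0 : 0 < tau by rewrite divr_gt0.
  have bt : 0 < b + tau by rewrite ltr_wpDl.
  pose t := e / (b + tau); have t0 : 0 < t by rewrite divr_gt0.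
  have Stp : S (t%:C%C *: phi) by rewrite -[_ *: _]addr0; exact: SP.
  have Btp : B n e (t%:C%C *: phi).
    have := gsbZ t%:C%C Bp; rewrite normcR gtr0_norm//; apply: gsb_le => //; first exact: ltW.
    by rewrite /t mulrAC ler_pdivrMr// ler_pM2l// lerDl ltW.
  have := H _ Stp Btp x.
  have T0 : T 0 = 0.
    by have := TP (-1) S0 S0; rewrite scaler0 addr0 scaleN1r addNr.
  have -> : T (t%:C%C *: phi) = t%:C%C *: T phi.
    by have := TP t%:C%C Sp S0; rewrite !addr0 T0 addr0.
  change ((t%:C%C *: T phi) x) with (t%:C%C * T phi x).
  rewrite Normc.normcM normcR gtr0_norm// -ler_pdivlMl// => {}H; apply: le_trans H _.
  rewrite (_ : t^-1 * (C * w N x) = C / e * b * w N x + (C / e * w N x) * tau); last first.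
    by rewrite /t; field; rewrite !gt_eqF.
  rewrite lerD2l /tau mulrA ler_pdivrMr// mulrC ler_pM2l// lerDl//.
apply: contrapT => nH.
have {}nH n N e C : 0 < e -> 0 <= C -> exists2 phi, S phi /\ B n e phi &
    exists x, C * w N x < Normc.normc (T phi x).
  move=> e0 C0; apply: contrapT => H; apply: nH; exists n, N, e, C; split => // phi Sp Bp x.
  by rewrite leNgt; apply/negP => Hx; apply: H; exists phi => //; exists x.
(* One stage of the construction: the function changes within the old tolerance, and the new
   tolerance is so small that no later correction [z] can bring the image below [j * w j] at the
   chosen point. *)
pose P j (ue ue' : F * R) := [/\ S ue'.1, B (n0 + j)%N ue.2 (ue'.1 - ue.1),
   0 < ue'.2, ue'.2 <= ue.2 / 2 & exists x, forall z, S z -> B n0 (2 * ue'.2) z ->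
   j%:R * w j x <= Normc.normc (T (ue'.1 + z) x)].
have stepP j ue : S ue.1 -> 0 < ue.2 -> exists ue', P j ue ue'.
  case: ue => u e /= Su e0.
  have [u' [x [Su' Bu' Hx]]] : exists u' x, [/\ S u', B (n0 + j)%N e (u' - u) &
      j%:R * w j x < Normc.normc (T u' x)].
    (* If the image of [u] is already large somewhere, nothing is added. Otherwise it is at most
       [j * w j] everywhere, and a hump exceeding twice that survives the addition. *)
    have [[x Hx]|nx] := pselect (exists x, j%:R * w j x < Normc.normc (T u x)).
      by exists u, x; split => //; rewrite subrr; apply/gsb0/ltW.
    have jj : 0 <= j%:R + j%:R :> R by rewrite addr_ge0.
    have [phi [Sp Bp] [x Hx]] := nH (n0 + j)%N j e _ e0 jj.
    exists (phi + u), x; split; [|by rewrite addrK|].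
      by rewrite -[phi]scale1r; exact: SP.
    have -> : T (phi + u) = T phi + T u by have := TP 1 Sp Su; rewrite !scale1r.
    have hu : Normc.normc (T u x) <= j%:R * w j x.
      by rewrite leNgt; apply/negP => Hu; apply: nx; exists x.
    have : Normc.normc (T phi x) <= Normc.normc ((T phi + T u) x) + Normc.normc (T u x).
      rewrite -[X in _ <= _ + X]normcN; apply: le_trans (le_normcD _ _).
      by change (Normc.normc (T phi x) <= Normc.normc (T phi x + T u x - T u x)); rewrite addrK.
    move: Hx hu; rewrite mulrDl; move: (Normc.normc _) (Normc.normc _) (Normc.normc _) (_ * _) => p q r s.
    lra.
  have [C C0 HC] := Tn0 x.
  pose g := Normc.normc (T u' x) - j%:R * w j x.
  have g0 : 0 < g by rewrite subr_gt0.
  (* [g] is the excess at [x]; continuity of evaluation at [x], with constant [C], turns it into a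
     size allowed for later corrections. *)
  exists (u', Num.min (e / 2) (g / (2 * (C + 1)))); rewrite /P /=.
  have C1 : 0 < 2 * (C + 1) by rewrite mulr_gt0// ltr_wpDl.
  split => //; first by rewrite lt_min !divr_gt0.
    by rewrite ge_min lexx.
  exists x => z Sz Bz.
  have {}Bz : B n0 (g / (C + 1)) z.
    apply: B_le Bz => //.
    have : Num.min (e / 2) (g / (2 * (C + 1))) <= g / (2 * (C + 1)) by rewrite ge_min lexx orbT.
    rewrite -(ler_pM2l (_ : 0 < 2))// => /le_trans; apply.
    by rewrite le_eqVlt; apply/orP; left; apply/eqP; field; rewrite gt_eqF// ltr_wpDl.
  have := HC _ _ Sz Bz; have -> : T (u' + z) = T u' + T z by have := TP 1 Su' Sz; rewrite !scale1r.
  have Cg : C * (g / (C + 1)) <= g.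
    have C10 : 0 < C + 1 by rewrite ltr_wpDl.
    by rewrite mulrA ler_pdivrMr// (mulrC C) mulrDr mulr1 lerDl ltW.
  move=> /le_trans/(_ Cg).
  have : Normc.normc (T u' x) <= Normc.normc ((T u' + T z) x) + Normc.normc (T z x).
    rewrite -[X in _ <= _ + X]normcN; apply: le_trans (le_normcD _ _).
    by change (Normc.normc (T u' x) <= Normc.normc (T u' x + T z x - T z x)); rewrite addrK.
  rewrite /g; move: (Normc.normc _) (Normc.normc _) (Normc.normc _) (_ * _) => p q r s; lra.
pose St := {ue : F * R | S ue.1 /\ 0 < ue.2}.
have /choice[nxt nxtP] : forall js : nat * St, exists ue' : St, P js.1 (sval js.2) (sval ue').
  move=> [j [ue [Su e0]]] /=; have [ue' Pj] := stepP j _ Su e0.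
  by have [Su' _ e0' _ _] := Pj; exists (exist _ ue' (conj Su' e0')).
have s0 : S ((0 : F), (1 : R)).1 /\ 0 < ((0 : F), (1 : R)).2 by [].
pose st := fix st n := if n is n'.+1 then nxt (n', st n') else (exist _ _ s0 : St).
pose u n := (sval (st n)).1; pose e n := (sval (st n)).2.
have uS n : S (u n) by have [] := svalP (st n).
have eS n : 0 < e n by have [] := svalP (st n).
have stP n : P n (u n, e n) (u n.+1, e n.+1).
  have := nxtP (n, st n); rewrite /u /e /=.
  by case: (sval (st n)) (sval (nxt _)) => ? ? [? ?].
have [|||||v sv vP] := @gsb_complete u e (fun j => n0 + j)%N.
- by move=> j; exact: S_smooth.
- by move=> j.
- by move=> j; have [] := stP j.
- by move=> j; rewrite addnS.
- by move=> j; have [] := stP j.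
have Sv : S v.
  apply: S_complete; first exact: sv.
  move=> n; exists (u n), (2 * e n); split; first exact: uS.
  by apply: B_le (vP n) => //; exact: leq_addl.
(* The bound [N * w N] for the limit contradicts the hump made at stage [N.+1], which the correction
   [v - u N.+2] cannot destroy. *)
have [N HN] := T_bound Sv.
have [_ _ _ _ [x /(_ (v - u N.+2))]] := stP N.+1.
rewrite /= (addrC (u N.+2)) subrK; have Sz : S (v - u N.+2) by rewrite addrC -scaleN1r; exact: SP.
have Bz : B n0 (2 * e N.+2) (v - u N.+2) by apply: B_le (vP _) => //; exact: leq_addr.
move=> /(_ Sz Bz) H.
have := le_trans H (HN x).
have := wS x (leqnSn N); have := w0 N x; rewrite -natr1.
move: (N%:R) (ler0n R N) (w N x) (w N.+1 x) => p p0 a b a0 ab.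
nra.
Qed.

End GlidingHump.

(** * Uniform estimate for the convolutions *)

Section UniformBound.
Context {R : realType} {d : nat} {c : ultra_case} {M A : nat -> {posnum R}}.
Hypotheses (wA : weight_seq A) (M2_M : M2 M).
Variable f : {linear GS d c M A -> R[i]^o}.
Hypothesis f_cont : continuous f.
Variable W : nat -> 'rV[R]_d -> {posnum R}.
Hypothesis incrW : incr_weight_system W.
Local Notation V := 'rV[R]_d.
Local Notation F := (V -> R[i]^o).
Local Notation S := (lcs_set (GS d c M A)).

Lemma archi_nat (r : R) : exists n : nat, r <= n%:R.
Proof. by exists (Num.bound `|r|); apply: le_trans (ler_norm r) (ltW (archi_boundP (normr_ge0 r))). Qed.

(** The weights increase, so constant and weight index can be merged into one integer, as the
    gliding hump expects. *)
Lemma CdecrP phi : lcs_set (Cdecr (dual_weights W)) phi ->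
  exists N, forall x, Normc.normc (phi x) <= N%:R * nweight (W N) x.
Proof.
move=> Cphi; have [N [D HD]] : exists N D, forall x, Normc.normc (phi x) <= D * nweight (W N) x.
  case: Cphi => s sC ->; elim: s sC => [_|psi s IH sC].
    by exists 0%N, 0 => x; rewrite big_nil mul0r Normc.normc0.
  have [|N1 [D1 H1]] := IH; first by move=> y ys; apply: sC; rewrite inE ys orbT.
  have [N2 [_ [D2 H2]]] := sC psi (mem_head _ _).
  exists (maxn N1 N2), (`|D1| + `|D2|) => x; rewrite big_cons mulrDl addrC.
  have w1 := incr_weight_le x incrW (leq_maxl N1 N2).
  have w2 := incr_weight_le x incrW (leq_maxr N1 N2).
  change (Normc.normc ((\sum_(y <- s) y) x + psi x) <= `|D1| * nweight (W (maxn N1 N2)) x +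
    `|D2| * nweight (W (maxn N1 N2)) x).
  apply: le_trans (le_normcD _ _) (lerD _ _).
    apply: le_trans (H1 x) _; apply: le_trans (ler_wpM2r _ (ler_norm D1)) _; first by rewrite /nweight.
    exact: ler_wpM2l.
  have : weighted_abs (dual_weights W N2) x psi <= D2 by apply: H2; exists x.
  rewrite /weighted_abs /= ler_pdivrMr// => /le_trans; apply.
  apply: le_trans (ler_wpM2r _ (ler_norm D2)) _ => //; exact: ler_wpM2l.
have [n Dn] := archi_nat D; exists (maxn n N) => x.
apply: le_trans (HD x) _; apply: (@le_trans _ _ (n%:R * nweight (W N) x)).
  by apply: ler_wpM2r => //; rewrite /nweight.
apply: ler_pM => //; first by rewrite /nweight.
  by rewrite ler_nat leq_maxl.
exact: (incr_weight_le x incrW (leq_maxr _ _)).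
Qed.

(** Evaluation of [fconv f] at a point is continuous because [f] is, so the gliding hump applies:
    with the cofinal parameters [n.+1] in the Beurling case, and with a constant parameter on each
    step in the Roumieu case. *)
Lemma conv_into_uniform : conv_into f (Cdecr (dual_weights W)) ->
  hex c (fun h => exists N, exists2 C, 0 <= C & forall phi b, S phi -> gsb M A h%:num b phi ->
    forall x, Normc.normc (fconv f phi x) <= C * b * nweight (W N) x).
Proof.
move=> convf.
have T_bound phi : S phi -> exists N, forall x, Normc.normc (fconv f phi x) <= N%:R * nweight (W N) x.
  by move=> Sp; apply: CdecrP; have := convf (lcs_mk Sp).
have := fval_hex wA f_cont.
have SPa a phi psi : S phi -> S psi -> S (a *: phi + psi) by exact: lcs_setP.
have S0 : S 0 by exact: lcs_set0.
have Ssm phi : S phi -> smooth phi by exact: GS_smooth.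
have TPa a phi psi : S phi -> S psi -> fconv f (a *: phi + psi) = a *: fconv f phi + fconv f psi.
  exact: fconv_lin.
have SPP phi := GSP c M phi wA.
have Srefl x phi : S phi -> S (refl_trans x phi) by exact: GS_refl.
have w0 n x : 0 < nweight (W n) x by rewrite /nweight.
have wS n m x : (n <= m)%N -> nweight (W n) x <= nweight (W m) x.
  exact: incr_weight_le.
have T_cont (h : {posnum R}) C k : 0 <= C -> 2 * h%:num <= k ->
    (forall psi b, S psi -> gsb M A h%:num b psi -> Normc.normc (fval f psi) <= C * b) ->
    forall x, exists2 C', 0 <= C' & forall phi b, S phi -> gsb M A k b phi ->
      Normc.normc (fconv f phi x) <= C' * b.
  move=> C0 hk HC x; exists (C * gsw A k x); first by rewrite mulr_ge0// gsw_ge0.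
  move=> phi b Sp bp; rewrite -mulrA; apply: HC; first exact: Srefl.
  by apply: gsb_refl bp.
move: T_bound SPa S0 Ssm TPa SPP Srefl T_cont {convf}.
case: (c) (f) => f' T_bound SPa S0 Ssm TPa SPP Srefl T_cont.
  move=> [h [C C0 HC]].
  pose kappa (n : nat) := n.+1%:R : R.
  have kappa0 n : 0 < kappa n by rewrite ltr0n.
  have kappa_le n m : (n <= m)%N -> kappa n <= kappa m by rewrite ler_nat ltnS.
  have arch (r : R) : exists n, r <= kappa n.
    by have [n rn] := archi_nat r; exists n; rewrite (le_trans rn)// ler_nat.
  have [n0 hn0] := arch (2 * h%:num).
  have [|n [N [D D0 HD]]] := @gliding_hump R d M A wA kappa kappa0 kappa_le _ (fconv f')
    (fun n => nweight (W n)) w0 wS SPa S0 Ssm _ TPa (ex_intro _ n0 (T_cont h C (kappa n0) C0 hn0 HC)) T_bound.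
    move=> v sv Hv; apply/SPP => k.
    have [m km] := arch k%:num; have [u [b [/SPP/(_ k)[b' bu] bvu]]] := Hv m.
    exists (b + b'); rewrite -[v](subrK u); apply: gsbD; [by []| |exact: bu].
    exact: gsb_le km (lexx b) bvu.
  by exists (PosNum (kappa0 n)), N, D => // phi b Sp bp x; exact: HD.
move=> Hf h.
have p2 : 0 < 2 :> R by [].
pose k := pscale (posinv (PosNum p2)) h.
have hk : 2 * k%:num <= h%:num by rewrite /= mulrA divff// mul1r.
have [C C0 HC] := Hf k.
have h0 : 0 < h%:num by [].
have [|n [N [D D0 HD]]] := @gliding_hump R d M A wA (fun=> h%:num) (fun=> h0) (fun _ _ _ => lexx _) _ (fconv f')
  (fun n => nweight (W n)) w0 wS SPa S0 Ssm _ TPa (ex_intro _ 0%N (T_cont k C h%:num C0 hk HC)) T_bound.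
  move=> v sv Hv; apply/SPP; have [u [b [/SPP[h' [b' bu]] bvu]]] := Hv 0%N.
  have [m [mh mh']] := posnum_min h h'; exists m, (b + b').
  rewrite -[v](subrK u); apply: gsbD; [by []|exact: gsb_le mh (lexx b) bvu|].
  exact: gsb_le mh' (lexx b') bu.
by exists N, D => // phi b Sp bp x; exact: HD.
Qed.

End UniformBound.

(** * Partitions of unity *)

Section Primitive.
Context {R : realType}.
Local Notation mu := (@lebesgue_measure R).

Lemma is_derive_near (f g : R -> R) (x l : R) : (\forall y \near x, f y = g y) ->
  is_derive x 1 g l -> is_derive x 1 f l.
Proof.
move=> /nbhs_ballP[r /= r0 fg] [dg gl].
have /derivable_distP Hg : derivable (g : R -> R^o) x 1 /\ 'D_1 (g : R -> R^o) x = l by [].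
suff [df fl] : derivable (f : R -> R^o) x 1 /\ 'D_1 (f : R -> R^o) x = l by exact: DeriveDef.
apply/derivable_distP => e e0; have [del del0 H] := Hg _ e0.
exists (Num.min r del) => [|h]; first by rewrite lt_min r0.
rewrite lt_min => /andP[hr hd]; rewrite !fg; first exact: H.
  by rewrite -ball_normE/= subrr normr0.
by rewrite -ball_normE/= [h *: 1]mulr1 opprD addrA subrr sub0r normrN.
Qed.

Lemma zero_derive_eq (f : R -> R) (lo a b : R) : lo < a -> lo < b ->
  (forall s : R, lo < s -> is_derive s 1 f 0) -> f a = f b.
Proof.
wlog ab : a b / a <= b => [H|].
  by move=> la lb df; have [/H->//|/ltW/H->] := leP a b.
move=> la _ df.
have cf : {within `[a, b], continuous f}.
  apply: continuous_in_subspaceT => s; rewrite inE/= in_itv/= => /andP[sa _].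
  by apply: differentiable_continuous; apply/derivable1_diffP; have [] := df s (lt_le_trans la sa).
have [|c _] := @MVT_segment R f (fun=> 0) a b ab _ cf.
  by move=> s; rewrite in_itv/= => /andP[sa _]; apply: df; exact: lt_trans sa.
by rewrite mul0r => /eqP; rewrite subr_eq0 => /eqP.
Qed.

(** Integrals from [- n] differ by constants where both make sense; normalised to vanish at 0 they
    agree, and an integer above [|x|] selects one valid at [x]. *)
Lemma primitive (v : R -> R) : continuous v -> exists G : R -> R, forall t : R, is_derive t 1 G (v t).
Proof.
move=> cv.
pose I0 (n : nat) (x : R) : R := (\int[mu]_(t in [set` `[- n%:R, x]]) (v t))%R.
have dI0 n (x : R) : - n%:R < x -> is_derive x 1 (I0 n) (v x).
  move=> nx; have xu : x < x + 1 by rewrite ltrDl.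
  have vi : mu.-integrable `[- n%:R, x + 1] (EFin \o v).
    apply: continuous_compact_integrable; first exact: segment_compact.
    exact: continuous_subspaceT.
  have [dF F'] := continuous_FTC1_closed xu vi nx (cv x).
  by apply: DeriveDef; [exact: dF|rewrite -F' derive1E].
pose P n x := I0 n.+1 x - I0 n.+1 0.
have dP n (x : R) : - n.+1%:R < x -> is_derive x 1 (P n) (v x).
  move=> nx; rewrite -[v x]subr0; apply: is_deriveB; exact: dI0.
have P_eq n m (x : R) : - n.+1%:R < x -> - m.+1%:R < x -> P n x = P m x.
  wlog nm : n m / (n <= m)%N => [H|].
    by move=> nx mx; have [/H->//|/ltnW/H->] := leqP n m.
  move=> nx mx; apply/eqP; rewrite -subr_eq0.
  have d0 (s : R) : - n.+1%:R < s -> is_derive s 1 (fun x => P n x - P m x) 0.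
    move=> ns; have ms : - m.+1%:R < s by apply: le_lt_trans ns; rewrite lerN2 ler_nat ltnS.
    rewrite -(subrr (v s)); apply: is_deriveB; exact: dP.
  have n0 : - n.+1%:R < 0 :> R by rewrite oppr_lt0.
  have -> := zero_derive_eq nx n0 d0.
  by rewrite /P !subrr.
exists (fun x => P (Num.bound `|x|) x) => t.
have [n tn] := archi_nat (`|t| + 1).
have tn' : - n.+1%:R < t.
  have : - `|t| <= t by rewrite lerNl -normrN ler_norm.
  have : n%:R < n.+1%:R :> R by rewrite ltr_nat.
  lra.
apply: is_derive_near (dP n t tn').
exists 1 => //= y; rewrite /ball/= => ty; apply: P_eq.
  have : `|y| < (Num.bound `|y|)%:R by apply: archi_boundP.
  have : - `|y| <= y by rewrite lerNl -normrN ler_norm.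
  have : (Num.bound `|y|)%:R < (Num.bound `|y|).+1%:R :> R by rewrite ltr_nat.
  lra.
have : t - y < 1 by apply: le_lt_trans ty; exact: ler_norm.
have : - `|t| <= t by rewrite lerNl -normrN ler_norm.
have : n%:R < n.+1%:R :> R by rewrite ltr_nat.
lra.
Qed.

Lemma derive_nneg (f df : R -> R) (a b : R) : (forall s : R, is_derive s 1 f (df s)) ->
  (forall s, 0 <= df s) -> a <= b -> f a <= f b.
Proof.
move=> fdf df0 ab; have cf : {within `[a, b], continuous f}.
  apply: continuous_subspaceT => s.
  by apply: differentiable_continuous; apply/derivable1_diffP; have [] := fdf s.
have [c _] := MVT_segment ab (fun s _ => fdf s) cf.
by move=> E; rewrite -subr_ge0 E mulr_ge0// subr_ge0.
Qed.

(* The primitive is bounded by comparison with a multiple of atan. *)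
Lemma step_function (v : R -> R) (c0 : R) : continuous v -> (forall t, 0 <= v t) -> 0 < v 0 ->
  (forall t, v t * (1 + t ^+ 2) <= c0) ->
  exists G L, [/\ 0 < L, forall t : R, is_derive t 1 G (v t / L), forall t, 0 <= G t <= 1,
    forall s t, s <= t -> G s <= G t & forall e, 0 < e -> exists r, forall t,
      (r <= t -> 1 - e <= G t) /\ (t <= - r -> G t <= e)].
Proof.
move=> cv v0 v00 vc; have [G dG] := primitive cv.
have Gmono s t : s <= t -> G s <= G t by move=> st; apply: derive_nneg dG v0 st.
have q0 (t : R) : 0 < 1 + t ^+ 2 by apply: ltr_pwDl => //; exact: sqr_ge0.
have Gle s t : s <= t -> G t - G s <= c0 * (atan t - atan s).
  move=> st; pose D : R -> R := c0 *: (atan : R -> R) - G.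
  have dD (r : R) : is_derive r 1 D (c0 * (1 + r ^+ 2)^-1 - v r).
    by apply: is_deriveB; apply: is_deriveZ; exact: is_derive1_atan.
  have : D s <= D t.
    by apply: derive_nneg dD _ st => r; rewrite subr_ge0 ler_pdivlMr.
  by rewrite /D; change (c0 * atan s - G s <= c0 * atan t - G t -> G t - G s <= c0 * (atan t - atan s)); lra.
have c00 : 0 <= c0 by apply: le_trans (vc 0); rewrite mulr_ge0// ltW.
have Gb s t : G t - G s <= c0 * pi.
  have [st|/ltW ts] := leP s t.
    apply: le_trans (Gle _ _ st) _; apply: ler_wpM2l => //.
    by have := atan_ltpi2 t; have := atan_gtNpi2 s; lra.
  apply: (@le_trans _ _ 0); first by rewrite subr_le0 Gmono.
  by rewrite mulr_ge0// pi_ge0.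
have bG : has_sup (range G).
  split; first by exists (G 0), 0.
  by exists (G 0 + c0 * pi) => _ [t _ <-]; have := Gb 0 t; lra.
have bG' : has_inf (range G).
  split; first by exists (G 0), 0.
  by exists (G 0 - c0 * pi) => _ [t _ <-]; have := Gb t 0; lra.
pose b := sup (range G); pose a := inf (range G).
have Gsup t : G t <= b by apply: ub_le_sup; [exact: bG.2|exists t].
have Ginf t : a <= G t by apply: ge_inf; [exact: bG'.2|exists t].
(* A constant [G] would have zero derivative at 0, against [0 < v 0]. *)
have L0 : 0 < b - a.
  rewrite subr_gt0 ltNge; apply/negP => ba.
  have Gc : G = cst b.
    apply/funext => t; apply/eqP; rewrite eq_le Gsup/=; exact: le_trans (Ginf t).
  have [_ E] := dG 0; have := v00.
  by rewrite -E Gc derive_cst ltxx.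
exists (fun t => (G t - a) / (b - a)), (b - a); split => //.
- move=> t; have dGa : is_derive t 1 ((b - a)^-1 *: (G - cst a)) ((b - a)^-1 *: (v t - 0)).
    exact: is_deriveZ.
  rewrite subr0 in dGa; have -> : v t / (b - a) = (b - a)^-1 *: v t by exact: mulrC.
  have -> : (fun t => (G t - a) / (b - a)) = (b - a)^-1 *: (G - cst a) by apply/funext => r; exact: mulrC.
  exact: dGa.
- move=> t; apply/andP; split; first by rewrite divr_ge0 ?subr_ge0// ltW// -subr_gt0.
  by rewrite ler_pdivrMr// mul1r lerB.
- by move=> s t st; rewrite ler_pM2r ?invr_gt0// lerB// Gmono.
- move=> e e0; have eL : 0 < e * (b - a) by rewrite mulr_gt0.
  have [_ [t1 _ <-] h1] := sup_adherent eL bG.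
  have [_ [t2 _ <-] h2] := inf_adherent eL bG'.
  exists (Num.max t1 (- t2)) => t; split => ht.
    rewrite ler_pdivlMr//; have : G t1 <= G t by apply: Gmono; apply: le_trans ht; rewrite le_max lexx.
    rewrite -/b in h1; nra.
  rewrite ler_pdivrMr//; have : G t <= G t2.
    apply: Gmono; apply: le_trans ht _; rewrite lerNl; by rewrite le_max lexx orbT.
  rewrite -/a in h2; nra.
Qed.

End Primitive.

Section Windows.
Context {R : realType} {d : nat} {M A : nat -> {posnum R}}.
Hypotheses (wA : weight_seq A) (M1_M : M1 M).
Local Notation V := 'rV[R]_d.
Local Notation F := (V -> R[i]^o).
Local Notation "''e_' i" := (delta_mx ord0 i : V) (at level 8, i at level 2).

Lemma enorm_delta (t : R) (i : 'I_d) : enorm (t *: 'e_i : V) = `|t|.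
Proof.
rewrite /enorm (bigD1 i)//= big1 ?addr0 => [|j ji].
  by rewrite !mxE !eqxx mulr1 sqrtr_sqr.
by rewrite !mxE eqxx/= (negbTE ji) mulr0 expr0n.
Qed.

Lemma GS_square phi : lcs_set (GS d Beurling M A) phi ->
  forall k : R, 0 < k -> exists b, gsb M A k b (fmul phi (fconj phi)).
Proof.
move=> /(GSP _ _ _ wA) H k k0; have k20 : 0 < 2 * k by rewrite mulr_gt0.
have k2 : k <= 2 * k by rewrite mulr_natl mulr2n lerDl ltW.
have [b [sphi bphi]] := H (PosNum k20); rewrite /= in bphi.
have w0 (x : V) : 0 <= gsw A (2 * k) x by exact: gsw_ge0.
have [sc _] := pderivs_conj sphi.
have := ubd_mul M1_M k20 w0 w0 sphi sc bphi (ubd_conj sphi bphi).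
set B := _ * (M 0)%:num; move=> bd; exists B; split; first by have [] := leibniz sphi sc.
apply: ubd_le bd => //; first by rewrite mulrC mulKf// lexx (ltW k0).
move=> x; rewrite gsw_ge0/=.
have w1 : 1 <= gsw A (2 * k) x by apply: gsw_ge1 => //; exact: ltW.
apply: (@le_trans _ _ (gsw A (2 * k) x)); last by apply: ler_peMl.
exact: gsw_le (ltW k0) k2.
Qed.

(** [G] is the normalised primitive of [|phi|^2] along the line through [x0] in direction [i]. Its
    derivatives inherit the Gelfand-Shilov bounds, and [phi x0 <> 0] prevents it from being
    constant. *)
Lemma step_jet phi x0 (i : 'I_d) : lcs_set (GS d Beurling M A) phi -> phi x0 <> 0 ->
  exists G, [/\ is_jet G, forall t, 0 <= G 0%N t <= 1,
    forall e, 0 < e -> exists r, forall t,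
      (r <= t -> 1 - e <= G 0%N t) /\ (t <= - r -> G 0%N t <= e) &
    forall k, 0 < k -> exists2 c, 0 <= c & forall n t,
      `|G n.+1 t| * eassoc A (k * `|t|) * k ^+ n <= c * (M n)%:num].
Proof.
move=> Sphi phi0; pose psi := fmul phi (fconj phi).
have psiP := GS_square Sphi; have spsi : smooth psi by have [b []] := psiP 1 ltr01.
pose v n t := complex.Re (pderivs (nseq n i) psi (x0 + t *: 'e_i)).
have jv : is_jet v by exact: jet_restrict.
have vb k : 0 < k -> exists2 c, 0 <= c & forall n t,
    `|v n t| * eassoc A (k * `|t|) * k ^+ n <= c * (M n)%:num.
  move=> k0; have k20 : 0 < 2 * k by rewrite mulr_gt0.
have k2 : k <= 2 * k by rewrite mulr_natl mulr2n lerDl ltW.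
  have [b bp] := psiP _ k20; exists (gsw A (2 * k) x0 * b).
    by apply: mulr_ge0; [exact: gsw_ge0|exact: gsb_ge0 bp].
  move=> n t; have := proj2 bp (nseq n i) (x0 + t *: 'e_i); rewrite size_nseq.
  have : eassoc A (k * `|t|) <= gsw A (2 * k) (x0 + t *: 'e_i) * gsw A (2 * k) x0.
    rewrite -(enorm_delta t i) -(enormN (t *: 'e_i)).
    have := gsw_refl wA (x0 + t *: 'e_i) (- (- (t *: 'e_i))) (ltW k0) (lexx (2 * k)).
    by rewrite opprK addrK /gsw enormN.
  have := normc_Re (pderivs (nseq n i) psi (x0 + t *: 'e_i)); rewrite -/(v n t).
  have := eassoc_gt0 A (k * `|t|).
  have := gsw_ge0 A (2 * k) x0; have := gsw_ge0 A (2 * k) (x0 + t *: 'e_i).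
  have := normc_ge0 (pderivs (nseq n i) psi (x0 + t *: 'e_i)).
  have kn : k ^+ n <= (2 * k) ^+ n.
    by rewrite lerXn2r ?nnegrE ?(ltW k0) ?(ltW k20).
  have kn0 : 0 <= k ^+ n by rewrite exprn_ge0// ltW.
  move: (Normc.normc _) (gsw A (2 * k) (x0 + t *: 'e_i)) (gsw A (2 * k) x0) (eassoc A _) => D g g' g1.
  move=> D0 g0 g'0 g10 vD g1g H.
  apply: (@le_trans _ _ (D * (g * g') * (2 * k) ^+ n)).
    apply: ler_pM => //; first by rewrite mulr_ge0// ltW.
    by apply: ler_pM => //; exact: ltW.
  rewrite (_ : _ * _ * _ = g' * (D * g * (2 * k) ^+ n)); last by ring.
  by rewrite -[leRHS]mulrA ler_wpM2l.
have v0 t : 0 <= v 0%N t.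
  rewrite /v /= /psi /fmul /fconj; case: (phi _) => a b /=.
  by rewrite mulrN opprK addr_ge0// -expr2 sqr_ge0.
have v00 : 0 < v 0%N 0.
  rewrite lt_def v0 andbT; apply/eqP; rewrite /v /= scale0r addr0 /psi /fmul /fconj => E.
  apply: phi0; move: E; case: (phi x0) => a b /=; rewrite mulrN opprK => /eqP.
  rewrite -!expr2 paddr_eq0 ?sqr_ge0// !sqrf_eq0 => /andP[/eqP -> /eqP ->].
  by [].
have cv : continuous (v 0%N : R -> R).
  by move=> t; apply: differentiable_continuous; apply/derivable1_diffP; have [] := jv 0%N t.
have [c c0 vc] := vb 1 ltr01.
pose c1 := c * (M 0)%:num.
(* The exponential weight dominates its term of index 2, so the decay of [v 0] against it gives
   decay against [1 + t ^+ 2]. *)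
have [|G [L [L0 dG G01 _ Glim]]] := @step_function R (v 0%N) (c1 + c1 * (A 2)%:num / (A 0)%:num) cv v0 v00.
  move=> t; have := vc 0%N t; rewrite expr0 mulr1 mul1r ger0_norm// -/c1 => H.
  have e1 := eassoc_ge1 wA (normr_ge0 t).
  have e2 := eassoc_pow wA 2 (normr_ge0 t); rewrite real_normK ?num_real// in e2.
  rewrite mulrDr mulr1; apply: lerD.
    by apply: le_trans H; rewrite ler_peMr.
  rewrite ler_pdivlMr// -mulrA; rewrite ler_pdivrMr// in e2.
  apply: (@le_trans _ _ (v 0%N t * (eassoc A `|t| * (A 2)%:num))); first exact: ler_wpM2l.
  by rewrite mulrA ler_wpM2r.
exists (fun n => if n is n'.+1 then fun t => v n' t / L else G); split.
- move=> [|n] t; first exact: dG.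
  have := is_deriveZ (L^-1) (jv n t).
  have -> : L^-1 \*: v n = (fun t => v n t / L) by apply/funext => r; exact: mulrC.
  by have -> : L^-1 *: v n.+1 t = v n.+1 t / L by exact: mulrC.
- exact: G01.
- exact: Glim.
- move=> k k0; have [b b0 vb'] := vb k k0; exists (b / L); first by rewrite divr_ge0// ltW.
  have Li : 0 <= L^-1 by rewrite invr_ge0 ltW.
  move=> n t; rewrite normrM (ger0_norm Li).
  rewrite (_ : `|v n t| / L * _ * _ = (`|v n t| * eassoc A (k * `|t|) * k ^+ n) / L).
    rewrite (_ : b / L * _ = b * (M n)%:num / L); last by rewrite mulrAC.
    by rewrite ler_pM2r ?invr_gt0.
  by move: (eassoc _ _) => g; ring.
Qed.

End Windows.

(** * Windows and cutoffs in one variable *)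

Section Jets.
Context {R : realType}.
Implicit Types (v u G : nat -> R -> R).

Lemma jet_affine v (a sg : R) : is_jet v -> is_jet (fun n t => sg ^+ n * v n (a + sg * t)).
Proof.
move=> jv n t.
have d1 (r : R) : is_derive r 1 (fun t : R => a + sg * t) sg.
  have := is_deriveD (is_derive_cst a r 1) (is_deriveZ sg (is_derive_id r 1)).
  by rewrite add0r [sg *: _]mulr1.
have d2 : is_derive t 1 (v n \o (fun t : R => a + sg * t)) (v n.+1 (a + sg * t) * sg).
  exact: is_derive1_comp.
have := is_deriveZ (sg ^+ n) d2.
have -> : sg ^+ n *: (v n.+1 (a + sg * t) * sg) = sg ^+ n.+1 * v n.+1 (a + sg * t).
  by rewrite [_ *: _]mulrA mulrAC -exprSr.
exact.
Qed.

Lemma jet_sub u v : is_jet u -> is_jet v -> is_jet (fun n t => u n t - v n t).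
Proof. by move=> ju jv n t; exact: is_deriveB (ju n t) (jv n t). Qed.

Lemma jet_cst (a : R) : is_jet (fun n (_ : R) => if n is 0%N then a else 0).
Proof. by case=> [|n] t; exact: is_derive_cst. Qed.

Definition window G n (s : R) : R := G n (s + 1) - G n s.

Lemma jet_window G : is_jet G -> is_jet (window G).
Proof.
move=> jG; apply: jet_sub => //.
have -> : (fun n t => G n (t + 1)) = fun n t => 1 ^+ n * G n (1 + 1 * t).
  by apply/funext => n; apply/funext => t; rewrite expr1n !mul1r addrC.
exact: jet_affine.
Qed.

(** Derivatives in [t] of 1 minus the sum of [window G 0 (k - t)] over the integers [- n <= k < n],
    a sum that telescopes. *)
Definition cocutoff G (n : nat) p (t : R) : R :=
  (if p is 0%N then 1 else 0) -
  ((-1) ^+ p * G p (n%:R + (-1) * t) - (-1) ^+ p * G p (- n%:R + (-1) * t)).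

Lemma jet_cocutoff G n : is_jet G -> is_jet (cocutoff G n).
Proof.
move=> jG; apply: jet_sub; first exact: jet_cst.
by apply: jet_sub; exact: jet_affine.
Qed.

Variables (M A : nat -> {posnum R}).
Hypotheses (wA : weight_seq A) (M1_M : M1 M).

Lemma eassoc_split (k s a b : R) : 0 <= k -> 0 <= s -> 0 <= a -> 0 <= b -> s <= a + b ->
  eassoc A (k * s) <= eassoc A (2 * k * a) * eassoc A (2 * k * b).
Proof.
move=> k0 s0 a0 b0 sab; have ks : 0 <= k * s by exact: mulr_ge0.
have e1 x : 0 <= x -> 1 <= eassoc A (2 * k * x).
  by move=> x0; apply: eassoc_ge1; rewrite // !mulr_ge0.
have [ab|/ltW ba] := leP a b.
  apply: (@le_trans _ _ (eassoc A (2 * k * b))).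
    apply: eassoc_le => //; rewrite (mulrC 2) -mulrA ler_wpM2l//; lra.
  by apply: ler_peMl; [exact/ltW/eassoc_gt0|exact: e1].
apply: (@le_trans _ _ (eassoc A (2 * k * a))).
  apply: eassoc_le => //; rewrite (mulrC 2) -mulrA ler_wpM2l//; lra.
by apply: ler_peMr; [exact/ltW/eassoc_gt0|exact: e1].
Qed.

Definition step_bound G := forall k, 0 < k -> exists2 c, 0 <= c & forall n t,
  `|G n.+1 t| * eassoc A (k * `|t|) * k ^+ n <= c * (M n)%:num.

(** The mean value theorem bounds the window by values of [G n.+1] within distance 1, so only
    derivatives of the step enter, and these decay. *)
Lemma window_bound G : is_jet G -> step_bound G -> forall k, 0 < k ->
  exists2 c, 0 <= c & jbd M k (fun t => eassoc A (k * `|t|)) c (window G).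
Proof.
move=> jG bG k k0; have k20 : 0 < 2 * k by rewrite mulr_gt0.
have [c c0 H] := bG _ k20.
have E0 : 0 < eassoc A (2 * k * 1) by exact: eassoc_gt0.
exists (c * eassoc A (2 * k * 1)); first by rewrite mulr_ge0// ltW.
move=> n s; set g := eassoc A (k * `|s|).
have g0 : 0 < g by exact: eassoc_gt0.
have gk : 0 < g * k ^+ n by rewrite mulr_gt0 ?exprn_gt0.
rewrite -mulrA -ler_pdivlMr//; set K := (X in _ <= X).
have := @MVT_dist R (G n) (G n.+1) s (s + 1) K (jG n).
have -> : s + 1 - s = 1 by ring.
rewrite normr1 mulr1; apply => r rs.
rewrite /K ler_pdivlMr//.
have sr : `|s| <= `|r| + 1.
  have -> : s = r - (r - s) by ring.
  by apply: le_trans (ler_normB _ _) _; rewrite lerD2l.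
have := eassoc_split (ltW k0) (normr_ge0 s) (normr_ge0 r) ler01 sr.
have := H n r; rewrite -/g.
have kn : k ^+ n <= (2 * k) ^+ n.
  by rewrite lerXn2r ?nnegrE ?(ltW k0) ?(ltW k20)// mulr_natl mulr2n lerDl ltW.
have kn0 : 0 <= k ^+ n by rewrite exprn_ge0// ltW.
move: E0 (eassoc_gt0 A (2 * k * `|r|)).
move: (eassoc A (2 * k * 1)) (eassoc A (2 * k * `|r|)) => E E' E0 E'0 HG gE.
apply: (@le_trans _ _ (`|G n.+1 r| * (E' * E * (2 * k) ^+ n))).
  by apply: ler_wpM2l => //; apply: ler_pM => //; exact: ltW.
have -> : `|G n.+1 r| * (E' * E * (2 * k) ^+ n) = `|G n.+1 r| * E' * (2 * k) ^+ n * E by ring.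
have -> : c * E * (M n)%:num = c * (M n)%:num * E by ring.
by rewrite ler_pM2r.
Qed.

Definition step_limits G := (forall t, 0 <= G 0%N t <= 1) /\
  forall e, 0 < e -> exists r, forall t : R,
      (r <= t -> 1 - e <= G 0%N t) /\ (t <= - r -> G 0%N t <= e).

(** From [M 1 * M p <= M 0 * M p.+1]: the order of the derivative and the index of [M] agree
    again. *)
Lemma step_bound_ge1 G : step_bound G -> forall k, 0 < k -> exists2 c, 0 <= c &
  forall p t, `|G p.+1 t| * k ^+ p.+1 <= c * (M p.+1)%:num / eassoc A (k * `|t|).
Proof.
move=> bG k k0; have [c c0 H] := bG _ k0.
exists (c * k * ((M 0)%:num / (M 1)%:num)).
  by rewrite !mulr_ge0// ltW.
move=> p t; rewrite ler_pdivlMr; last exact: eassoc_gt0.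
have := H p t; move: (eassoc A _) (eassoc_gt0 A (k * `|t|)) => E E0 {}H.
have -> : `|G p.+1 t| * k ^+ p.+1 * E = k * (`|G p.+1 t| * E * k ^+ p) by rewrite exprS; ring.
have -> : c * k * ((M 0)%:num / (M 1)%:num) * (M p.+1)%:num =
   k * (c * ((M 0)%:num * (M p.+1)%:num / (M 1)%:num)) by field.
rewrite ler_pM2l//; apply: le_trans H _; apply: ler_wpM2l => //.
by rewrite ler_pdivlMr// mulrC; have := sub_mult M1_M 1 p; rewrite add1n.
Qed.

Lemma cocutoff_bound G : step_bound G -> step_limits G -> forall k, 0 < k ->
  exists2 c, 0 <= c & forall n, jbd M k (fun=> 1) c (cocutoff G n).
Proof.
move=> bG [G01 _] k k0; have [c c0 H] := step_bound_ge1 bG k0.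
exists (2 / (M 0)%:num + 2 * c); first by rewrite addr_ge0 ?mulr_ge0.
move=> n p t; rewrite mulr1 /cocutoff; case: p => [|p].
  rewrite !expr0 !mul1r mulr1; apply: (@le_trans _ _ 2).
    have := G01 (n%:R + -1 * t); have := G01 (- n%:R + -1 * t).
    move: (G _ _) (G _ _) => a b /andP[a0 a1] /andP[b0 b1].
    rewrite ler_norml; apply/andP; split; lra.
  by rewrite mulrDl divfK// lerDl !mulr_ge0.
rewrite sub0r normrN -mulrBr normrM normrX normrN1 expr1n mul1r.
have h s : `|G p.+1 s| * k ^+ p.+1 <= c * (M p.+1)%:num.
  apply: le_trans (H p s) _; rewrite ler_pdivrMr ?eassoc_gt0//.
  by apply: ler_peMr; [rewrite mulr_ge0|apply: eassoc_ge1; rewrite // mulr_ge0// ltW].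
apply: (@le_trans _ _ ((`|G p.+1 (n%:R + -1 * t)| + `|G p.+1 (- n%:R + -1 * t)|) * k ^+ p.+1)).
  by rewrite ler_wpM2r ?ler_normB// exprn_ge0// ltW.
rewrite mulrDl; apply: le_trans (lerD (h _) (h _)) _.
rewrite [leLHS](_ : _ = 2 * c * (M p.+1)%:num); last by ring.
by rewrite ler_wpM2r// lerDr divr_ge0.
Qed.

(* On [|t| <= n/2] the tails of [G] are small; beyond, the weight [1/(1+|t|)] is. *)
Lemma cocutoff_small G : step_bound G -> step_limits G -> forall k e, 0 < k -> 0 < e ->
  exists N, forall n, (N <= n)%N -> jbd M k (fun t => (1 + `|t|)^-1) e (cocutoff G n).
Proof.
move=> bG lG k e k0 e0; have [c c0 Hc] := cocutoff_bound bG lG k0.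
have [b b0 Hb] := step_bound_ge1 bG k0.
have [G01 Glim] := lG.
have e1 : 0 < e * (M 0)%:num / 2 by rewrite divr_gt0 ?mulr_gt0.
have [r Hr] := Glim _ e1.
(* The term of index 1 of the exponential weight shows that beyond [K] the derivatives of [G],
   relative to [M], are below [e / 2]. *)
pose K := 2 * b * (A 1)%:num / ((A 0)%:num * k * e).
have [N HN] := archi_nat (2 * (Num.max r (Num.max K (c / e)))).
have N2 : Num.max r (Num.max K (c / e)) <= N%:R / 2 by rewrite ler_pdivlMr// mulrC.
have [rN [KN cN]] : r <= N%:R / 2 /\ K <= N%:R / 2 /\ c / e <= N%:R / 2.
  by move: N2; rewrite !ge_max => /and3P[].
exists N => n Nn p t.
have Nn2 : N%:R / 2 <= n%:R / 2 :> R by rewrite ler_pM2r// ler_nat.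
have t1 : 0 < 1 + `|t| by rewrite ltr_pwDl.
have [tn|tn] := leP (n%:R / 2) `|t|.
  rewrite mulrAC ler_pdivrMr//; have := Hc n p t; rewrite mulr1 => /le_trans; apply.
  rewrite mulrAC ler_wpM2r//; have : c / e <= `|t| by rewrite (le_trans cN)// (le_trans Nn2).
  rewrite ler_pdivrMr// => h; rewrite mulrDr mulr1 (mulrC e); lra.
have ti : (1 + `|t|)^-1 <= 1 by rewrite invf_le1// lerDl.
have tp : t <= `|t| by exact: ler_norm.
have tm : - `|t| <= t by rewrite lerNl -normrN ler_norm.
have s1 : n%:R / 2 <= n%:R + -1 * t by lra.
have s2 : - n%:R + -1 * t <= - (n%:R / 2) by lra.
suff H : `|cocutoff G n p t| * k ^+ p <= e * (M p)%:num.
  by apply: le_trans H; rewrite -mulrA ler_wpM2l// ler_piMl// exprn_ge0// ltW.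
rewrite /cocutoff; case: p => [|p].
  rewrite !expr0 !mul1r mulr1.
  have [/(_ (le_trans rN (le_trans Nn2 s1))) h1 _] := Hr (n%:R + -1 * t).
  have [_ h2] := Hr (- n%:R + -1 * t).
  have {}h2 : G 0%N (- n%:R + -1 * t) <= e * (M 0)%:num / 2.
    by apply: h2; apply: le_trans s2 _; rewrite lerN2; lra.
  have := G01 (n%:R + -1 * t); have := G01 (- n%:R + -1 * t); move: h1 h2.
  move: (G _ _) (G _ _) => x y h1 h2 /andP[y0 y1] /andP[x0 x1].
  rewrite ler_norml; apply/andP; split; lra.
rewrite sub0r normrN -mulrBr normrM normrX normrN1 expr1n mul1r.
have h s : n%:R / 2 <= `|s| -> `|G p.+1 s| * k ^+ p.+1 <= e / 2 * (M p.+1)%:num.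
  move=> ns; apply: le_trans (Hb p s) _; rewrite mulrAC ler_wpM2r//.
  rewrite ler_pdivrMr; last exact: eassoc_gt0.
  have ks : 0 <= k * `|s| by rewrite mulr_ge0// ltW.
  have := eassoc_pow wA 1 ks; rewrite expr1 => hA.
  have {hA} : e * (k * `|s| * (A 0)%:num / (A 1)%:num) <= e * eassoc A (k * `|s|).
    by rewrite ler_wpM2l// ltW.
  have : K <= `|s| by rewrite (le_trans KN)// (le_trans Nn2).
  rewrite /K ler_pdivrMr ?mulr_gt0// mulrA ler_pdivrMr//.
  have -> : e * (k * `|s| * (A 0)%:num) = `|s| * ((A 0)%:num * k * e) by ring.
  move=> h1 h2; have := le_trans h1 h2; rewrite ler_pM2r// mulrAC.
  lra.
apply: (@le_trans _ _ ((`|G p.+1 (n%:R + -1 * t)| + `|G p.+1 (- n%:R + -1 * t)|) * k ^+ p.+1)).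
  by rewrite ler_wpM2r ?ler_normB// exprn_ge0// ltW.
rewrite mulrDl; apply: le_trans (lerD (h _ _) (h _ _)) _.
- by apply: le_trans s1 (ler_norm _).
- by rewrite -normrN; apply: le_trans (ler_norm _); rewrite lerNr.
- by rewrite -mulrDl -splitr.
Qed.

End Jets.

(** * Tensor products over the coordinates *)

Section CoordinateProducts.
Context {R : realType} {d : nat} {M A : nat -> {posnum R}}.
Hypotheses (wA : weight_seq A) (M1_M : M1 M).
Local Notation V := 'rV[R]_d.
Local Notation F := (V -> R[i]^o).

Definition fcst (a : R[i]) : F := fun=> a.

Lemma pderivs_cst (a : R[i]) : smooth (fcst a) /\
  forall s, pderivs s (fcst a) = fcst (if s is [::] then a else 0).
Proof.
apply: (@smooth_family R d (fun s => fcst (if s is [::] then a else 0))) => [s|s i].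
  exact: cst_continuous.
apply/ispdP => x e e0; exists 1 => // h _.
by rewrite subrr mulr0 subrr Normc.normc0 mulr_ge0// ltW.
Qed.

(** The list of coordinates is a parameter so that bounds can be proved by induction on it. *)
Definition coord_prod (J : 'I_d -> nat -> R -> R) (r : seq 'I_d) : F :=
  \big[fmul/(fcst 1)]_(i <- r) clift i (J i).

Lemma coord_prodE J r x : coord_prod J r x = \prod_(i <- r) (J i 0%N (x ord0 i))%:C%C.
Proof.
rewrite /coord_prod; elim: r => [|i r IH]; first by rewrite !big_nil.
by rewrite !big_cons /fmul IH.
Qed.

Lemma ubd_cst (k : R) : 0 < k -> ubd M k (fun=> 1) (M 0)%:num^-1 (fcst 1).
Proof.
move=> k0 s x; have [_ ->] := pderivs_cst 1; rewrite /fcst; case: s => [|i s].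
  by rewrite Normc.normc1 !mul1r mulVf.
by rewrite Normc.normc0 !mul0r mulr_ge0.
Qed.

(** Each multiplication halves the parameter, which is affordable because every factor is bounded
    for all [k]. *)
Lemma coord_prod_ubd (J : 'I_d -> nat -> R -> R) (w : R -> R -> R) (r : seq 'I_d) :
  (forall i, is_jet (J i)) -> (forall k t, 0 <= w k t) ->
  (forall k k' t, 0 < k -> k <= k' -> w k t <= w k' t) ->
  (forall i k, 0 < k -> exists2 c, 0 <= c & jbd M k (w k) c (J i)) ->
  smooth (coord_prod J r) /\ forall k, 0 < k -> exists2 c, 0 <= c &
    ubd M k (fun x => \prod_(i <- r) w k (x ord0 i)) c (coord_prod J r).
Proof.
move=> jJ w0 wle HJ; rewrite /coord_prod; elim: r => [|i r [sr IH]].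
  rewrite big_nil; split; first by have [] := pderivs_cst 1.
  move=> k k0; exists (M 0)%:num^-1; first by [].
  by under eq_fun do rewrite big_nil; exact: ubd_cst.
have [sl _] := pderivs_lift i (jJ i).
rewrite big_cons; split; first by have [] := leibniz sl sr.
move=> k k0; have k20 : 0 < 2 * k by rewrite mulr_gt0.
have k2 : k <= 2 * k by rewrite mulr_natl mulr2n lerDl ltW.
have [a a0 Ha] := HJ i _ k20; have [b b0 Hb] := IH _ k20.
have w0' (x : V) : 0 <= \prod_(j <- r) w (2 * k) (x ord0 j) by apply: prodr_ge0.
have := ubd_mul M1_M k20 (fun x => w0 _ _) w0' sl sr (ubd_lift i (jJ i) a0 Ha) Hb.
move=> H; exists (a * b * (M 0)%:num); first by rewrite !mulr_ge0.
apply: ubd_le H => //; first by rewrite mulrC mulKf// lexx (ltW k0).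
move=> x; rewrite big_cons; apply/andP; split; first by rewrite mulr_ge0// prodr_ge0.
by apply: ler_pM; rewrite ?prodr_ge0 ?wle// ler_prod// => j _; rewrite w0 wle.
Qed.

(** The norm is at most [d] times the largest coordinate, and the factors of the other coordinates
    are at least 1. *)
Lemma gsw_le_prod (h : R) (x : V) : 0 <= h ->
  gsw A h x <= \prod_i eassoc A (h * d%:R * `|x ord0 i|).
Proof.
move=> h0; have hd : 0 <= h * d%:R by rewrite mulr_ge0.
have e1 i : 1 <= eassoc A (h * d%:R * `|x ord0 i|) by apply: eassoc_ge1; rewrite // mulr_ge0.
have p1 (P : pred 'I_d) : 1 <= \prod_(i | P i) eassoc A (h * d%:R * `|x ord0 i|).
  have m1 (a b : R) : 1 <= a -> 1 <= b -> 1 <= a * b.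
    by move=> a1 b1; apply: (le_trans a1 (ler_peMr _ b1)); exact: le_trans ler01 a1.
  exact: (@big_ind R (fun z => 1 <= z) 1 *%R (lexx _) m1 _ _ _ _ (fun i _ => e1 i)).
apply: (@le_trans _ _ (eassoc A (h * d%:R * `|x|))).
  by apply: eassoc_le; rewrite // ?mulr_ge0 ?enorm_ge0// -mulrA ler_wpM2l// enorm_le.
have [x0|x0] := eqVneq `|x| 0.
  by rewrite x0 mulr0 /eassoc /assoc_fun eqxx expR0.
have [[j i] /= xi] : exists ij, mx_norm x = `|x ij.1 ij.2| by exact: mx_norm_neq0.
rewrite [`|x|]/Num.Def.normr/= xi (ord1 j) (bigD1 i)//=.
by apply: ler_peMr; [exact/ltW/eassoc_gt0|exact: p1].
Qed.

Lemma ubd_scale (k k' C c : R) (w w' : V -> R) phi : 0 <= k' <= k -> 0 <= C ->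
  (forall x, 0 <= w' x <= C * w x) -> ubd M k w c phi -> ubd M k' w' (C * c) phi.
Proof.
move=> kk C0 ww H; apply: (ubd_le kk ww (lexx _)) => s x.
rewrite mulrCA -!mulrA ler_wpM2l// !mulrA; exact: H.
Qed.

Variable G : 'I_d -> nat -> R -> R.
Hypotheses (jG : forall i, is_jet (G i)) (bG : forall i, step_bound M A (G i)).
Hypothesis lG : forall i, step_limits (G i).

Definition lattice_window : F := coord_prod (fun i => window (G i)) (index_enum 'I_d).

Lemma lattice_window_gsb h : 0 < h -> exists b, gsb M A h b lattice_window.
Proof.
move=> h0; have [sb] := @coord_prod_ubd (fun i => window (G i)) (fun k t => eassoc A (k * `|t|))
  (index_enum 'I_d) (fun i => jet_window (jG i)) (fun k t => ltW (eassoc_gt0 A _))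
  (fun k k' t k0 kk => eassoc_le wA (mulr_ge0 (ltW k0) (normr_ge0 t)) (ler_wpM2r (normr_ge0 t) kk))
  (fun i => window_bound wA (jG i) (bG i)).
(* [d.+1] in place of [d] keeps the parameter positive in dimension 0. *)
have hd : 0 < h * d.+1%:R by rewrite mulr_gt0.
move=> /(_ _ hd)[c c0 Hc]; exists c; split; first exact: sb.
have h1 : h <= h * d.+1%:R by rewrite ler_peMr ?(ltW h0)// ler1n.
apply: ubd_le Hc => //; first by rewrite (ltW h0).
move=> x; rewrite gsw_ge0/=; apply: le_trans (gsw_le_prod x (ltW h0)) _.
apply: ler_prod => i _; apply/andP; split; first exact/ltW/eassoc_gt0.
apply: eassoc_le => //; first by rewrite !mulr_ge0// ltW.
by rewrite ler_wpM2r// ler_wpM2l ?(ltW h0)// ler_nat.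
Qed.

Definition cutoff (n : nat) : F :=
  coord_prod (fun i p t => (if p is 0%N then 1 else 0) - cocutoff (G i) n p t) (index_enum 'I_d).

Lemma jet_cutoff n i : is_jet (fun p t => (if p is 0%N then 1 else 0) - cocutoff (G i) n p t).
Proof. by apply: jet_sub; [exact: jet_cst|exact: jet_cocutoff]. Qed.

Lemma cutoff_bound i k : 0 < k -> exists2 c, 0 <= c & forall n, jbd M k (fun=> 1) c
  (fun p t => (if p is 0%N then 1 else 0) - cocutoff (G i) n p t).
Proof.
move=> k0; have [c c0 H] := cocutoff_bound wA M1_M (bG i) (lG i) k0.
exists ((M 0)%:num^-1 + c); first by rewrite addr_ge0.
move=> n p t; rewrite mulr1 mulrDl.
apply: le_trans (ler_wpM2r _ (ler_normB _ _)) _; first by rewrite exprn_ge0// ltW.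
rewrite mulrDl; apply: lerD; last by have := H n p t; rewrite mulr1.
case: p => [|p]; first by rewrite normr1 expr0 mul1r mulVf.
by rewrite normr0 mul0r mulr_ge0.
Qed.

(** Induction over the coordinates with [1 - a P = (1 - a) + a (1 - P)]: the first term is small by
    [cocutoff_small], the second by induction, as [a] is bounded uniformly in [n]. *)
Lemma cutoff_small k e : 0 < k -> 0 < e -> exists N, forall n, (N <= n)%N ->
  ubd M k (fun x => (1 + `|x|)^-1) e ((fcst 1) - cutoff n) /\ smooth (cutoff n).
Proof.
rewrite /cutoff /coord_prod; elim: (index_enum _) k e => [|i r IH] k e k0 e0.
  exists 0%N => n _; rewrite big_nil subrr; split.
    by move=> s x; rewrite pderivs0 Normc.normc0 !mul0r mulr_ge0// ltW.
  by have [] := pderivs_cst 1.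
have k20 : 0 < 2 * k by rewrite mulr_gt0.
have k2 : k <= 2 * k by rewrite mulr_natl mulr2n lerDl ltW.
have [a a0 Ha] := cutoff_bound i k20.
have D0 : 0 < a * (M 0)%:num + 1 by rewrite ltr_wpDl// mulr_ge0.
pose e' := e / 2 / (a * (M 0)%:num + 1).
have e'0 : 0 < e' by rewrite !divr_gt0.
have [N HN] := IH _ _ k20 e'0.
have e20 : 0 < e / 2 by rewrite divr_gt0.
have [K HK] := cocutoff_small wA M1_M (bG i) (lG i) k0 e20.
exists (maxn N K) => n; rewrite geq_max => /andP[/HN[bP sP] /HK bi].
rewrite big_cons; move: (\big[_/_]_(_ <- r) _) bP sP => P bP sP.
have [sl _] := pderivs_lift i (jet_cutoff n i).
have [sP' _] := leibniz sl sP.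
split => //.
have s1 : smooth (fcst 1) by have [] := @pderivs_cst 1.
set a_ := clift i _ in sl sP' *.
have -> : (fcst 1) - fmul a_ P = clift i (cocutoff (G i) n) + fmul a_ ((fcst 1) - P).
  apply/funext => x; change (1 - a_ x * P x = (cocutoff (G i) n 0 (x ord0 i))%:C%C + a_ x * (1 - P x)).
  rewrite /a_ /clift rmorphB/= rmorph1; move: (cocutoff _ _ _ _)%:C%C (P x) => X Y; ring.
have w0 (x : V) : 0 <= (1 + `|x|)^-1 by [].
have slc : smooth (clift i (cocutoff (G i) n)) by have [] := pderivs_lift i (jet_cocutoff n (jG i)).
have sPc := smoothB s1 sP.
have [sfm _] := leibniz sl sPc.
rewrite (splitr e); apply: ubdD => //; first exact: ltW.
  have := ubd_lift i (jet_cocutoff n (jG i)) (ltW e20) bi.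
  apply: ubd_le => //; first by rewrite (ltW k0) lexx.
  move=> x; rewrite w0/= lef_pV2 ?posrE ?ltr_pwDl//.
  by rewrite lerD2l norm_coord.
have := ubd_mul M1_M k20 (fun=> ler01) w0 sl sPc (ubd_lift i (jet_cutoff n i) a0 (Ha n)) bP.
apply: ubd_le => //; first by rewrite mulrC mulKf// lexx (ltW k0).
  by move=> x; rewrite mul1r lexx w0.
rewrite /e' mulrAC mulrA ler_pdivrMr//; rewrite mulrC ler_wpM2l ?(ltW e20)// lerDl//.
Qed.

End CoordinateProducts.

(** * Summation over the integer lattice *)

Section Lattice.
Context {R : realType} {d : nat}.
Local Notation V := 'rV[R]_d.
Local Notation F := (V -> R[i]^o).

Lemma coord_le_enorm (x : V) i : `|x ord0 i| <= enorm x.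
Proof.
rewrite -sqrtr_sqr ler_sqrt ?sumr_ge0// => [|j _]; last exact: sqr_ge0.
by rewrite (bigD1 i)//= lerDl sumr_ge0// => j _; exact: sqr_ge0.
Qed.

Lemma norm_le_enorm (x : V) : `|x| <= enorm x.
Proof. by apply: norm_le_coord; [exact: enorm_ge0|exact: coord_le_enorm]. Qed.

(** Two uses of the decay condition give the power [- 2 (d + 1)] of the norm, enough against the
    [2 d] powers of the product outside a ball; inside, the product is bounded below. *)
Lemma weight_decay2 (W : nat -> V -> {posnum R}) : incr_weight_system W -> weight_decay W ->
  forall N, exists L, exists2 C, 0 <= C & forall x,
    nweight (W N) x <= C * nweight (W L) x * \prod_i ((1 + `|x ord0 i|) ^+ 2)^-1.
Proof.
move=> incrW decayW N; have [K NK [C1 [r1 H1]]] := decayW N.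
have [L KL [C2 [r2 H2]]] := decayW K.
pose r := `|r1| + `|r2| + 1; have r0 : 0 <= r by rewrite !addr_ge0.
exists L, (`|C1| * `|C2| * 4 ^+ d + ((1 + r) ^+ 2) ^+ d).
  by rewrite addr_ge0 ?mulr_ge0 ?exprn_ge0// addr_ge0.
move=> x; set P := \prod_i (1 + `|x ord0 i|) ^+ 2.
have P0 : 0 < P by apply: prodr_gt0 => i _; rewrite exprn_gt0// ltr_pwDl.
rewrite prodfV ler_pdivlMr//.
have Ple (a : R) : (forall i, 1 + `|x ord0 i| <= a) -> P <= (a ^+ 2) ^+ d.
  move=> xa; apply: (@le_trans _ _ (\prod_(i < d) a ^+ 2)); last by rewrite prodr_const card_ord.
  apply: ler_prod => i _; rewrite exprn_ge0 ?addr_ge0//= lerXn2r ?nnegrE ?addr_ge0//.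
  by apply: le_trans (xa i); rewrite addr_ge0.
have wNL : nweight (W N) x <= nweight (W L) x.
  by apply: incr_weight_le => //; rewrite ltnW// (ltn_trans NK).
have wL0 : 0 < nweight (W L) x by rewrite /nweight.
have wN0 : 0 < nweight (W N) x by rewrite /nweight.
have wK0 : 0 < nweight (W K) x by rewrite /nweight.
have [xr|rx] := leP (enorm x) r.
  apply: (@le_trans _ _ (nweight (W L) x * ((1 + r) ^+ 2) ^+ d)).
    apply: ler_pM => //; [exact: ltW|exact: ltW|].
    by apply: Ple => i; rewrite lerD2l (le_trans _ xr)// coord_le_enorm.
  by rewrite mulrC ler_wpM2r ?(ltW wL0)// lerDr !mulr_ge0 ?exprn_ge0.
have e1 : 1 <= enorm x by apply: le_trans (ltW rx); rewrite /r lerDr addr_ge0.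
have e0 : 0 < enorm x by exact: lt_le_trans e1.
have r1x : r1 < enorm x.
  by apply: le_lt_trans rx; rewrite /r -addrA (le_trans (ler_norm _))// lerDl addr_ge0.
have r2x : r2 < enorm x.
  by apply: le_lt_trans rx; rewrite /r addrAC (le_trans (ler_norm _))// lerDr addr_ge0.
have := H1 _ r1x; have := H2 _ r2x; rewrite -/(nweight _ _) -/(nweight _ _) -/(nweight (W N) x).
set E := enorm x ^- d.+1; have E0 : 0 < E by rewrite invr_gt0 exprn_gt0.
rewrite !ler_pdivrMr// => h2 h1.
have {}h1 : nweight (W N) x <= `|C1| * E * nweight (W K) x.
  by apply: le_trans h1 _; rewrite ler_wpM2r ?(ltW wK0)// ler_wpM2r ?(ltW E0)// ler_norm.
have {}h2 : nweight (W K) x <= `|C2| * E * nweight (W L) x.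
  by apply: le_trans h2 _; rewrite ler_wpM2r ?(ltW wL0)// ler_wpM2r ?(ltW E0)// ler_norm.
have PE : P * E * E <= 4 ^+ d.
  apply: (@le_trans _ _ (((2 * enorm x) ^+ 2) ^+ d * E * E)).
    rewrite !ler_wpM2r ?(ltW E0)//; apply: Ple => i.
    by rewrite mulr_natl mulr2n lerD// coord_le_enorm.
  rewrite (_ : ((2 * enorm x) ^+ 2) ^+ d = 4 ^+ d * (enorm x ^+ d * enorm x ^+ d)); last first.
    by rewrite (_ : (2 * enorm x) ^+ 2 = 4 * (enorm x * enorm x)) ?exprMn//; ring.
  rewrite -!mulrA ler_piMr ?exprn_ge0//.
  rewrite (_ : _ * _ = (enorm x)^-1 ^+ 2) ?exprn_ile1 ?invr_ge0 ?(ltW e0)// ?invf_le1//.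
  have en : enorm x != 0 by rewrite gt_eqF.
  have ed : enorm x ^+ d != 0 by rewrite expf_neq0.
  rewrite /E exprSr; move: (enorm x ^+ d) ed => q q0.
  by field; rewrite q0 en.
apply: (@le_trans _ _ (`|C1| * E * (`|C2| * E * nweight (W L) x) * P)).
  rewrite ler_wpM2r ?(ltW P0)//; apply: le_trans h1 _.
  by apply: ler_wpM2l => //; rewrite mulr_ge0// ltW.
rewrite (_ : _ * P = `|C1| * `|C2| * (P * E * E) * nweight (W L) x); last by ring.
rewrite ler_wpM2r ?(ltW wL0)//; apply: (@le_trans _ _ (`|C1| * `|C2| * 4 ^+ d)).
  by apply: ler_wpM2l => //; rewrite mulr_ge0.
by rewrite lerDl !exprn_ge0// addr_ge0.
Qed.

(* 0, -1, 1, -2, 2, ... *)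
Definition int_enum (j : nat) : R := if odd j then - (j./2.+1)%:R else (j./2)%:R.

Lemma int_enum_even n : int_enum n.*2 = n%:R.
Proof. by rewrite /int_enum odd_double doubleK. Qed.

Lemma int_enum_odd n : int_enum n.*2.+1 = - n.+1%:R.
Proof. by rewrite /int_enum /= odd_double/= uphalf_double. Qed.

(** The first [2 n] integers of the enumeration are exactly those from [- n] to [n - 1]. *)
Lemma int_enum_telescope (g : R -> R) (x : R) n :
  \sum_(j < n.*2) (g (int_enum j - x + 1) - g (int_enum j - x)) = g (n%:R - x) - g (- n%:R - x).
Proof.
elim: n => [|n IH]; first by rewrite big_ord0 oppr0 subrr.
rewrite doubleS !big_ord_recr/= IH int_enum_even int_enum_odd -natr1.
have -> : n%:R - x + 1 = n%:R + 1 - x by ring.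
have -> : - (n%:R + 1) - x + 1 = - n%:R - x by ring.
by ring.
Qed.

Definition lat_weight (j : nat) : R := ((1 + `|int_enum j|) ^+ 2)^-1.

Lemma lat_weight_ge0 j : 0 <= lat_weight j.
Proof. by rewrite invr_ge0 exprn_ge0// addr_ge0. Qed.

(** Induction on the sharper bound [3 - 3 / (n + 1)]; the two new terms sum to at most
    [3 / ((n + 1) (n + 2))]. *)
Lemma lat_weight_sum n : \sum_(j < n.*2) lat_weight j <= 3.
Proof.
suff H : \sum_(j < n.*2) lat_weight j <= 3 - 3 / n.+1%:R.
  by apply: le_trans H _; rewrite gerBl divr_ge0.
elim: n => [|n IH]; first by rewrite big_ord0 divr1 subrr.
rewrite doubleS !big_ord_recr/= /lat_weight int_enum_even int_enum_odd normrN !ger0_norm//.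
have n1 : n.+1%:R = n%:R + 1 :> R by rewrite natr1.
rewrite n1 in IH *.
have -> : n.+2%:R = n%:R + 2 :> R by rewrite -addn2 natrD.
move: IH; rewrite /lat_weight.
have : 0 <= n%:R :> R by [].
move: (\sum_(i < n.*2) _) (n%:R) => s a a0 IH.
have a1 : 0 < a + 1 by lra.
have a2 : 0 < a + 2 by lra.
have a3 : 0 < 1 + (a + 1) by lra.
have h1 : ((1 + a) ^+ 2)^-1 <= 2 * ((a + 1) * (a + 2))^-1.
  rewrite ler_pdivlMr ?mulr_gt0// mulrC ler_pdivrMr ?exprn_gt0 ?(addrC 1)//; nra.
have h2 : ((1 + (a + 1)) ^+ 2)^-1 <= ((a + 1) * (a + 2))^-1.
  have q1 : 0 < (a + 1) * (a + 2) by rewrite mulr_gt0.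
  have q2 : 0 < (1 + (a + 1)) ^+ 2 by rewrite exprn_gt0.
  rewrite lef_pV2 ?posrE//.
  rewrite (_ : (1 + (a + 1)) ^+ 2 = (a + 1) * (a + 2) + (a + 2)); last by ring.
  by rewrite lerDl ltW.
have E : 3 - 3 / (a + 2) = 3 - 3 / (a + 1) + 3 * ((a + 1) * (a + 2))^-1.
  by field; rewrite !gt_eqF.
rewrite E; lra.
Qed.

(** Each coordinate runs over the first [2 (n + 1)] integers of the enumeration. The offset keeps
    the ordinals inhabited and explains [cutoff G n.+1] below. *)
Definition box_sum (U : nmodType) n (a : ('I_d -> nat) -> U) : U :=
  \sum_(f : {ffun 'I_d -> 'I_(n.*2.+2)}) a (fun i => f i : nat).

Lemma box_sum_sub (U : nmodType) n m (a : ('I_d -> nat) -> U) : (n <= m)%N ->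
  box_sum n a = \sum_(f : {ffun 'I_d -> 'I_(m.*2.+2)} | [forall i, (f i < n.*2.+2)%N])
    a (fun i => f i : nat).
Proof.
move=> nm; have nm2 : (n.*2.+2 <= m.*2.+2)%N by rewrite !ltnS leq_double.
pose h (f : {ffun 'I_d -> 'I_(n.*2.+2)}) : {ffun 'I_d -> 'I_(m.*2.+2)} := [ffun i => inord (f i)].
pose h' (f : {ffun 'I_d -> 'I_(m.*2.+2)}) : {ffun 'I_d -> 'I_(n.*2.+2)} := [ffun i => inord (f i)].
have hE f i : h f i = f i :> nat by rewrite ffunE inordK// (leq_trans (ltn_ord _)).
rewrite (reindex_onto h h') => [|f /forallP fn]; last first.
  by apply/ffunP => i; apply: ord_inj; rewrite hE ffunE inordK.
apply/esym; apply: eq_big => [f|f _].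
  rewrite (introT forallP) => [|i]; last by rewrite hE ltn_ord.
  by apply/eqP/ffunP => i; apply: ord_inj; rewrite ffunE inordK hE ?ltn_ord.
by congr a; apply/funext => i; exact: hE.
Qed.

Lemma box_sum_diff n m (a : ('I_d -> nat) -> R[i]) (b : ('I_d -> nat) -> R) : (n <= m)%N ->
  (forall k, Normc.normc (a k) <= b k) ->
  Normc.normc (box_sum m a - box_sum n a) <= box_sum m b - box_sum n b.
Proof.
move=> nm ab; rewrite !(box_sum_sub _ nm).
have E (U : zmodType) (c : ('I_d -> nat) -> U) : box_sum m c -
   \sum_(f : {ffun 'I_d -> 'I_(m.*2.+2)} | [forall i, (f i < n.*2.+2)%N]) c (fun i => f i : nat) =
   \sum_(f : {ffun 'I_d -> 'I_(m.*2.+2)} | ~~ [forall i, (f i < n.*2.+2)%N]) c (fun i => f i : nat).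
  by rewrite /box_sum (bigID (fun f : {ffun 'I_d -> 'I_(m.*2.+2)} => [forall i, (f i < n.*2.+2)%N]))/= addrAC subrr add0r.
rewrite !E; apply: le_trans (normc_sum _ _ _) _; exact: ler_sum.
Qed.

Lemma box_sum_prod (U : comNzRingType) n (b : 'I_d -> nat -> U) :
  box_sum n (fun k => \prod_i b i (k i)) = \prod_i \sum_(j < n.*2.+2) b i j.
Proof. by rewrite bigA_distr_bigA. Qed.

(** The box sums increase and factor into one-dimensional sums, hence are bounded by [3 ^+ d]. *)
Lemma box_weight_cauchy e : 0 < e -> exists N, forall n m, (N <= n)%N -> (n <= m)%N ->
  box_sum m (fun k => \prod_i lat_weight (k i)) - box_sum n (fun k => \prod_i lat_weight (k i)) <= e.
Proof.
move=> e0; pose s n := box_sum n (fun k => \prod_i lat_weight (k i)).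
have s_le n : s n <= 3 ^+ d.
  rewrite /s (@box_sum_prod _ n (fun _ => lat_weight)) prodr_const card_ord.
  rewrite lerXn2r ?nnegrE//; first by apply: sumr_ge0 => *; exact: lat_weight_ge0.
  exact: (lat_weight_sum n.+1).
have s_mono : nondecreasing_seq s.
  move=> n m nm; rewrite /s !(@box_sum_prod _ _ (fun _ => lat_weight)) !prodr_const card_ord.
  rewrite lerXn2r ?nnegrE//; try by apply: sumr_ge0 => *; exact: lat_weight_ge0.
  rewrite -!(big_mkord predT lat_weight) [leRHS](big_cat_nat (n := n.*2.+2))//=.
    by rewrite lerDl sumr_ge0// => *; exact: lat_weight_ge0.
  by rewrite !ltnS leq_double.
have bs : has_sup (range s).
  by split; [exists (s 0), 0%N|exists (3 ^+ d) => _ [n _ <-]].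
have [_ [N _ <-] HN] := sup_adherent e0 bs.
exists N => n m Nn nm; have h1 : s N <= s n by exact: s_mono.
have h2 : s m <= sup (range s) by apply: ub_le_sup; [exact: bs.2|exists m].
change (s m - s n <= e); lra.
Qed.

Lemma box_weight_le n : box_sum n (fun k => \prod_i lat_weight (k i)) <= 3 ^+ d.
Proof.
rewrite (@box_sum_prod _ n (fun _ => lat_weight)) prodr_const card_ord.
rewrite lerXn2r ?nnegrE//; first by apply: sumr_ge0 => *; exact: lat_weight_ge0.
exact: (lat_weight_sum n.+1).
Qed.

Lemma box_sum_scale n (D : R) (b : ('I_d -> nat) -> R) :
  box_sum n (fun k => D * b k) = D * box_sum n b.
Proof. by rewrite /box_sum mulr_sumr. Qed.

End Lattice.

(** * Recovering a functional from its convolutions *)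

Section Localization.
Context {R : realType} {d : nat} {M A : nat -> {posnum R}}.
Hypotheses (wA : weight_seq A) (M1_M : M1 M) (M2_A : M2 A).
Local Notation V := 'rV[R]_d.
Local Notation F := (V -> R[i]^o).
Variable chi : F.
Hypothesis chiP : forall h, 0 < h -> exists b, gsb M A h b chi.

(* [refl_trans t (theta t phi)] is [phi] times the window [chi (t - x)] centred at [t]. *)
Definition theta (t : V) (phi : F) : F := fmul (refl_trans t phi) chi.

(** Admissibility bounds [1 / wK (t - y)] by [gsw A lambda y / wL t] up to a constant, so the
    reflected [phi] has size [1 / wL t] with exponential growth in [y]; the decay of [chi] absorbs
    this growth. *)
Lemma theta_gsb (k lambda : R) : 0 < k -> 0 < lambda -> exists2 C, 0 <= C &
  forall (wL wK : V -> R) (Ca B : R) (phi : F) (t : V), 0 < Ca -> (forall x, 0 < wL x) ->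
    (forall x, 0 <= wK x) ->
    (forall x y, wL (x + y) <= Ca * wK x * gsw A lambda y) ->
    smooth phi -> ubd M k wK B phi -> gsb M A (k / 2) (C * Ca * B / wL t) (theta t phi).
Proof.
move=> k0 la0; have [C2 [H [C21 H1 CH]]] := eassoc_sqr wA M2_A.
have C20 : 0 <= C2 by rewrite (le_trans ler01).
have H0 : 0 < H by exact: lt_le_trans H1.
(* [h] dominates both the growth to absorb and the weight to keep; by [eassoc_sqr], the weight at
   [H * h] covers their product. *)
pose h := Num.max (k / 2) lambda; have h0 : 0 < h by rewrite lt_max la0 orbT.
pose q := Num.max k (H * h); have q0 : 0 < q by rewrite lt_max k0.
have [b [schi bchi]] := chiP q0.
have b0 : 0 <= b by apply: ubd_ge0 bchi; exists 0; exact: gsw_ge0.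
exists (C2 * b * (M 0)%:num); first by rewrite !mulr_ge0.
move=> wL wK Ca B phi t Ca0 wL0 wK0 adm sphi bphi.
have B0 : 0 <= B by apply: ubd_ge0 bphi; exists 0.
have gl (y : V) : 0 < gsw A lambda y by exact: gsw_gt0.
have gl0 (y : V) : 0 <= (gsw A lambda y)^-1 by rewrite invr_ge0 ltW.
have K0 : 0 <= Ca / wL t by rewrite divr_ge0// ltW.
have br : ubd M k (fun y => (gsw A lambda y)^-1) (Ca / wL t * B) (refl_trans t phi).
  apply: (ubd_refl (ltW k0) K0 sphi _ bphi) => y.
  have := adm (t - y) y; rewrite subrK => H'.
  rewrite mulrAC ler_pdivlMr// ler_pdivrMl//; apply: le_trans H' _.
  by rewrite mulrC.
have bc : ubd M k (gsw A (H * h)) b chi.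
  apply: ubd_le bchi => //; first by rewrite (ltW k0) le_max lexx.
  move=> x; rewrite gsw_ge0/=; apply: gsw_le => //; first by rewrite mulr_ge0// ltW.
  by rewrite le_max lexx orbT.
have sr := smooth_refl t sphi.
have := ubd_mul M1_M k0 gl0 (fun y => gsw_ge0 A _ y) sr schi br bc.
move=> bt; split; first by have [] := leibniz sr schi.
have -> : C2 * b * (M 0)%:num * Ca * B / wL t = C2 * (Ca / wL t * B * b * (M 0)%:num) by ring.
apply: (ubd_scale _ C20 _ bt) => [|x]; first by rewrite lexx andbT divr_ge0// ltW.
rewrite gsw_ge0/= mulrCA ler_pdivlMl//.
have m1 : gsw A lambda x <= gsw A h x by apply: gsw_le; rewrite ?(ltW la0)// le_max lexx orbT.
have m2 : gsw A (k / 2) x <= gsw A h x by apply: gsw_le; rewrite ?divr_ge0 ?(ltW k0)// le_max lexx.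
apply: le_trans (gsw_mul x CH (ltW h0)).
exact: ler_pM (ltW (gl x)) (gsw_ge0 A _ x) m1 m2.
Qed.

Lemma theta_lin t a phi psi : theta t (a *: phi + psi) = a *: theta t phi + theta t psi.
Proof.
apply/funext => x; change ((a * phi (t - x) + psi (t - x)) * chi x =
  a * (phi (t - x) * chi x) + psi (t - x) * chi x); by rewrite mulrDl mulrA.
Qed.

End Localization.

Section Admissible.
Context {R : realType} {d : nat} {c : ultra_case} {M A : nat -> {posnum R}}.
Hypothesis wA : weight_seq A.
Local Notation V := 'rV[R]_d.
Variable W : nat -> V -> {posnum R}.
Hypothesis admW : admissible c A W.

(** The window decays at every rate, so a single admissible [la] is enough and both cases can be
    treated together. *)
Lemma admissible_exists L : exists (la : R) (K : nat) (Ca : R), [/\ 0 < la, 0 < Ca &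
  forall x t, nweight (W L) (x + t) <= Ca * nweight (W K) x * gsw A la t].
Proof.
have [la [K [la0 [Ca Ca0 adm]]]] : exists la K, 0 < la /\ admissible_bound A W L K la.
  move: admW; case: (c) => /= adm.
    by have [la la0 [K _ bd]] := adm L; exists la, K.
  by have [K _ bd] := adm L 1 ltr01; exists 1, K.
exists la, K, Ca; split; [exact: la0|exact: Ca0|move=> x t].
by have := adm x t; rewrite (enormZ _ (ltW la0)).
Qed.

Lemma GS_Bincr phi : lcs_set (GS d c M A) phi -> lcs_set (Bincr c M W) phi.
Proof.
move=> /(GSP _ _ _ wA) H; apply/BincrP; move: admW H; case: (c) => adm H.
  move=> h; split; first by have [b []] := H h.
  move=> N; have [la la0 [K _ bd]] := adm N.
  have m0 : 0 < Num.max h%:num la by rewrite lt_max la0 orbT.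
  have [b bp] := H (PosNum m0).
  have lm : la <= (PosNum m0)%:num by rewrite /= le_max lexx orbT.
  have [b' Hb'] := gsb_weight wA la0 lm bd bp; exists b'.
  apply: ubd_le Hb' => //; first by apply/andP; split => //; rewrite /= le_max lexx.
  by move=> x; rewrite lexx andbT /nweight.
have [h [b bp]] := H; exists h; split; first exact: proj1 bp.
have h0 : 0 < h%:num by [].
move=> N; have [K _ bd] := adm N h%:num h0.
exact: (gsb_weight wA h0 (lexx _) bd bp).
Qed.

End Admissible.

Lemma complex_lim_unique (R : realType) (z : nat -> R[i]) l l' :
  (forall e, 0 < e -> exists N, forall n, (N <= n)%N -> Normc.normc (z n - l) <= e) ->
  (forall e, 0 < e -> exists N, forall n, (N <= n)%N -> Normc.normc (z n - l') <= e) -> l = l'.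
Proof.
move=> zl zl'; apply/eqP; rewrite -subr_eq0; apply/eqP/Normc.eq0_normc/eqP.
rewrite eq_le normc_ge0 andbT; apply/ler_addgt0Pr => e e0; rewrite add0r.
have [N NP] := zl' _ e0; exact: normc_lim_le zl NP.
Qed.

(** * The functional defined by the lattice sum *)

Section Functional.
Context {R : realType} {d : nat} {c : ultra_case} {M A : nat -> {posnum R}}.
Hypotheses (wA : weight_seq A) (M1_M : M1 M) (M2_M : M2 M) (M2_A : M2 A).
Local Notation V := 'rV[R]_d.
Local Notation F := (V -> R[i]^o).
Local Notation S := (lcs_set (GS d c M A)).
Variable W : nat -> V -> {posnum R}.
Hypotheses (incrW : incr_weight_system W) (decayW : weight_decay W) (admW : admissible c A W).
Variable f : {linear GS d c M A -> R[i]^o}.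
Hypothesis f_cont : continuous f.
Hypothesis convf : conv_into f (Cdecr (dual_weights W)).
Local Notation BW := (lcs_set (Bincr c M W)).
Variable chi : F.
Hypothesis chiP : forall h, 0 < h -> exists b, gsb M A h b chi.

Definition lattice_point (k : 'I_d -> nat) : V := \row_i int_enum (k i).

(** Reflecting twice about the lattice point [k] restores [phi]: this is [f] applied to
    [y |-> phi y * chi (k - y)]. *)
Definition local_term (phi : F) (k : 'I_d -> nat) : R[i] :=
  fconv f (theta chi (lattice_point k) phi) (lattice_point k).

Lemma theta_GS t phi : BW phi -> S (theta chi t phi).
Proof.
move=> /BincrP H; apply/(GSP _ _ _ wA).
have [la [K [Ca [la0 Ca0 adm]]]] := admissible_exists admW 0.
have p2 : 0 < 2 :> R by [].
apply: hall_map (PosNum p2) _ H => h [sphi /(_ K)[b bphi]].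
have k0 : 0 < (pscale (PosNum p2) h)%:num by [].
have [C C0 HC] := theta_gsb wA M1_M M2_A chiP k0 la0.
have := HC (nweight (W 0)) (nweight (W K)) Ca b phi t Ca0 _ _ adm sphi bphi.
have -> : (pscale (PosNum p2) h)%:num / 2 = h%:num by rewrite /= mulrC mulKf.
by move=> H'; eexists; apply: H' => x; rewrite /nweight.
Qed.

Lemma local_term_lin a phi psi : BW phi -> BW psi ->
  local_term (a *: phi + psi) = fun k => a * local_term phi k + local_term psi k.
Proof.
move=> Bp Bq; apply/funext => k; rewrite /local_term theta_lin fconv_lin//; exact: theta_GS.
Qed.

(** Three estimates combine at the lattice point: [W N] from the uniform bound on convolutions, the
    inverse of [W L] from the localisation, and the summable quotient from [weight_decay2]. *)
Lemma local_term_bound : hex c (fun h => exists N, exists2 D, 0 <= D & forall phi b, BW phi ->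
  smooth phi -> ubd M h%:num (nweight (W N)) b phi ->
  forall k, Normc.normc (local_term phi k) <= D * b * \prod_i lat_weight (k i)).
Proof.
have p2 : 0 < 2 :> R by [].
apply: hex_map (PosNum p2) _ (conv_into_uniform wA f_cont incrW convf) => h [N [C C0 HC]].
have [L [Cd Cd0 Hd]] := weight_decay2 incrW decayW N.
have [la [K [Ca [la0 Ca0 adm]]]] := admissible_exists admW L.
have k0 : 0 < (pscale (PosNum p2) h)%:num by [].
have [C' C'0 HC'] := theta_gsb wA M1_M M2_A chiP k0 la0.
exists K, (C * (C' * Ca) * Cd); first by rewrite !mulr_ge0// ltW.
move=> phi b Bp sphi bphi k; set t := lattice_point k.
have b0 : 0 <= b by apply: ubd_ge0 bphi; exists 0; rewrite /nweight.
have wL0 x : 0 < nweight (W L) x by rewrite /nweight.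
have wK0 x : 0 <= nweight (W K) x by rewrite /nweight.
have gt := HC' _ _ _ _ _ t Ca0 wL0 wK0 adm sphi bphi.
rewrite (_ : (pscale (PosNum p2) h)%:num / 2 = h%:num) in gt; last by rewrite /= mulrC mulKf.
apply: le_trans (HC _ _ (theta_GS t Bp) gt t) _.
have := Hd t; have -> : \prod_i ((1 + `|t ord0 i|) ^+ 2)^-1 = \prod_i lat_weight (k i) :> R.
  by apply: eq_bigr => i _; rewrite mxE.
have := wL0 t; move: (\prod_i _) (nweight (W L) t) (nweight (W N) t) => P w wN w0 Hw.
have -> : C * (C' * Ca * b / w) * wN = C * (C' * Ca) * b * (wN / w) by ring.
have -> : C * (C' * Ca) * Cd * b * P = C * (C' * Ca) * b * (Cd * P) by ring.
apply: ler_wpM2l; first by rewrite !mulr_ge0// ltW.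
by rewrite ler_pdivrMr// mulrAC.
Qed.

Lemma box_sum_lin a phi psi n : BW phi -> BW psi -> box_sum n (local_term (a *: phi + psi)) =
  a * box_sum n (local_term phi) + box_sum n (local_term psi).
Proof. by move=> Bp Bq; rewrite local_term_lin// /box_sum big_split/= mulr_sumr. Qed.

Lemma local_sum_bound : hex c (fun h => exists N, exists2 D, 0 <= D & forall phi b, BW phi ->
  smooth phi -> ubd M h%:num (nweight (W N)) b phi -> 
  (forall n, Normc.normc (box_sum n (local_term phi)) <= D * b) /\
  forall e, 0 < e -> exists N, forall n m, (N <= n)%N -> (n <= m)%N ->
    Normc.normc (box_sum m (local_term phi) - box_sum n (local_term phi)) <= e).
Proof.
apply: hex_imp local_term_bound => h [N [D D0 HD]]; exists N, (D * 3 ^+ d).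
  by rewrite mulr_ge0// exprn_ge0.
move=> phi b Bp sphi bphi; have Hk := HD _ _ Bp sphi bphi.
have b0 : 0 <= b by apply: ubd_ge0 bphi; exists 0; rewrite /nweight.
have Db : 0 <= D * b by exact: mulr_ge0.
split=> [n|e e0].
  rewrite mulrAC; apply: le_trans (ler_wpM2l Db (box_weight_le n)).
  rewrite -box_sum_scale; apply: le_trans (normc_sum _ _ _) _; apply: ler_sum => g _.
  exact: Hk.
have [n0 Hn] := @box_weight_cauchy R d (e / (D * b + 1)) (divr_gt0 e0 (ltr_wpDl Db ltr01)).
exists n0 => n m nn nm; apply: le_trans (box_sum_diff nm Hk) _.
rewrite !box_sum_scale -mulrBr; apply: le_trans (ler_wpM2l Db (Hn _ _ nn nm)) _.
by rewrite mulrCA ler_piMr ?(ltW e0)// ler_pdivrMr ?mul1r ?lerDl// ltr_wpDl.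
Qed.

Lemma local_limit phi : BW phi -> exists l, forall e, 0 < e -> exists N, forall n, (N <= n)%N ->
  Normc.normc (box_sum n (local_term phi) - l) <= e.
Proof.
move=> Bp; have Bp' := proj1 (BincrP _ _ _ _) Bp.
have p1 : 0 < 1 :> R by [].
have [h [[sphi bp] [N [D D0 HD]]]] := hall_hex (PosNum p1) Bp' local_sum_bound.
have [b bb] := bp N.
have bb' : ubd M h%:num (nweight (W N)) b phi by move: bb; rewrite /= mul1r.
have [_ HC] := HD _ _ Bp sphi bb'.
apply: complex_cauchy => e e0; have [n0 Hn] := HC _ e0.
exists n0 => n m nn nm; have [le|lt] := leqP n m; last exact: Hn nm (ltnW lt).
by rewrite -normcN opprB; exact: Hn nn le.
Qed.

Lemma local_sum_functional : exists2 g : {linear Bincr c M W -> R[i]^o}, continuous g &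
  forall (phi : Bincr c M W) e, 0 < e -> exists N, forall n, (N <= n)%N ->
    Normc.normc (box_sum n (local_term (val phi)) - g phi) <= e.
Proof.
have ex (phi : Bincr c M W) := local_limit (lcs_eltP phi).
pose g phi : R[i]^o := projT1 (cid (ex phi)).
have gP phi : forall e, 0 < e -> exists N, forall n, (N <= n)%N ->
    Normc.normc (box_sum n (local_term (val phi)) - g phi) <= e by exact: (projT2 (cid (ex phi))).
have g_lin : linear g.
  move=> a phi psi; apply: complex_lim_unique (gP _) _ => e e0.
  have q0 : 0 < e / 2 by rewrite divr_gt0.
  have a0 : 0 < 1 + Normc.normc a by rewrite ltr_wpDr// normc_ge0.
  have [N1 H1] := gP phi _ (divr_gt0 q0 a0); have [N2 H2] := gP psi _ q0.
  exists (maxn N1 N2) => n; rewrite geq_max => /andP[/H1 n1 /H2 n2].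
  have -> : val (a *: phi + psi) = a *: val phi + val psi by rewrite linearP.
  rewrite (box_sum_lin a n (lcs_eltP phi) (lcs_eltP psi)).
  move: (box_sum n _) (box_sum n _) n1 n2 => v u n1 n2.
  rewrite [X in Normc.normc X](_ : _ = a * (u - g phi) + (v - g psi)); last first.
    by rewrite mulrBr addrACA -opprD.
  apply: le_trans (le_normcD _ _) _; rewrite [leRHS](splitr e) lerD// Normc.normcM.
  apply: le_trans (ler_wpM2l (normc_ge0 _) n1) _.
  by rewrite mulrCA ler_piMr ?(ltW q0)// ler_pdivrMr ?mul1r ?lerDr.
pose G := HB.pack g (GRing.isLinear.Build _ _ _ _ g g_lin) : {linear Bincr c M W -> R[i]^o}.
exists G; last exact: gP.
apply: dominated_linear; apply: (proj2 (Bincr_dominatedP incrW (linear_seminorm G))).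
apply: hex_imp local_sum_bound => h [N [D D0 HD]]; exists N, D => // phi b Bp /Bincr_stepP [sphi _] bphi.
have [HB _] := HD _ _ Bp sphi bphi.
have := gP (insubd 0 phi); rewrite lcs_insubdK// => gl.
rewrite -[X in Normc.normc X]subr0; apply: (normc_lim_le (N0 := 0%N) gl) => n _.
by rewrite subr0.
Qed.

End Functional.

(** * The lattice sum reproduces the functional *)

Section Reproduction.
Context {R : realType} {d : nat} {c : ultra_case} {M A : nat -> {posnum R}}.
Hypotheses (wA : weight_seq A) (M1_M : M1 M) (M2_A : M2 A).
Local Notation V := 'rV[R]_d.
Local Notation F := (V -> R[i]^o).
Local Notation S := (lcs_set (GS d c M A)).
Variable f : {linear GS d c M A -> R[i]^o}.
Hypothesis f_cont : continuous f.

Lemma fval_sum (I : Type) (r : seq I) (psi : I -> F) : (forall i, S (psi i)) ->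
  fval f (\sum_(i <- r) psi i) = \sum_(i <- r) fval f (psi i).
Proof.
move=> Sp; have Ss (s : seq I) : S (\sum_(i <- s) psi i).
  elim: s => [|i s IH]; first by rewrite big_nil; exact: lcs_set0.
  by rewrite big_cons -[psi i]scale1r; exact: lcs_setP.
elim: r => [|i r IH].
  rewrite !big_nil; have := @fval_lin _ _ _ _ _ f (-1) 0 0 (lcs_set0 _) (lcs_set0 _).
  by rewrite scaler0 addr0 mulN1r addNr.
by rewrite !big_cons -IH -[X in fval f (X + _)]scale1r fval_lin// mul1r.
Qed.

Lemma enorm_gsw H C h (x : V) :
  (forall t, 0 <= t -> eassoc A t * eassoc A t <= C * eassoc A (H * t)) -> 0 < h -> 0 <= C ->
  (1 + `|x|) * gsw A h x <= (1 + (A 1)%:num / (A 0)%:num / h) * C * gsw A (H * h) x.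
Proof.
move=> CH h0 C0; have hx : 0 <= h * enorm x by rewrite mulr_ge0 ?enorm_ge0 ?ltW.
have g1 : 1 <= gsw A h x by exact: gsw_ge1 (ltW h0).
have K0 : 0 <= (A 1)%:num / (A 0)%:num / h by rewrite !divr_ge0 // ltW.
have e1 : enorm x <= (A 1)%:num / (A 0)%:num / h * gsw A h x.
  have := @eassoc_pow _ _ wA 1%N _ hx; rewrite expr1 -/(gsw A h x).
  move: (gsw A h x) => g Hg.
  have -> : (A 1)%:num / (A 0)%:num / h * g = g * (A 1)%:num / ((A 0)%:num * h).
    by field; rewrite !gt_eqF.
  rewrite ler_pdivlMr ?mulr_gt0//; move: Hg; rewrite ler_pdivrMr//; apply: le_trans.
  by rewrite (_ : enorm x * _ = h * enorm x * (A 0)%:num)//; ring.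
have := gsw_mul x CH (ltW h0).
have nx := norm_le_enorm x.
move: g1 e1; move: (gsw A h x) (gsw A (H * h) x) ((A 1)%:num / _ / h) K0 => g g' K K0 g1 e1 gg.
have g0 : 0 <= g by exact: le_trans g1.
have K1 : 0 <= 1 + K by rewrite addr_ge0.
rewrite -mulrA; apply: le_trans (ler_wpM2l K1 gg).
rewrite mulrA; apply: ler_wpM2r => //; rewrite mulrDl mul1r; apply: lerD => //.
exact: le_trans e1.
Qed.

Variable G : 'I_d -> nat -> R -> R.
Hypotheses (jG : forall i, is_jet (G i)) (bG : forall i, step_bound M A (G i)).
Hypothesis lG : forall i, step_limits (G i).

(** [phi] times [1 - cutoff] is small in a norm that controls [f]: [cutoff_small] loses a factor
    [1 + |x|], which the decay of [phi] compensates. *)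
Lemma fval_cutoff phi e : S phi -> (forall n, S (fmul phi (cutoff G n.+1))) -> 0 < e ->
  exists N, forall n, (N <= n)%N -> Normc.normc (fval f (fmul phi (cutoff G n.+1)) - fval f phi) <= e.
Proof.
move=> Sp Sc e0; have [C2 [H [C21 H1 CH]]] := eassoc_sqr wA M2_A.
have C20 : 0 <= C2 by rewrite (le_trans ler01).
have H0 : 0 < H by exact: lt_le_trans H1.
(* In the parameter [2 * H * h] of [phi], 2 serves the Leibniz rule and [H] the factor [1 + |x|]. *)
have r0 : 0 < 2 * H by rewrite mulr_gt0.
have [h [[b [sphi bphi]] [C C0 HC]]] := hall_hex (PosNum r0) (proj1 (GSP _ _ _ wA) Sp) (fval_hex wA f_cont).
have h0 : 0 < h%:num by [].
have w0 (x : V) : 0 <= (1 + `|x|)^-1 by rewrite invr_ge0 addr_ge0.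
have k0 : 0 < (pscale (PosNum r0) h)%:num by [].
have kE : (pscale (PosNum r0) h)%:num = 2 * H * h%:num by [].
move: ((pscale (PosNum r0) h)%:num) k0 kE bphi => k k0 kE bphi.
have b0 : 0 <= b by apply: ubd_ge0 bphi; exists 0; exact: gsw_ge0.
set K := (1 + (A 1)%:num / (A 0)%:num / h%:num) * C2.
have K0 : 0 <= K by rewrite mulr_ge0// addr_ge0// !divr_ge0.
have D0 : 0 <= C * (K * (b * (M 0)%:num)) by rewrite !mulr_ge0.
have D1 : 0 < C * (K * (b * (M 0)%:num)) + 1 by rewrite ltr_wpDl.
pose e' := e / (C * (K * (b * (M 0)%:num)) + 1); have e'0 : 0 < e' by rewrite divr_gt0.
have [N HN] := cutoff_small wA M1_M jG bG lG k0 e'0.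
exists N => n Nn; have [bc sc] := HN n.+1 (leqW Nn).
have s1 : smooth (fcst 1 : F) by have [] := @pderivs_cst R d 1.
have sd := smoothB s1 sc.
have := ubd_mul M1_M k0 (fun x => gsw_ge0 A k x) w0 sphi sd bphi bc.
move=> bm; have sm : smooth (fmul phi (fcst 1 - cutoff G n.+1)) by exact: (proj1 (leibniz sphi sd)).
have {}bm : ubd M h%:num (gsw A h%:num) (K * (b * e' * (M 0)%:num)) (fmul phi (fcst 1 - cutoff G n.+1)).
  have hk : 0 <= h%:num <= k / 2.
    by rewrite (ltW h0) kE -mulrA [leRHS]mulrC mulKf//= ler_peMl// ltW.
  apply: (ubd_scale hk K0 _ bm) => x; have E := enorm_gsw x CH h0 C20.
  have x0 : 0 < 1 + `|x| by rewrite ltr_pwDl.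
  have g0 := gsw_ge0 A h%:num x.
  have gk : gsw A (H * h%:num) x <= gsw A k x.
    have Hh : 0 <= H * h%:num by rewrite mulr_ge0// ltW.
    by apply: (gsw_le wA) => //; rewrite kE -mulrA ler_peMl ?ler1n.
  rewrite -/K in E; move: (gsw A _ x) (gsw A _ x) (gsw A _ x) g0 E gk => g1 g2 g3 g0 E gk.
  rewrite g0/= mulrA ler_pdivlMr// mulrC; apply: (le_trans E).
  by apply: ler_wpM2l.
have Sd : S (fmul phi (fcst 1 - cutoff G n.+1)).
  rewrite (_ : fmul _ _ = (-1) *: fmul phi (cutoff G n.+1) + phi); first exact: lcs_setP.
  apply/funext => x; change (phi x * (1 - cutoff G n.+1 x) = -1 * (phi x * cutoff G n.+1 x) + phi x).
  by rewrite mulrBr mulr1 mulN1r addrC.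
rewrite (_ : fmul phi (cutoff G n.+1) = (-1) *: fmul phi (fcst 1 - cutoff G n.+1) + phi); last first.
  apply/funext => x; change (phi x * cutoff G n.+1 x = -1 * (phi x * (1 - cutoff G n.+1 x)) + phi x).
  by rewrite mulrBr mulr1 mulN1r opprB subrK.
rewrite fval_lin// addrK mulN1r normcN.
apply: le_trans (HC _ _ Sd (conj sm bm)) _.
rewrite /e' (_ : C * _ = e * (C * (K * (b * (M 0)%:num))) / (C * (K * (b * (M 0)%:num)) + 1)); last by ring.
by rewrite ler_pdivrMr// ler_wpM2l ?(ltW e0)// lerDl.
Qed.

(** As the window is a product over the coordinates, the box sum factors into one-dimensional sums,
    and each of them telescopes. *)
Lemma box_sum_cutoff n (phi : F) x :
  box_sum n (fun k => refl_trans (lattice_point k) (theta (lattice_window G) (lattice_point k) phi) x) =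
  fmul phi (cutoff G n.+1) x.
Proof.
have E k : refl_trans (lattice_point k) (theta (lattice_window G) (lattice_point k) phi) x =
    phi x * \prod_i (window (G i) 0 (int_enum (k i) - x ord0 i))%:C%C.
  rewrite /refl_trans /theta /fmul /refl_trans /lattice_window subKr coord_prodE; congr (_ * _).
  by apply: eq_bigr => i _; rewrite !mxE.
under eq_fun do rewrite E.
rewrite /box_sum -mulr_sumr /fmul; congr (_ * _).
rewrite -/(box_sum n (fun k => \prod_i (window (G i) 0 (int_enum (k i) - x ord0 i))%:C%C)).
rewrite (box_sum_prod n (fun i j => (window (G i) 0 (int_enum j - x ord0 i))%:C%C)).
rewrite /cutoff coord_prodE; apply: eq_bigr => i _; rewrite -rmorph_sum; congr (_%:C%C).
rewrite (int_enum_telescope (G i 0%N) (x ord0 i) n.+1) /cocutoff subKr expr0 !mul1r.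
by rewrite !mulN1r.
Qed.

End Reproduction.

(** * Conclusion *)

Lemma conv_into_in_dual (R : realType) (d : nat) (c : ultra_case)
    (M A : nat -> {posnum R}) (W : nat -> 'rV[R]_d -> {posnum R})
    (wA : weight_seq A) (M1_M : M1 M) (M2_M : M2 M) (M2_A : M2 A)
    (GS_neq0 : exists phi : GS d Beurling M A, phi <> 0)
    (incrW : incr_weight_system W) (decayW : weight_decay W) (admW : admissible c A W)
    (f : {linear GS d c M A -> R[i]^o}) (f_cont : continuous f) :
  conv_into f (Cdecr (dual_weights W)) -> in_dual f (Bincr c M W).
Proof.
move=> convf; have [phi0 phi0_neq0] := GS_neq0.
have [x0 phix0] : exists x0, val phi0 x0 <> 0.
  apply: contrapT => H; apply: phi0_neq0; apply: val_inj; apply/funext => x.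
  by apply: contrapT => Hx; apply: H; exists x.
pose G (i : 'I_d) := projT1 (cid (step_jet wA M1_M i (lcs_eltP phi0) phix0)).
have GP i := projT2 (cid (step_jet wA M1_M i (lcs_eltP phi0) phix0)).
have jG i : is_jet (G i) by case: (GP i).
have bG i : step_bound M A (G i) by case: (GP i).
have lG i : step_limits (G i) by case: (GP i) => ? ? ? ?; split.
have chiP := lattice_window_gsb wA M1_M jG bG.
have [g cg gP] := local_sum_functional wA M1_M M2_A incrW decayW admW f_cont convf chiP.
exists g => // phi; have Sphi := lcs_eltP phi; have Bphi := GS_Bincr wA admW Sphi.
exists (insubd 0 (val phi)); first by rewrite lcs_insubdK.
have St k : lcs_set (GS d c M A) (refl_trans (lattice_point k) (theta (lattice_window G) (lattice_point k) (val phi))).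
  by apply: GS_refl => //; apply: (theta_GS wA M1_M M2_A admW chiP) Bphi.
have Ec n : fmul (val phi) (cutoff G n.+1) = \sum_(h : {ffun 'I_d -> 'I_(n.*2.+2)})
    refl_trans (lattice_point (fun i => h i)) (theta (lattice_window G) (lattice_point (fun i => h i)) (val phi)).
  by apply/funext => x; rewrite -box_sum_cutoff fct_sumE.
have Eb n : box_sum n (local_term f (lattice_window G) (val phi)) = fval f (fmul (val phi) (cutoff G n.+1)).
  by rewrite Ec fval_sum// => h; exact: St.
suff -> : g (insubd 0 (val phi)) = fval f (val phi) by rewrite /fval lcs_insubd_val.
have gl := gP (insubd 0 (val phi)); rewrite lcs_insubdK// in gl.
apply: (complex_lim_unique gl) => e e0.
have [|N HN] := fval_cutoff wA M1_M M2_A f_cont jG bG lG Sphi _ e0.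
  (* [phi] times a cutoff lies in the space because it is a finite sum of localised pieces. *)
  by move=> n; rewrite Ec; apply: big_ind => [|x y Sx Sy|h _];
    [exact: lcs_set0|rewrite -[x]scale1r; exact: lcs_setP|exact: St].
by exists N => n /HN; rewrite Eb.
Qed.

Theorem theorem4p19 (R : realType) (d : nat) (c : ultra_case)
    (M A : nat -> {posnum R}) (W : nat -> 'rV[R]_d -> {posnum R})
    (wM : weight_seq M) (wA : weight_seq A)
    (M1_M : M1 M) (M2_M : M2 M) (M1_A : M1 A) (M2_A : M2 A)
    (fact_prec : seq_prec (fun p => p`!%:R) (fun p => (M p)%:num * (A p)%:num))
    (GS_neq0 : exists phi : GS d Beurling M A, phi <> 0)
    (incrW : incr_weight_system W) (decayW : weight_decay W)
    (admW : admissible c A W)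
    (f : {linear GS d c M A -> R[i]^o}) (f_cont : continuous f) :
  [<-> in_dual f (Bincr c M W);
       conv_into f (Cdecr (dual_weights W));
       conv_into f (Cdecr (dual_weights W)) /\
         conv_continuous f (Cdecr (dual_weights W));
       conv_into f (Bdecr c M (dual_weights W));
       conv_into f (Bdecr c M (dual_weights W)) /\
         conv_continuous f (Bdecr c M (dual_weights W))].
Proof.
have r10 := conv_into_in_dual wA M1_M M2_M M2_A GS_neq0 incrW decayW admW f_cont.
have r04 : in_dual f (Bincr c M W) -> conv_into f (Bdecr c M (dual_weights W)) /\
    conv_continuous f (Bdecr c M (dual_weights W)).
  move=> /(dual_fconv_uniform wA M2_M f_cont incrW admW)[H H1 unif]; split.
    by move=> phi; rewrite fconvE; exact: (fconv_Bdecr wA M2_M f_cont H1 unif (lcs_eltP phi)).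
  exact: (fconv_Bdecr_continuous wA M2_M f_cont H1 unif).
have r31 : conv_into f (Bdecr c M (dual_weights W)) -> conv_into f (Cdecr (dual_weights W)).
  by move=> H phi; exact: Bdecr_Cdecr (H phi).
(* Continuity into [Cdecr] is inherited from [Bdecr] through the inclusion. *)
have r02 : in_dual f (Bincr c M W) -> conv_into f (Cdecr (dual_weights W)) /\
    conv_continuous f (Cdecr (dual_weights W)).
  move=> /r04[H3 [T TE cT]]; split; first exact: r31.
  have [J JE cJ] := Bdecr_Cdecr_continuous c M (dual_weights W).
  exists (J \o T) => [phi|phi]; first by rewrite /= JE TE.
  by apply: continuous_comp; [exact: cT|exact: cJ].
split; first by move=> /r04[/r31].
split; first by move=> /r10/r02.
split; first by move=> [/r10/r04[]].
split; first by move=> /r31/r10/r04.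
by move=> [/r31/r10].
Qed.
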